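(* Let $-A$ be the generator of a bounded $C_0$-semigroup $(e^{-tA})_{t\ge 0}$ on a complex Banach space $X$. Suppose that $\overline{\mathrm{ran}}(A)=X$ and that $\sigma(A)\cap i\mathbb R$ has an accumulation point at infinity (i.e. is unbounded). If $f\in\tilde{\mathcal S}_2$, $f\neq 0$, then $$\limsup_{\sqrt n/t\to\infty}\frac{\|f(A)\Delta_{n,t}(A)\|}{f(\sqrt n/t)}>0.$$
   Context: $\mathbb C_+=\{z\in\mathbb C:\mathrm{Re}\,z>0\}$, $\mathbb R_+=[0,\infty)$; $\sigma(A)$ is the spectrum of $A$; $\mathrm{dom}$ and $\mathrm{ran}$ denote domain and range, and $\overline{\mathrm{ran}}(A)$ is the norm-closure of the range. For $n\in\mathbb N$, $t>0$: $\Delta_{n,t}(A):=\left(1+\frac tn A\right)^{-n}-e^{-tA}$. For a quantity $F(n,t)$, $\limsup_{\sqrt n/t\to\infty}F(n,t)$ means $\lim_{R\to\infty}\sup\{F(n,t): n\in\mathbb N,\ t>0,\ \sqrt n/t\ge R\}$. Stieltjes functions: a function $f:(0,\infty)\to[0,\infty)$ belongs to $\mathcal S$ if $f(z)=a+\int_0^\infty\frac{\mu(d\tau)}{z+\tau}$ for $z>0$, where $a\ge 0$ and $\mu$ is a positive Radon measure on $[0,\infty)$ with $\int_0^\infty\frac{\mu(d\tau)}{1+\tau}<\infty$; $f$ is identified with its unique analytic extension to $\mathbb C\setminus(-\infty,0]$. Further, $\tilde{\mathcal S}_2:=\{f_1\cdot f_2: f_1,f_2\in\mathcal S\}$. Functional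 calculus: $M(\mathbb R_+)$ is the Banach algebra of bounded (complex) Radon measures on $\mathbb R_+$, $(\mathcal L\mu)(z)=\int_0^\infty e^{-sz}\mu(ds)$ for $z\in\mathbb C_+$, and $A^1_+(\mathbb C_+)=\{\mathcal L\mu:\mu\in M(\mathbb R_+)\}$. For $g=\mathcal L\mu\in A^1_+(\mathbb C_+)$, $g(A)x:=\int_0^\infty e^{-sA}x\,\mu(ds)$ for $x\in X$. If $f:\mathbb C_+\to\mathbb C$ is holomorphic and there is $e\in A^1_+(\mathbb C_+)$ (a regularizer) with $ef\in A^1_+(\mathbb C_+)$ and $e(A)$ injective, then $f(A):=e(A)^{-1}(ef)(A)$ with $\mathrm{dom}(f(A))=\{x\in X:(ef)(A)x\in\mathrm{ran}(e(A))\}$; this does not depend on the choice of $e$ (extended Hille–Phillips calculus). For $\overline{\mathrm{ran}}(A)=X$ every $f\in\tilde{\mathcal S}_2$ is regularizable by $e(z)=z^2/(1+z)^2$, and $f(A)\Delta_{n,t}(A)$ (with natural domain) is an everywhere defined bounded operator on $X$; $\|\cdot\|$ is its operator norm. *)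

(* Defs.v *)
From HB Require Import structures.
From mathcomp Require Import all_boot all_order all_algebra.
From mathcomp Require Import complex.
From mathcomp Require Import all_classical all_reals all_analysis.

Set Implicit Arguments.
Unset Strict Implicit.
Unset Printing Implicit Defensive.

Import Order.TTheory GRing.Theory Num.Theory.
Import numFieldNormedType.Exports.

Local Open Scope classical_set_scope.
Local Open Scope ring_scope.
Local Open Scope complex_scope.

(* The norm of a normed space over R[i] takes its values in R[i]; they are
   real, and rnorm reads them in R. *)
Definition rnorm (R : realType) (V : normedModType R[i]) (x : V) : R :=
  complex.Re `|x|.

Definition Rplus (R : realType) : set R := `[0, +oo[.
Arguments Rplus : clear implicits.

Definition Cplus (R : realType) : set R[i] := [set z | 0 < complex.Re z].
Arguments Cplus : clear implicits.

Definition slit_plane (R : realType) : set R[i] :=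
  [set z | ~ (complex.Im z = 0 /\ complex.Re z <= 0)].
Arguments slit_plane : clear implicits.

Definition cexp (R : realType) (z : R[i]) : R[i] :=
  (expR (complex.Re z))%:C *
    (cos (complex.Im z) +i* sin (complex.Im z)).

Definition holomorphic_on (R : realType) (U : set R[i]) (F : R[i] -> R[i]) :
    Prop :=
  forall z : R[i], U z -> derivable (F : R[i]^o -> R[i]^o) z 1.

(** Unbounded operators on X, represented by their graphs. *)

Section Operators.
Variables (R : realType) (X : normedModType R[i]).
Implicit Types (A B : set (X * X)) (S : X -> X) (c : R[i]).

Definition op_graph S : set (X * X) := [set p | p.2 = S p.1].

Definition op_dom A : set X := [set x | exists y, A (x, y)].
Definition op_ran A : set X := [set y | exists x, A (x, y)].

Definition op_inv A : set (X * X) := [set p | A (p.2, p.1)].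

Definition op_scale c A : set (X * X) :=
  [set p | exists2 y, A (p.1, y) & p.2 = c *: y].

Definition op_add A B : set (X * X) :=
  [set p | exists y z, [/\ A (p.1, y), B (p.1, z) & p.2 = y + z]].

Definition op_opp A := op_scale (-1) A.
Definition op_sub A B := op_add A (op_opp B).

(* B is applied first; natural domain *)
Definition op_comp A B : set (X * X) :=
  [set p | exists2 y, B (p.1, y) & A (y, p.2)].

Definition op_id : set (X * X) := op_graph id.

Definition op_pow (n : nat) A : set (X * X) := iter n (op_comp A) op_id.

(* The value is +oo when A is unbounded on its domain. *)
Definition op_norm A : \bar R :=
  ereal_sup [set (rnorm p.2)%:E | p in [set p | A p /\ rnorm p.1 <= 1]].

Definition bounded_operator S : Prop := linear S /\ continuous S.

Definition resolvent_set A : set R[i] :=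
  [set lam | exists2 S, bounded_operator S &
     op_inv (op_sub (op_scale lam op_id) A) = op_graph S].

Definition spectrum A : set R[i] := ~` resolvent_set A.

End Operators.

Arguments op_id {R X}.

Section Semigroups.
Variables (R : realType) (X : normedModType R[i]).

(* Only the values T t for t >= 0 are meaningful. *)
Definition c0_semigroup (T : R -> X -> X) : Prop :=
  [/\ forall t : R, 0 <= t -> bounded_operator (T t),
      T 0 = id,
      forall s t : R, 0 <= s -> 0 <= t -> T (s + t) = T s \o T t
    & forall x, T t x @[t --> 0^'+] --> x].

Definition bounded_semigroup (T : R -> X -> X) : Prop :=
  exists M : R, forall (t : R) x, 0 <= t -> rnorm (T t x) <= M * rnorm x.

Definition generator (T : R -> X -> X) : set (X * X) :=
  [set p | (h^-1)%:C *: (T h p.1 - p.1) @[h --> 0^'+] --> p.2].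

End Semigroups.

(** Bochner integration with respect to finite measures on the real line. *)

Section Bochner.
Variables (R : realType) (V : normedModType R[i]).
Local Notation mR := (measurableTypeR R).

Definition simple_integral (m : {finite_measure set mR -> \bar R})
    (D : set R) (s : R -> V) : V :=
  \sum_(v \in range s) (fine (m (D `&` s @^-1` [set v])))%:C *: v.

Definition is_bochner_integral (m : {finite_measure set mR -> \bar R})
    (D : set R) (f : R -> V) (y : V) : Prop :=
  exists s : nat -> {fimfun R >-> V},
  [/\ forall n v, measurable (s n @^-1` [set v] : set mR),
      {ae m, forall t : mR, D t -> s n t @[n --> \oo] --> f t},
      (\int[m]_(t in D) (rnorm (f t - s n t))%:E)%E @[n --> \oo] --> 0%E
    & simple_integral m D (s n) @[n --> \oo] --> y].

Definition bochner_integral m D f : V := get (is_bochner_integral m D f).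

(* The Jordan decomposition of nu does not depend on the Hahn decomposition
   chosen by cid. *)
Definition charge_integral (nu : {charge set mR -> \bar R})
    (D : set R) (f : R -> V) : V :=
  let PN := projT2 (cid (projT2 (cid (Hahn_decomposition nu)))) in
  bochner_integral (jordan_pos PN) D f - bochner_integral (jordan_neg PN) D f.

End Bochner.

(* A bounded complex Borel measure on R, given by its real and imaginary parts;
   on the real line every such measure is Radon. Below it is only integrated
   over [0, +oo[, that is, it stands for its restriction to [0, +oo[; every
   bounded complex Radon measure on [0, +oo[ is obtained in this way. *)
Record cmeasure (R : realType) := CMeasure {
  cm_re : {charge set (measurableTypeR R) -> \bar R};
  cm_im : {charge set (measurableTypeR R) -> \bar R}
}.

Definition cm_integral (R : realType) (V : normedModType R[i])
    (mu : cmeasure R) (f : R -> V) : V :=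
  charge_integral (cm_re mu) (Rplus R) f +
  'i%C *: charge_integral (cm_im mu) (Rplus R) f.

Definition laplace (R : realType) (mu : cmeasure R) (z : R[i]) : R[i] :=
  cm_integral mu (fun s : R => cexp (- (s%:C * z)) : R[i]^o).

(** Extended Hille-Phillips calculus of A, where T t = exp (- t A). *)

Section FunctionalCalculus.
Variables (R : realType) (X : normedModType R[i]).

Definition hp_op (T : R -> X -> X) (mu : cmeasure R) (x : X) : X :=
  cm_integral mu (fun s => T s x).

(* laplace mu is a regularizer e of F, and laplace nu = e F *)
Definition regularizes (T : R -> X -> X) (F : R[i] -> R[i])
    (mu nu : cmeasure R) : Prop :=
  injective (hp_op T mu) /\
  forall z, Cplus R z -> laplace nu z = laplace mu z * F z.

(* The operator e(A)^-1 (eF)(A) does not depend on the regularizer e, so that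
   the union of its graphs over all the regularizers is its graph. *)
Definition hp_calculus (T : R -> X -> X) (F : R[i] -> R[i]) : set (X * X) :=
  [set p | holomorphic_on (Cplus R) F /\
     exists mu nu, regularizes T F mu nu /\
       op_comp (op_inv (op_graph (hp_op T mu))) (op_graph (hp_op T nu)) p].

Definition euler_error (T : R -> X -> X) (A : set (X * X)) (n : nat) (t : R) :
    set (X * X) :=
  op_sub
    (op_pow n (op_inv (op_add op_id (op_scale (t / n%:R)%:C A))))
    (op_graph (T t)).

End FunctionalCalculus.

(** Stieltjes functions; only their values on (0, +oo) are meaningful. *)

(* The integrability condition makes mu finite on bounded subsets of
   [0, +oo[, hence Radon there. *)
Definition stieltjes (R : realType) (f : R -> R) : Prop :=
  exists (a : R) (mu : {measure set (measurableTypeR R) -> \bar R}),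
  [/\ 0 <= a,
      (\int[mu]_(tau in Rplus R) ((1 + tau)^-1)%:E < +oo)%E
    & forall z : R, 0 < z ->
        (f z)%:E = (a%:E + \int[mu]_(tau in Rplus R) ((z + tau)^-1)%:E)%E].

Definition stieltjes_prod2 (R : realType) (f : R -> R) : Prop :=
  exists f1 f2 : R -> R, [/\ stieltjes f1, stieltjes f2
    & forall z : R, 0 < z -> f z = f1 z * f2 z].

Definition analytic_extension (R : realType) (f : R -> R) (F : R[i] -> R[i]) :
    Prop :=
  holomorphic_on (slit_plane R) F /\ forall z : R, 0 < z -> F z%:C = (f z)%:C.

(* lim_(r -> +oo) of the supremum of Q n t over all n >= 1 and t > 0
   such that sqrt n / t >= r *)
Definition limsup_sqrtn_t (R : realType) (Q : nat -> R -> \bar R) : \bar R :=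
  lim (ereal_sup [set Q p.1 p.2 | p in [set p : nat * R |
         [/\ (0 < p.1)%N, 0 < p.2 & r <= Num.sqrt p.1%:R / p.2]]]
       @[r --> +oo]).

(* Main.v *)
From HB Require Import structures.
Require Import Defs.
From mathcomp Require Import all_boot all_order all_algebra.
From mathcomp Require Import complex.
From mathcomp Require Import all_classical all_reals all_analysis.
From mathcomp Require Import measurable_realfun.
From mathcomp Require Import ring lra.

Set Implicit Arguments.
Unset Strict Implicit.
Unset Printing Implicit Defensive.

Import Order.TTheory GRing.Theory Num.Theory.
Import numFieldNormedType.Exports.

Local Open Scope classical_set_scope.
Local Open Scope ring_scope.
Local Open Scope complex_scope.

(** The lower bound is already attained for n = 1. Let i eta be a spectral point of
    A with |eta| large and let t = 1 / |eta|, so that sqrt n / t = |eta|. At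
    z = i eta the function f(z) ((1 + t z)^-1 - exp (- t z)) has modulus at least
    c f(|eta|) with an absolute constant c > 0: the second factor only depends on
    t eta, which is 1 or -1, and |f(i eta)| >= f(|eta|) / 4 when f is a product of
    two Stieltjes functions (stt_lower). As i eta is an approximate eigenvalue of A,
    the norm of the operator is at least the modulus of this value.

    To make this precise, the functional calculus is computed on approximate
    eigenvectors.

    - The regularizer is e(z) = z^2 / ((1 + z) (2 + z)) = (1 - Q_1) (1 - Q_2), where
      Q_l(z) = l / (l + z) is the Laplace transform of an exponential distribution.
      The operator e(A) is a product of two operators 1 - l (l + A)^-1, and it is
      injective because A has dense range (regularizer_injective). The resolvents
      are obtained by averaging the semigroup over exponential times (resol_gen).
    - If f = f1 f2, then (1 - Q_1) f1 and (1 - Q_2) f2 are Laplace transforms of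
      signed measures: this is checked on the positive real axis with Tonelli's
      theorem (stieltjes_repr), and it carries over to the product e f by convolution
      (lapr_conv). The uniqueness of analytic continuation (identity_Cplus) extends
      the identity to the right half-plane, and continuity to its boundary
      (regularized).
    - If a spectral point i eta were not an approximate eigenvalue, i eta - A would
      be bounded below, and the bounded solutions of the resolvent equation near
      i eta would provide a bounded inverse (gen_onto, approx_eigenvector).
    - If u is an approximate eigenvector and z = u + t A u, then
      (1 + t A)^-1 z - T(t) z = u - T(t) z. Hence the pair formed by e(A) z and
      (e f)(A) (u - T(t) z) lies in the graph of f(A) Delta_{1,t}(A)
      (calculus_pair). Both members are close to multiples of u (hp_op_approx), and
      the quotient of their norms gives the bound (calculus_norm_lower).

    Two tools are developed from first principles. Bochner integrals of bounded
    continuous functions are limits of Riemann sums (rsum_cvg), from which their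
    properties follow. Uniqueness of analytic continuation is derived from Goursat's
    theorem without power series: a function g that vanishes on the real axis has a
    primitive H that vanishes there; the maximum principle on the upper half disc,
    applied to H psi^N, where psi has modulus 1 on the circle and more than 1
    inside, shows that H = 0. *)

(** * Real-valued norms *)

Section RealNorm.
Variables (R : realType) (V : normedModType R[i]).
Implicit Types (x y : V) (c : R[i]).

Lemma normE_rnorm x : `|x| = (rnorm x)%:C.
Proof.
rewrite /rnorm; have := normr_ge0 x.
by case: (`|x|) => a b; rewrite lecE /= => /andP[/eqP -> _].
Qed.

Lemma rnorm_ge0 x : 0 <= rnorm x.
Proof. by have := normr_ge0 x; rewrite normE_rnorm lecE /= => /andP[]. Qed.

Lemma rnorm0 : rnorm (0 : V) = 0.
Proof. by rewrite /rnorm normr0. Qed.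

Lemma rnorm_eq0 x : rnorm x = 0 -> x = 0.
Proof. by move=> h; apply/eqP; rewrite -normr_eq0 normE_rnorm h. Qed.

Lemma rnormN x : rnorm (- x) = rnorm x.
Proof. by rewrite /rnorm normrN. Qed.

Lemma rnorm_distC x y : rnorm (x - y) = rnorm (y - x).
Proof. by rewrite /rnorm distrC. Qed.

Lemma rnormD x y : rnorm (x + y) <= rnorm x + rnorm y.
Proof.
have := ler_normD x y; rewrite !normE_rnorm.
by rewrite lecE /= => /andP[].
Qed.

Lemma rnormB x y : rnorm (x - y) <= rnorm x + rnorm y.
Proof. by rewrite -(rnormN y) rnormD. Qed.

Lemma rnorm_dist x y z : rnorm (x - z) <= rnorm (x - y) + rnorm (y - z).
Proof. by rewrite -{1}(subrK y x) -addrA rnormD. Qed.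

Lemma rnorm_lb x y : rnorm x - rnorm y <= rnorm (x - y).
Proof. by rewrite lerBlDr -{1}(subrK y x) rnormD. Qed.

Lemma rnorm_sum (I : Type) (r : seq I) (P : pred I) (F : I -> V) :
  rnorm (\sum_(i <- r | P i) F i) <= \sum_(i <- r | P i) rnorm (F i).
Proof.
elim/big_ind2 : _ => [|a b c d h1 h2|//]; first by rewrite rnorm0.
by rewrite (le_trans (rnormD _ _)) // lerD.
Qed.

Lemma cvg_rnormP (I : Type) (F : set_system I) (FF : Filter F) (f : I -> V) y :
  f @ F --> y <-> forall e : R, 0 < e -> \forall t \near F, rnorm (y - f t) < e.
Proof.
split=> [/cvgrPdist_lt h e e0|h].
  have : 0 < e%:C :> R[i] by rewrite ltcR.
  move=> /h; apply: filterS => t; rewrite normE_rnorm ltcR; exact.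
apply/cvgrPdist_lt => -[a b]; rewrite ltcE /= => /andP[/eqP -> a0].
by move: (h a a0); apply: filterS => t; rewrite normE_rnorm -[a +i* 0]/(a%:C) ltcR.
Qed.

Lemma nbhs_rnormP y (P : set V) :
  nbhs y P <-> exists2 e : R, 0 < e & forall x, rnorm (y - x) < e -> P x.
Proof.
split.
  move/nbhs_normP => [[a b]] /=; rewrite ltcE /= => /andP[/eqP -> a0] h.
  exists a => // x hx; apply: h => /=.
  by rewrite /ball_ /= normE_rnorm -[a +i* 0]/(a%:C) ltcR.
case=> e e0 h; apply/nbhs_normP; exists e%:C; first by rewrite /= ltcR.
by move=> x; rewrite /ball_ /= normE_rnorm ltcR => /h.
Qed.

End RealNorm.

(** An instance of rnorm, so that the lemmas above apply to it. *)
Definition cabs (R : realType) (z : R[i]) : R := @rnorm R (R[i]^o) z.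

Section Modulus.
Variable R : realType.
Implicit Types (z w : R[i]) (x : R).

Lemma cabsE z : cabs z = Num.sqrt (complex.Re z ^+ 2 + complex.Im z ^+ 2).
Proof. by rewrite /cabs /rnorm normc_def. Qed.

Lemma rnormZ (V : normedModType R[i]) z (x : V) :
  rnorm (z *: x) = cabs z * rnorm x.
Proof.
have := normrZ z x; rewrite !normE_rnorm.
have -> : `|z| = (cabs z)%:C by rewrite -normE_rnorm.
by rewrite -rmorphM => /complexI.
Qed.

Lemma cabsM z w : cabs (z * w) = cabs z * cabs w.
Proof. exact: (@rnormZ (R[i]^o)). Qed.

Lemma cabs_ge0 z : 0 <= cabs z. Proof. exact: rnorm_ge0. Qed.

Lemma cabs_sq z : cabs z ^+ 2 = complex.Re z ^+ 2 + complex.Im z ^+ 2.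
Proof. by rewrite cabsE sqr_sqrtr // addr_ge0 // sqr_ge0. Qed.

Lemma cabs_real x : cabs x%:C = `|x|.
Proof. by rewrite cabsE /= expr0n addr0 sqrtr_sqr. Qed.

Lemma cabs_i : cabs ('i%C : R[i]) = 1.
Proof. by rewrite cabsE /= expr0n add0r expr1n sqrtr1. Qed.

Lemma cabs0 : cabs (0 : R[i]) = 0. Proof. exact: rnorm0. Qed.

Lemma cabs1 : cabs (1 : R[i]) = 1.
Proof. by rewrite -[1]/((1 : R)%:C) cabs_real normr1. Qed.

Lemma cabsN z : cabs (- z) = cabs z. Proof. exact: rnormN. Qed.

Lemma cabsD z w : cabs (z + w) <= cabs z + cabs w.
Proof. exact: rnormD. Qed.

Lemma cabsB z w : cabs (z - w) <= cabs z + cabs w.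
Proof. exact: rnormB. Qed.

Lemma cabs_distC z w : cabs (z - w) = cabs (w - z).
Proof. exact: rnorm_distC. Qed.

Lemma cabs_eq0 z : cabs z = 0 -> z = 0. Proof. exact: rnorm_eq0. Qed.

Lemma cabs_gt0 z : z != 0 -> 0 < cabs z.
Proof.
move=> z0; rewrite lt_neqAle cabs_ge0 andbT eq_sym.
by apply: contra z0 => /eqP /cabs_eq0 ->.
Qed.

Lemma cabsV z : cabs z^-1 = (cabs z)^-1.
Proof.
have [->|z0] := eqVneq z 0; first by rewrite invr0 cabs0 invr0.
have h := cabs_gt0 z0; apply: (mulfI (lt0r_neq0 h)).
by rewrite -cabsM (divff z0) (divff (lt0r_neq0 h)) cabs1.
Qed.

Lemma cabsX z n : cabs (z ^+ n) = cabs z ^+ n.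
Proof. by elim: n => [|n IH]; rewrite ?expr0 ?cabs1 // !exprS cabsM IH. Qed.

Lemma Re_le_cabs z : `|complex.Re z| <= cabs z.
Proof.
rewrite -(@ler_pXn2r _ 2) ?nnegrE ?cabs_ge0 // cabs_sq real_normK ?num_real //.
by rewrite lerDl sqr_ge0.
Qed.

Lemma Im_le_cabs z : `|complex.Im z| <= cabs z.
Proof.
rewrite -(@ler_pXn2r _ 2) ?nnegrE ?cabs_ge0 // cabs_sq real_normK ?num_real //.
by rewrite lerDr sqr_ge0.
Qed.

Lemma complexRI z : z = (complex.Re z)%:C + 'i%C * (complex.Im z)%:C.
Proof. by case: z => a b; rewrite {1}[a +i* b]complexE. Qed.

Lemma cabs_le_ReIm z : cabs z <= `|complex.Re z| + `|complex.Im z|.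
Proof.
rewrite {1}(complexRI z) (le_trans (cabsD _ _)) // cabsM cabs_i mul1r.
by rewrite !cabs_real.
Qed.

Lemma complexP z w :
  complex.Re z = complex.Re w -> complex.Im z = complex.Im w -> z = w.
Proof. by case: z w => [a b] [c d] /= -> ->. Qed.

Lemma cReM z w : complex.Re (z * w) =
  complex.Re z * complex.Re w - complex.Im z * complex.Im w.
Proof. by case: z w => [a b] [c d]. Qed.

Lemma cImM z w : complex.Im (z * w) =
  complex.Re z * complex.Im w + complex.Im z * complex.Re w.
Proof. by case: z w => [a b] [c d]. Qed.

Lemma cReD z w : complex.Re (z + w) = complex.Re z + complex.Re w.
Proof. by case: z w => [a b] [c d]. Qed.

Lemma cImD z w : complex.Im (z + w) = complex.Im z + complex.Im w.
Proof. by case: z w => [a b] [c d]. Qed.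

Lemma cReN z : complex.Re (- z) = - complex.Re z.
Proof. by case: z. Qed.

Lemma cImN z : complex.Im (- z) = - complex.Im z.
Proof. by case: z. Qed.

Lemma cReB z w : complex.Re (z - w) = complex.Re z - complex.Re w.
Proof. by rewrite cReD cReN. Qed.

Lemma cImB z w : complex.Im (z - w) = complex.Im z - complex.Im w.
Proof. by rewrite cImD cImN. Qed.

End Modulus.

Lemma cvg_cabsP (R : realType) (I : Type) (F : set_system I) (FF : Filter F)
    (h : I -> R[i]) (y : R[i]) :
  h t @[t --> F] --> (y : R[i]^o) <->
  forall e : R, 0 < e -> \forall t \near F, cabs (y - h t) < e.
Proof. exact: (@cvg_rnormP R (R[i]^o)). Qed.

Section ComplexLimits.
Variables (R : realType) (I : Type) (F : set_system I).
Context {FF : Filter F}.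
Implicit Types (f g : I -> R[i]) (a b : R[i]).

Lemma ccvgM f g a b : f t @[t --> F] --> (a : R[i]^o) ->
  g t @[t --> F] --> (b : R[i]^o) -> f t * g t @[t --> F] --> (a * b : R[i]^o).
Proof. exact: (@cvgM R[i] I F FF f g a b). Qed.

Lemma ccvgD f g a b : f t @[t --> F] --> (a : R[i]^o) ->
  g t @[t --> F] --> (b : R[i]^o) -> f t + g t @[t --> F] --> (a + b : R[i]^o).
Proof. exact: (@cvgD R[i] (R[i]^o) I F FF f g a b). Qed.

Lemma ccvgN f a : f t @[t --> F] --> (a : R[i]^o) ->
  - f t @[t --> F] --> (- a : R[i]^o).
Proof. exact: (@cvgN R[i] (R[i]^o) I F FF f a). Qed.

Lemma ccvgV f a : a != 0 -> f t @[t --> F] --> (a : R[i]^o) ->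
  (f t)^-1 @[t --> F] --> (a^-1 : R[i]^o).
Proof. by move=> a0; exact: (@cvgV R[i] I F FF f a). Qed.

Lemma ccvg_cst a : (fun=> a) @ F --> (a : R[i]^o).
Proof. exact: (@cvg_cst (R[i]^o) a I F FF). Qed.

Lemma cvg_RtoC (h : I -> R) (s : R) :
  h t @[t --> F] --> s -> (h t)%:C @[t --> F] --> (s%:C : R[i]^o).
Proof.
move=> /cvgrPdist_lt k; apply/cvg_cabsP => e /k; apply: filterS => t.
by rewrite -rmorphB /= cabs_real.
Qed.

Lemma ccvg_eq f a b : f t @[t --> F] --> (a : R[i]^o) -> a = b ->
  f t @[t --> F] --> (b : R[i]^o).
Proof. by move=> + <-. Qed.

Lemma ccvg_ext f g a : f t @[t --> F] --> (a : R[i]^o) -> (forall t, f t = g t) ->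
  g t @[t --> F] --> (a : R[i]^o).
Proof. by move=> + /funext <-. Qed.

End ComplexLimits.

(** * Integrals of complex functions over segments *)

Section ComplexIntegral.
Variable R : realType.
Local Notation mu := (@lebesgue_measure R).
Implicit Types (f g : R -> R[i]) (a b : R).

Definition cts_on a b (f : R -> R[i]) :=
  forall s, a <= s <= b -> f t @[t --> s] --> (f s : R[i]^o).

Definition cint a b f : R[i] :=
  (\int[mu]_(x in `[a, b]) (complex.Re (f x)))%:C +
  'i%C * (\int[mu]_(x in `[a, b]) (complex.Im (f x)))%:C.

Lemma cvg_Re (I : Type) (F : set_system I) (FF : Filter F) (h : I -> R[i]) (y : R[i]) :
  h @ F --> (y : R[i]^o) -> complex.Re (h t) @[t --> F] --> complex.Re y.
Proof.
move=> /cvg_cabsP hy; apply/cvgrPdist_lt => e /hy.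
apply: filterS => t; apply: le_lt_trans.
by rewrite -cReB Re_le_cabs.
Qed.

Lemma cvg_Im (I : Type) (F : set_system I) (FF : Filter F) (h : I -> R[i]) (y : R[i]) :
  h @ F --> (y : R[i]^o) -> complex.Im (h t) @[t --> F] --> complex.Im y.
Proof.
move=> /cvg_cabsP hy; apply/cvgrPdist_lt => e /hy.
apply: filterS => t; apply: le_lt_trans.
by rewrite -cImB Im_le_cabs.
Qed.

Lemma cts_on_integrable a b f : cts_on a b f ->
  mu.-integrable `[a, b] (EFin \o (fun x => complex.Re (f x))) /\
  mu.-integrable `[a, b] (EFin \o (fun x => complex.Im (f x))).
Proof.
move=> h; split; apply: continuous_compact_integrable;
  (try exact: segment_compact); apply: continuous_in_subspaceT => s;
  rewrite inE /= in_itv /= => /h hs.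
- exact: cvg_Re.
- exact: cvg_Im.
Qed.

Lemma Rintegral_split a b c (f : R -> R) : a <= c -> c <= b ->
  mu.-integrable `[a, b] (EFin \o f) ->
  \int[mu]_(x in `[a, b]) f x =
  \int[mu]_(x in `[a, c]) f x + \int[mu]_(x in `[c, b]) f x.
Proof.
move=> ac cb hf.
have := @Rintegral_itvB R f (BLeft a) (BRight b) c hf.
rewrite !bnd_simp => /(_ ac cb) h.
have hs : mu.-integrable `]c, b] (EFin \o f).
  by apply: integrableS hf => //; apply: subset_itvr; rewrite bnd_simp.
by rewrite -(Rintegral_itv_obnd_cbnd hs) -h addrC subrK.
Qed.

Lemma cint_split a b c f : a <= c -> c <= b -> cts_on a b f ->
  cint a b f = cint a c f + cint c b f.
Proof.
move=> ac cb /cts_on_integrable[h1 h2]; rewrite /cint.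
rewrite (Rintegral_split ac cb h1) (Rintegral_split ac cb h2) !rmorphD /=; ring.
Qed.

Lemma cintB a b f g : cts_on a b f -> cts_on a b g ->
  cint a b (fun x => f x - g x) = cint a b f - cint a b g.
Proof.
move=> /cts_on_integrable[h1 h2] /cts_on_integrable[h3 h4]; rewrite /cint.
under eq_Rintegral do rewrite cReB.
under [in X in _ + _ * X%:C = _]eq_Rintegral do rewrite cImB.
rewrite !RintegralB // !rmorphB /=; ring.
Qed.

Lemma fine_lebesgue_itv a b : a <= b -> fine (lebesgue_measure `[a, b]%classic) = b - a.
Proof.
move=> ab; rewrite lebesgue_measure_itv /= lte_fin.
have [//|ba] := ltP a b; have -> : b = a by apply/eqP; rewrite eq_le ab ba.
by rewrite subrr.
Qed.

Lemma Rintegral_bound a b (f : R -> R) e : a <= b ->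
  mu.-integrable `[a, b] (EFin \o f) -> (forall s, a <= s <= b -> `|f s| <= e) ->
  `|\int[mu]_(x in `[a, b]) f x| <= e * (b - a).
Proof.
move=> ab hf he; rewrite (le_trans (le_normr_Rintegral _ hf)) //.
have -> : e * (b - a) = \int[mu]_(x in `[a, b]) e.
  by rewrite Rintegral_cst //; congr (_ * _); rewrite -(fine_lebesgue_itv ab).
apply: le_Rintegral => //.
- exact: integrable_norm hf.
- apply: continuous_compact_integrable; first exact: segment_compact.
  by apply: continuous_in_subspaceT => s _; exact: cvg_cst.
Qed.

Lemma cint_bound a b f e : a <= b -> cts_on a b f ->
  (forall s, a <= s <= b -> cabs (f s) <= e) -> cabs (cint a b f) <= 2 * e * (b - a).
Proof.
move=> ab /cts_on_integrable[h1 h2] he; rewrite /cint (le_trans (cabsD _ _)) //.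
rewrite cabsM cabs_i mul1r !cabs_real -mulrA mulr_natl mulr2n lerD //.
  apply: Rintegral_bound => // s /he; exact/le_trans/Re_le_cabs.
by apply: Rintegral_bound => // s /he; exact/le_trans/Im_le_cabs.
Qed.

Lemma Rintegral_id a b : a <= b ->
  \int[mu]_(x in `[a, b]) x = (b ^+ 2 - a ^+ 2) / 2.
Proof.
rewrite le_eqVlt => /predU1P[->|ab].
  by rewrite set_itv1 Rintegral_set1 subrr mul0r.
rewrite /Rintegral (@continuous_FTC2 _ _ (fun x => x ^+ 2 / 2)) //.
- by rewrite /= mulrBl.
- by apply: continuous_in_subspaceT => s _; exact: cvg_id.
- split.
  + by move=> x _; exact: ex_derive.
  + by apply: cvg_at_right_filter; apply: cvgM; [exact: exprn_continuous|exact: cvg_cst].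
  + by apply: cvg_at_left_filter; apply: cvgM; [exact: exprn_continuous|exact: cvg_cst].
- move=> x _; rewrite derive1E.
  have h : is_derive x (1 : R) (fun x : R => x ^+ 2 / 2) x.
    by apply: is_derive_eq; rewrite !scaler0 /= /GRing.scale /=; field.
  by rewrite derive_val.
Qed.

Lemma cts_on_affine a b (u v : R[i]) : cts_on a b (fun x => u + v * x%:C).
Proof.
move=> s _; apply/cvg_cabsP => e e0.
have e1 : 0 < e / (cabs v + 1) by rewrite divr_gt0 // ltr_wpDl ?cabs_ge0.
exists (e / (cabs v + 1)) => // t /=; rewrite /ball_ /= => h.
have -> : u + v * s%:C - (u + v * t%:C) = v * (s - t)%:C by rewrite rmorphB /=; ring.
rewrite cabsM cabs_real.
move: h; rewrite ltr_pdivlMr ?ltr_wpDl ?cabs_ge0 // => h.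
apply: le_lt_trans h; rewrite mulrC ler_wpM2l // lerDl //.
Qed.

Lemma cint_affine a b (u v : R[i]) : a <= b ->
  cint a b (fun x => u + v * x%:C) = u * (b - a)%:C + v * ((b ^+ 2 - a ^+ 2) / 2)%:C.
Proof.
move=> ab.
have hc p q : \int[mu]_(x in `[a, b]) (p + q * x) =
    p * (b - a) + q * ((b ^+ 2 - a ^+ 2) / 2).
  have ic : mu.-integrable `[a, b] (EFin \o (fun=> p)).
    apply: continuous_compact_integrable; first exact: segment_compact.
    by apply: continuous_in_subspaceT => s _; exact: cvg_cst.
  have ii : mu.-integrable `[a, b] (EFin \o id).
    apply: continuous_compact_integrable; first exact: segment_compact.
    by apply: continuous_in_subspaceT => s _; exact: cvg_id.
  have ii' : mu.-integrable `[a, b] (EFin \o (fun x => q * x)).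
    apply: continuous_compact_integrable; first exact: segment_compact.
    by apply: continuous_in_subspaceT => s _; apply: cvgM; [exact: cvg_cst|exact: cvg_id].
  rewrite RintegralD // RintegralZl // Rintegral_id // Rintegral_cst //.
  by congr (_ * _ + _); rewrite -(fine_lebesgue_itv ab).
rewrite /cint.
under eq_Rintegral do rewrite cReD cReM /= mulr0 subr0.
under [in X in _ + _ * X%:C = _]eq_Rintegral do rewrite cImD cImM /= mulr0 add0r.
rewrite !hc; apply: complexP.
  by rewrite !(cReD, cReM) /=; ring.
by rewrite !(cImD, cImM) /=; ring.
Qed.

Lemma eq_cint a b f g : (forall s, a <= s <= b -> f s = g s) -> cint a b f = cint a b g.
Proof.
move=> h; rewrite /cint; congr (_%:C + _ * _%:C); apply: eq_Rintegral => s;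
  by rewrite inE /= in_itv /= => /h ->.
Qed.

Lemma cint0 a b : cint a b (fun=> 0) = 0.
Proof. by rewrite /cint /= /Rintegral integral0 /= !mulr0 addr0. Qed.

Lemma cts_onB a b f g : cts_on a b f -> cts_on a b g -> cts_on a b (fun x => f x - g x).
Proof.
move=> hf hg s hs.
exact: (@cvgB _ (R[i]^o) _ _ _ f g _ _ (hf s hs) (hg s hs)).
Qed.

(** A differentiable function is affine up to a small error, and integrals of
    affine functions are explicit. *)
Lemma cint_approx a b f u v e : a <= b -> cts_on a b f ->
  (forall s, a <= s <= b -> cabs (f s - (u + v * s%:C)) <= e) ->
  cabs (cint a b f - (u * (b - a)%:C + v * ((b ^+ 2 - a ^+ 2) / 2)%:C))
    <= 2 * e * (b - a).
Proof.
move=> ab hf he; have E := cintB hf (@cts_on_affine a b u v).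
rewrite (cint_affine u v ab) in E.
rewrite -E.
exact: (cint_bound ab (cts_onB hf (@cts_on_affine a b u v)) he).
Qed.

End ComplexIntegral.

(** * Goursat's theorem for rectangles *)

Section Cdiff.
Variable R : realType.
Implicit Types (g h : R[i] -> R[i]) (z d : R[i]).

Definition cdiff g z d := forall e : R, 0 < e -> exists2 r : R, 0 < r &
  forall w, cabs (w - z) < r -> cabs (g w - g z - d * (w - z)) <= e * cabs (w - z).

Lemma cdiff_cts g z d : cdiff g z d ->
  forall e : R, 0 < e -> exists2 r : R, 0 < r &
  forall w, cabs (w - z) < r -> cabs (g w - g z) < e.
Proof.
move=> hg e e0; have [r r0 hr] := hg 1 ltr01.
have k0 : 0 < 1 + cabs d by rewrite ltr_pwDl ?cabs_ge0.
exists (Num.min r (e / (1 + cabs d))); first by rewrite lt_min r0 divr_gt0.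
move=> w; rewrite lt_min ltr_pdivlMr // => /andP[/hr h1 h2].
have -> : g w - g z = (g w - g z - d * (w - z)) + d * (w - z) by rewrite subrK.
rewrite (le_lt_trans (cabsD _ _)) //; apply: le_lt_trans h2.
rewrite cabsM; have -> : cabs (w - z) * (1 + cabs d) = 1 * cabs (w - z) + cabs d * cabs (w - z).
  by ring.
by rewrite lerD2r.
Qed.

Lemma cdiff_cvg (I : Type) (F : set_system I) (FF : Filter F) g z d (p : I -> R[i]) :
  cdiff g z d -> p t @[t --> F] --> (z : R[i]^o) -> g (p t) @[t --> F] --> (g z : R[i]^o).
Proof.
move=> hg /cvg_cabsP hp; apply/cvg_cabsP => e e0.
have [r r0 hr] := cdiff_cts hg e0.
by move: (hp r r0); apply: filterS => t; rewrite !(cabs_distC z) !(cabs_distC (g z)); exact: hr.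
Qed.

(** Holomorphy enters through hypotheses, and the
    epsilon form is easier to establish for concrete functions. *)
Lemma derivable_cdiff g z : derivable (g : R[i]^o -> R[i]^o) z 1 -> exists d, cdiff g z d.
Proof.
move=> /cvg_ex[d] /cvg_cabsP hd; exists d => e e0.
have /nbhs_rnormP[r r0 hr] := hd e e0.
exists r => // w hw.
have [->|wz] := eqVneq w z; first by rewrite !subrr mulr0 subr0 cabs0 mulr0.
have x0 : w - z != 0 by rewrite subr_eq0.
have := hr (w - z); rewrite -/(cabs _) sub0r cabsN => /(_ hw x0).
have -> : d - (w - z)^-1 *: (g ((w - z) *: (1 : R[i]^o) + z) - g z)
    = - ((w - z)^-1 * (g w - g z - d * (w - z))).
  by rewrite /GRing.scale /= mulr1 subrK; field.
rewrite cabsN cabsM cabsV mulrC ltr_pdivrMr ?cabs_gt0 //; exact: ltW.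
Qed.

Lemma cdiffB g h z d d' : cdiff g z d -> cdiff h z d' -> cdiff (fun w => g w - h w) z (d - d').
Proof.
move=> hg hh e e0; have e2 : 0 < e / 2 by rewrite divr_gt0.
have [r r0 hr] := hg _ e2; have [r' r'0 hr'] := hh _ e2.
exists (Num.min r r'); first by rewrite lt_min r0.
move=> w; rewrite lt_min => /andP[/hr a1 /hr' a2].
have -> : g w - h w - (g z - h z) - (d - d') * (w - z) =
  (g w - g z - d * (w - z)) - (h w - h z - d' * (w - z)) by ring.
apply: (le_trans (cabsB _ _)).
have -> : e * cabs (w - z) = e / 2 * cabs (w - z) + e / 2 * cabs (w - z) by field.
exact: lerD.
Qed.

Lemma cdiffM g h z d d' : cdiff g z d -> cdiff h z d' ->
  cdiff (fun w => g w * h w) z (d * h z + g z * d').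
Proof.
move=> hg hh e e0.
pose A := cabs (h z) + 1; pose B := cabs (g z) + 1; pose C := cabs d + 1.
have A0 : 0 < A by rewrite ltr_wpDl ?cabs_ge0.
have B0 : 0 < B by rewrite ltr_wpDl ?cabs_ge0.
have C0 : 0 < C by rewrite ltr_wpDl ?cabs_ge0.
have [r1 r10 k1] := hg (e / 3 / A) (divr_gt0 (divr_gt0 e0 (ltr0n R 3)) A0).
have [r2 r20 k2] := hh (e / 3 / B) (divr_gt0 (divr_gt0 e0 (ltr0n R 3)) B0).
have [r3 r30 k3] := cdiff_cts hh (divr_gt0 (divr_gt0 e0 (ltr0n R 3)) C0).
have [r4 r40 k4] := cdiff_cts hh (@ltr01 R).
exists (Num.min (Num.min r1 r2) (Num.min r3 r4)); first by rewrite !lt_min r10 r20 r30.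
move=> w; rewrite !lt_min => /andP[/andP[/k1 b1 /k2 b2] /andP[/k3 b3 /k4 b4]].
have hA : cabs (h w) <= A.
  have -> : h w = h z + (h w - h z) by rewrite addrC subrK.
  by apply: (le_trans (cabsD _ _)); rewrite lerD2l ltW.
have -> : g w * h w - g z * h z - (d * h z + g z * d') * (w - z) =
  (g w - g z - d * (w - z)) * h w + g z * (h w - h z - d' * (w - z)) +
  d * (w - z) * (h w - h z) by ring.
set k := cabs (w - z) in b1 b2 *; have k0 : 0 <= k by exact: cabs_ge0.
have -> : e * k = e / 3 / A * k * A + B * (e / 3 / B * k) + C * k * (e / 3 / C).
  by field; rewrite !lt0r_neq0.
apply: (le_trans (cabsD _ _)); apply: lerD; last first.
  rewrite cabsM [cabs (d * _)]cabsM; apply: ler_pM; rewrite ?mulr_ge0 ?cabs_ge0 //; last exact: ltW.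
  by rewrite ler_wpM2r // lerDl.
apply: (le_trans (cabsD _ _)); apply: lerD; rewrite cabsM.
  by apply: ler_pM; rewrite ?cabs_ge0.
by apply: ler_pM; rewrite ?cabs_ge0 // lerDl.
Qed.

End Cdiff.

Section Goursat.
Variables (R : realType) (g : R[i] -> R[i]).
Implicit Types (a b c d x y L K : R).

Definition hint a b y := cint a b (fun s => g (s +i* y)).
Definition vint c d x := cint c d (fun s => g (x +i* s)).

(** The integral of g along the boundary of a rectangle with lower left
    corner (a, c), width L and height K. *)
Definition bint a c L K :=
  hint a (a + L) c - hint a (a + L) (c + K) +
  'i%C * (vint c (c + K) (a + L) - vint c (c + K) a).

Definition diff_on a b c d := forall x y, a <= x <= b -> c <= y <= d ->
  exists D, cdiff g (x +i* y) D.

Lemma cvg_hline (s y : R) : (t +i* y) @[t --> s] --> ((s +i* y) : R[i]^o).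
Proof.
apply/cvg_cabsP => e e0; exists e => //= t; rewrite /ball_ /= => h.
suff -> : s +i* y - t +i* y = (s - t)%:C by rewrite cabs_real.
by apply: complexP => /=; ring.
Qed.

Lemma cvg_vline (s x : R) : (x +i* t) @[t --> s] --> ((x +i* s) : R[i]^o).
Proof.
apply/cvg_cabsP => e e0; exists e => //= t; rewrite /ball_ /= => h.
suff -> : x +i* s - x +i* t = 'i%C * (s - t)%:C by rewrite cabsM cabs_i mul1r cabs_real.
by apply: complexP => /=; ring.
Qed.

Lemma diff_on_h a b c d y : diff_on a b c d -> c <= y <= d ->
  cts_on a b (fun s => g (s +i* y)).
Proof.
move=> h hy s hs; have [D hD] := h s y hs hy.
by apply: cdiff_cvg hD _; exact: cvg_hline.
Qed.

Lemma diff_on_v a b c d x : diff_on a b c d -> a <= x <= b ->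
  cts_on c d (fun s => g (x +i* s)).
Proof.
move=> h hx s hs; have [D hD] := h x s hx hs.
by apply: cdiff_cvg hD _; exact: cvg_vline.
Qed.

Lemma bint_split4 a c L K : 0 <= L -> 0 <= K ->
  diff_on a (a + L + L) c (c + K + K) ->
  bint a c (L + L) (K + K) = bint a c L K + bint (a + L) c L K +
    bint a (c + K) L K + bint (a + L) (c + K) L K.
Proof.
move=> L0 K0 h; rewrite /bint (addrA a L L) (addrA c K K).
have hs y : c <= y <= c + K + K ->
    hint a (a + L + L) y = hint a (a + L) y + hint (a + L) (a + L + L) y.
  by move=> hy; apply: cint_split; [lra|lra|exact: diff_on_h h hy].
have vs x : a <= x <= a + L + L ->
    vint c (c + K + K) x = vint c (c + K) x + vint (c + K) (c + K + K) x.
  by move=> hx; apply: cint_split; [lra|lra|exact: diff_on_v h hx].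
rewrite (hs c); last by apply/andP; split; lra.
rewrite (hs (c + K + K)); last by apply/andP; split; lra.
rewrite (vs a); last by apply/andP; split; lra.
rewrite (vs (a + L + L)); last by apply/andP; split; lra.
ring.
Qed.

(** The boundary integral of the affine part of g vanishes; what remains is
    bounded by e on four sides of total length 2 (L + K). *)
Lemma bint_small a c L K (z0 D : R[i]) e : 0 <= L -> 0 <= K ->
  diff_on a (a + L) c (c + K) ->
  (forall x y, a <= x <= a + L -> c <= y <= c + K ->
     cabs (g (x +i* y) - g z0 - D * (x +i* y - z0)) <= e) ->
  cabs (bint a c L K) <= 4 * e * (L + K).
Proof.
move=> L0 K0 h he.
have hc y : c <= y <= c + K -> cts_on a (a + L) (fun s => g (s +i* y)).
  exact: diff_on_h h.
have vc x : a <= x <= a + L -> cts_on c (c + K) (fun s => g (x +i* s)).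
  exact: diff_on_v h.
have c0 : c <= c <= c + K by apply/andP; split; lra.
have cK : c <= c + K <= c + K by apply/andP; split; lra.
have a0 : a <= a <= a + L by apply/andP; split; lra.
have aL : a <= a + L <= a + L by apply/andP; split; lra.
have hH : cabs (hint a (a + L) c - hint a (a + L) (c + K)
    - (- (D * 'i%C * K%:C)) * L%:C) <= 4 * e * L.
  rewrite /hint -cintB; [|exact: hc|exact: hc].
  have := @cint_approx _ a (a + L) (fun x => g (x +i* c) - g (x +i* (c + K)))
    (- (D * 'i%C * K%:C)) 0 (2 * e).
  rewrite mul0r addr0 (_ : a + L - a = L); last by ring.
  rewrite (_ : 2 * (2 * e) * L = 4 * e * L); last by ring.
  apply; [lra|by apply: cts_onB; exact: hc|] => s hs.
  rewrite mul0r addr0.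
  have -> : g (s +i* c) - g (s +i* (c + K)) - - (D * 'i%C * K%:C) =
      (g (s +i* c) - g z0 - D * (s +i* c - z0)) -
      (g (s +i* (c + K)) - g z0 - D * (s +i* (c + K) - z0)).
    have -> : s +i* (c + K) = s +i* c + 'i%C * K%:C by apply: complexP => /=; ring.
    ring.
  rewrite (le_trans (cabsB _ _)) //; have := he _ _ hs c0; have := he _ _ hs cK; lra.
have hV : cabs (vint c (c + K) (a + L) - vint c (c + K) a - (D * L%:C) * K%:C)
    <= 4 * e * K.
  rewrite /vint -cintB; [|exact: vc|exact: vc].
  have := @cint_approx _ c (c + K) (fun x => g ((a + L) +i* x) - g (a +i* x))
    (D * L%:C) 0 (2 * e).
  rewrite mul0r addr0 (_ : c + K - c = K); last by ring.
  rewrite (_ : 2 * (2 * e) * K = 4 * e * K); last by ring.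
  apply; [lra|by apply: cts_onB; exact: vc|] => s hs.
  rewrite mul0r addr0.
  have -> : g ((a + L) +i* s) - g (a +i* s) - D * L%:C =
      (g ((a + L) +i* s) - g z0 - D * ((a + L) +i* s - z0)) -
      (g (a +i* s) - g z0 - D * (a +i* s - z0)).
    have -> : (a + L) +i* s = a +i* s + L%:C by apply: complexP => /=; ring.
    ring.
  rewrite (le_trans (cabsB _ _)) //; have := he _ _ a0 hs; have := he _ _ aL hs; lra.
have -> : bint a c L K = (hint a (a + L) c - hint a (a + L) (c + K)
    - (- (D * 'i%C * K%:C)) * L%:C) +
   'i%C * (vint c (c + K) (a + L) - vint c (c + K) a - (D * L%:C) * K%:C).
  by rewrite /bint; ring.
by rewrite (le_trans (cabsD _ _)) // cabsM cabs_i mul1r mulrDr lerD.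
Qed.

End Goursat.

Lemma nested_point (R : realType) (a l : nat -> R) :
  (forall n, 0 <= l n) -> (forall n, a n <= a n.+1) ->
  (forall n, a n.+1 + l n.+1 <= a n + l n) ->
  exists x, forall n, a n <= x <= a n + l n.
Proof.
move=> l0 ia da.
have mono m n : a m <= a (m + n)%N.
  by elim: n => [|n IH]; rewrite ?addn0 // addnS (le_trans IH).
have anti m n : a (m + n)%N + l (m + n)%N <= a m + l m.
  by elim: n => [|n IH]; rewrite ?addn0 // addnS (le_trans (da _)).
have ub m n : a n <= a m + l m.
  have h : a n <= a (n + m)%N by exact: mono.
  by rewrite (le_trans h) // addnC (le_trans _ (anti m n)) // lerDl.
have hs n : has_sup (range a).
  by split; [exists (a 0%N), 0%N|exists (a 0%N + l 0%N) => _ [m _ <-]; exact: ub].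
exists (sup (range a)) => n; apply/andP; split.
  by apply: sup_upper_bound; [exact: hs|exists n].
by apply: ge_sup; [exists (a 0%N), 0%N|move=> _ [m _ <-]; exact: ub].
Qed.

Lemma half_in (R : realType) (x l q : R) : 0 <= l -> q = x \/ q = x + l ->
  x <= q /\ q + l <= x + (l + l).
Proof. by move=> l0 [->|->]; split; lra. Qed.

Section GoursatBisection.
Variables (R : realType) (g : R[i] -> R[i]).

(** If the boundary integral were nonzero, bisection would produce rectangles
    shrinking to a point on which it is at least a fixed multiple of the
    area, whereas differentiability at that point makes it o(area). *)
Lemma goursat (a c L K : R) : 0 <= L -> 0 <= K ->
  diff_on g a (a + L) c (c + K) -> bint g a c L K = 0.
Proof.
move=> L0 K0 hg; apply: cabs_eq0; apply/eqP; rewrite eq_le cabs_ge0 andbT.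
set J := cabs _; rewrite leNgt; apply/negP => J0.
pose Ln n := L / 2 ^+ n; pose Kn n := K / 2 ^+ n.
have p2 n : 0 < 2 ^+ n :> R by rewrite exprn_gt0.
have Ln0 n : 0 <= Ln n by rewrite divr_ge0 // ltW.
have Kn0 n : 0 <= Kn n by rewrite divr_ge0 // ltW.
have LS n : Ln n = Ln n.+1 + Ln n.+1.
  by rewrite /Ln exprS; field; rewrite lt0r_neq0.
have KS n : Kn n = Kn n.+1 + Kn n.+1.
  by rewrite /Kn exprS; field; rewrite lt0r_neq0.
pose ok n (p : R * R) := [/\ J / 4 ^+ n <= cabs (bint g p.1 p.2 (Ln n) (Kn n)),
  a <= p.1, p.1 + Ln n <= a + L, c <= p.2 & p.2 + Kn n <= c + K].
have step (q : nat * (R * R)) : exists p', ok q.1 q.2 ->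
    [/\ ok q.1.+1 p', q.2.1 <= p'.1, p'.1 + Ln q.1.+1 <= q.2.1 + Ln q.1,
      q.2.2 <= p'.2 & p'.2 + Kn q.1.+1 <= q.2.2 + Kn q.1].
  case: q => n [x y] /=.
  have [|] := pselect (ok n (x, y)); last by move=> h; exists (0, 0).
  move=> [/= h1 h2 h3 h4 h5].
  pose q4 := J / 4 ^+ n.+1.
  have h4q : q4 + q4 + q4 + q4 = J / 4 ^+ n.
    by rewrite /q4 exprS; field; rewrite lt0r_neq0 // exprn_gt0.
  have hd : diff_on g x (x + Ln n.+1 + Ln n.+1) y (y + Kn n.+1 + Kn n.+1).
    move=> u v /andP[u1 u2] /andP[v1 v2]; move: (LS n) (KS n) => l k.
    by apply: hg; apply/andP; split; lra.
  have := bint_split4 (Ln0 n.+1) (Kn0 n.+1) hd; rewrite -LS -KS => hs.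
  have [p' hp'] : exists p' : R * R, q4 <= cabs (bint g p'.1 p'.2 (Ln n.+1) (Kn n.+1)) /\
      (p'.1 = x \/ p'.1 = x + Ln n.+1) /\ (p'.2 = y \/ p'.2 = y + Kn n.+1).
    have [k1|k1] := leP q4 (cabs (bint g x y (Ln n.+1) (Kn n.+1))).
      by exists (x, y); split=> //; split; left.
    have [k2|k2] := leP q4 (cabs (bint g (x + Ln n.+1) y (Ln n.+1) (Kn n.+1))).
      by exists (x + Ln n.+1, y); split=> //; split; [right|left].
    have [k3|k3] := leP q4 (cabs (bint g x (y + Kn n.+1) (Ln n.+1) (Kn n.+1))).
      by exists (x, y + Kn n.+1); split=> //; split; [left|right].
    have [k4|k4] := leP q4 (cabs (bint g (x + Ln n.+1) (y + Kn n.+1) (Ln n.+1) (Kn n.+1))).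
      by exists (x + Ln n.+1, y + Kn n.+1); split=> //; split; right.
    exfalso; move: h1; rewrite leNgt => /negP; apply.
    rewrite hs -h4q; apply: (le_lt_trans (cabsD _ _)); apply: ltrD => //.
    apply: (le_lt_trans (cabsD _ _)); apply: ltrD => //.
    by apply: (le_lt_trans (cabsD _ _)); apply: ltrD.
  case: p' hp' => q1 q2 /= [hq [hx hy]]; exists (q1, q2) => _ /=.
  have [x1 x2] := half_in (Ln0 n.+1) hx; rewrite -LS in x2.
  have [y1 y2] := half_in (Kn0 n.+1) hy; rewrite -KS in y2.
  split=> //; split=> //=.
  - exact: le_trans h2 x1.
  - exact: le_trans x2 h3.
  - exact: le_trans h4 y1.
  - exact: le_trans y2 h5.
have [f hf] := boolp.choice step.
pose u := fix u n := if n is m.+1 then f (m, u m) else (a, c).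
have uok n : ok n (u n).
  elim: n => [|n IH]; last by have [] := hf (n, u n) IH.
  by split; rewrite /= ?expr0 /Ln /Kn ?expr0 ?divr1.
have hu n := hf (n, u n) (uok n).
have [x hx] := @nested_point _ (fun n => (u n).1) Ln Ln0
  (fun n => let: And5 _ h _ _ _ := hu n in h) (fun n => let: And5 _ _ h _ _ := hu n in h).
have [y hy] := @nested_point _ (fun n => (u n).2) Kn Kn0
  (fun n => let: And5 _ _ _ h _ := hu n in h) (fun n => let: And5 _ _ _ _ h := hu n in h).
have [D hD] : exists D, cdiff g (x +i* y) D.
  apply: hg; [have := hx 0%N|have := hy 0%N]; by rewrite /= /Ln /Kn expr0 divr1.
pose M := L + K.
have M0 : 0 <= M by rewrite addr_ge0.
(* with this e, bint_small gives less than the lower bound J / 4 ^+ n *)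
have e0 : 0 < J / (8 * (M ^+ 2 + 1)).
  by rewrite divr_gt0 // mulr_gt0 // ltr_wpDl // sqr_ge0.
have [r r0 hr] := hD _ e0.
have [n hn] : exists n, M / 2 ^+ n < r.
  exists (Num.bound (M / r)); rewrite ltr_pdivrMr // -ltr_pdivrMl // mulrC.
  exact: upper_nthrootP.
have [h1 h2 h3 h4 h5] := uok n.
have hsm := @bint_small R g (u n).1 (u n).2 (Ln n) (Kn n) (x +i* y) D
  (J / (8 * (M ^+ 2 + 1)) * (M / 2 ^+ n)) (Ln0 n) (Kn0 n).
have {hsm} : cabs (bint g (u n).1 (u n).2 (Ln n) (Kn n)) <=
    4 * (J / (8 * (M ^+ 2 + 1)) * (M / 2 ^+ n)) * (Ln n + Kn n).
  apply: hsm.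
    move=> s t /andP[s1 s2] /andP[t1 t2]; apply: hg; apply/andP; split; lra.
  move=> s t /andP[s1 s2] /andP[t1 t2].
  have hst : cabs (s +i* t - x +i* y) <= M / 2 ^+ n.
    apply: (le_trans (cabs_le_ReIm _)); rewrite /= mulrDl.
    move: (hx n) (hy n) => /andP[x1 x2] /andP[y1 y2].
    by apply: lerD; rewrite ler_norml; apply/andP; split; move: x2 y2 s2 t2; rewrite /Ln /Kn; lra.
  apply: (le_trans (hr _ (le_lt_trans hst hn))).
  by rewrite ler_wpM2l // ltW.
apply/negP; rewrite -ltNge; apply: lt_le_trans h1.
have -> : 4 * (J / (8 * (M ^+ 2 + 1)) * (M / 2 ^+ n)) * (Ln n + Kn n) =
   J * (M ^+ 2 / (2 * (M ^+ 2 + 1))) / 4 ^+ n.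
  rewrite /Ln /Kn -mulrDl -/M (_ : (4 : R) = 2 * 2); last by ring.
  rewrite exprMn; field.
  by rewrite lt0r_neq0 //= lt0r_neq0 // ltr_wpDl // sqr_ge0.
rewrite ltr_pM2r ?invr_gt0 ?exprn_gt0 // gtr_pMr //.
rewrite ltr_pdivrMr ?mul1r; last by rewrite mulr_gt0 // ltr_wpDl // sqr_ge0.
have := sqr_ge0 M; lra.
Qed.

End GoursatBisection.

(** * Second order expansions along the two axes *)

Section Jets.
Variable R : realType.
Implicit Types (phi : R -> R[i]) (p a b u v w k : R[i]) (t : R).

(** A second order Taylor expansion at 0; b is the coefficient of t ^+ 2 and the
    o (t ^+ 2) is absorbed in r. *)
Definition jet1 phi p a b := exists r : R -> R[i],
  (forall t, phi t = p + a * t%:C + (t ^+ 2)%:C * r t) /\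
  r t @[t --> 0] --> (b : R[i]^o).

Lemma cvg_jet1 phi p a b : jet1 phi p a b -> phi t @[t --> 0] --> (p : R[i]^o).
Proof.
move=> [r [hr hb]].
have hid : t @[t --> (0 : R)] --> (0 : R) by exact: cvg_id.
have h2 : (t ^+ 2)%:C @[t --> (0 : R)] --> ((0 ^+ 2)%:C : R[i]^o).
  by apply: cvg_RtoC; apply: exprn_continuous.
have hc q : (fun=> q) @ (0 : R) --> (q : R[i]^o) by exact: (@ccvg_cst R _ _ _ q).
apply: ccvg_ext (fun t => esym (hr t)).
apply: ccvg_eq (ccvgD (ccvgD (hc p) (ccvgM (hc a) (cvg_RtoC hid))) (ccvgM h2 hb)) _.
by rewrite expr0n /= mulr0 mul0r !addr0.
Qed.

Lemma jet1_affine p a : jet1 (fun t => p + a * t%:C) p a 0.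
Proof.
by exists (fun=> 0); split=> [t|]; [rewrite mulr0 addr0|exact: (@ccvg_cst R _ _ _)].
Qed.

Lemma jet1M phi psi p a b p' a' b' : jet1 phi p a b -> jet1 psi p' a' b' ->
  jet1 (fun t => phi t * psi t) (p * p') (p * a' + a * p')
    (p * b' + a * a' + b * p').
Proof.
move=> h1 h2; have hpsi := cvg_jet1 h2; move: h1 h2 => [r [hr hb]] [r' [hr' hb']].
exists (fun t => (p + a * t%:C) * r' t + a * a' + r t * psi t); split.
  by move=> t; rewrite hr hr' !(rmorphXn, rmorphM) /=; ring.
have hid : t @[t --> (0 : R)] --> (0 : R) by exact: cvg_id.
have hc q : (fun=> q) @ (0 : R) --> (q : R[i]^o) by exact: (@ccvg_cst R _ _ _ q).
apply: ccvg_eq (ccvgD (ccvgD (ccvgM (ccvgD (hc p) (ccvgM (hc a) (cvg_RtoC hid))) hb')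
  (hc (a * a'))) (ccvgM hb hpsi)) _.
by rewrite mulr0 addr0.
Qed.

Lemma jet1_inv p a : p != 0 ->
  jet1 (fun t => (p + a * t%:C)^-1) p^-1 (- (a / p ^+ 2)) (a ^+ 2 / p ^+ 3).
Proof.
move=> p0.
pose q t := p + a * t%:C.
(* away from t = 0 the denominator may vanish; there r is only required to
   satisfy the defining identity *)
pose r t := if q t == 0 then (- p^-1 + a / p ^+ 2 * t%:C) / (t ^+ 2)%:C
  else a ^+ 2 / p ^+ 2 * (q t)^-1.
have hid : t @[t --> (0 : R)] --> (0 : R) by exact: cvg_id.
have hc x : (fun=> x) @ (0 : R) --> (x : R[i]^o) by exact: (@ccvg_cst R _ _ _ x).
have hq : q t @[t --> 0] --> (p : R[i]^o) by exact: cvg_jet1 (jet1_affine p a).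
exists r; split.
  move=> t; rewrite /r -/(q t); case: eqVneq => [qt|qt].
    have t0 : (t ^+ 2)%:C != 0 :> R[i].
      rewrite -(rmorph0 (@real_complex R)) (inj_eq (@complexI R)) sqrf_eq0.
      by apply: contra p0 => /eqP t0; rewrite -qt /q t0 mulr0 addr0.
    rewrite qt invr0; move: t0; move: ((t ^+ 2)%:C) => X X0; field; by rewrite p0 X0.
  by rewrite rmorphXn /=; move: qt; rewrite /q => qt; field; rewrite p0 qt.
have hl : a ^+ 2 / p ^+ 2 * (q t)^-1 @[t --> 0] --> (a ^+ 2 / p ^+ 3 : R[i]^o).
  apply: ccvg_eq (ccvgM (hc _) (ccvgV p0 hq)) _; by field.
have hn : \forall t \near (0 : R), q t != 0.
  move/cvg_cabsP: hq => /(_ _ (cabs_gt0 p0)); apply: filterS => t ht.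
  by apply: contraTneq ht => ->; rewrite subr0 ltxx.
move/cvg_cabsP: hl => hl; apply/cvg_cabsP => e /hl; apply: filterS2 hn => t qt.
by rewrite /r (negbTE qt).
Qed.

Lemma jet1_eq phi phi' p a a' b b' : jet1 phi p a b -> (forall t, phi t = phi' t) ->
  a = a' -> b = b' -> jet1 phi' p a' b'.
Proof. by move=> + /funext <- <- <-. Qed.

(** An expansion shared by both axis directions, with the coefficients that a
    twice complex differentiable function has. *)
Definition jet (P : R[i] -> R[i]) z a b := forall w, w = 1 \/ w = 'i%C ->
  jet1 (fun t => P (z + w * t%:C)) (P z) (w * a) (w ^+ 2 * b).

Lemma jetM P Q z a b a' b' : jet P z a b -> jet Q z a' b' ->
  jet (fun x => P x * Q x) z (P z * a' + a * Q z) (P z * b' + a * a' + b * Q z).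
Proof.
move=> h1 h2 w hw; have := jet1M (h1 w hw) (h2 w hw).
have -> : P z * (w * a') + w * a * Q z = w * (P z * a' + a * Q z) by ring.
by have -> : P z * (w ^+ 2 * b') + w * a * (w * a') + w ^+ 2 * b * Q z =
  w ^+ 2 * (P z * b' + a * a' + b * Q z) by ring.
Qed.

Lemma jet_ext P Q z a b : (forall x, P x = Q x) -> jet P z a b -> jet Q z a b.
Proof. by move=> /funext <-. Qed.

Lemma jet_eq P z a b a' b' : jet P z a b -> a = a' -> b = b' -> jet P z a' b'.
Proof. by move=> + <- <-. Qed.

Lemma jet_cst c z : jet (fun=> c) z 0 0.
Proof.
move=> w _; have := jet1_affine c 0; rewrite !mulr0.
by have -> : (fun t : R => c + 0 * t%:C) = (fun=> c) by apply: funext => t; rewrite mul0r addr0.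
Qed.

Lemma jetX P z a b n : jet P z a b -> exists a' b', jet (fun x => P x ^+ n) z a' b'.
Proof.
move=> h; elim: n => [|n [a' [b' IH]]].
  by exists 0, 0; apply: jet_ext (jet_cst 1 z) => x; rewrite expr0.
by do 2 eexists; apply: jet_ext (jetM h IH) => x; rewrite exprS.
Qed.

(** Integrating the first order expansion of psi at s0 gives the second order
    expansion of its primitive Phi. The factor k is 1 or i, according to the
    direction of the segment. *)
Lemma jet1_cint (Phi psi : R -> R[i]) s0 r0 k u v : 0 < r0 -> cabs k <= 1 ->
  (forall s1 s2, s0 - r0 < s1 -> s1 <= s2 -> s2 < s0 + r0 ->
     Phi s2 - Phi s1 = k * cint s1 s2 psi /\ cts_on s1 s2 psi) ->
  (forall e : R, 0 < e -> exists2 d : R, 0 < d & forall s, `|s - s0| < d ->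
     cabs (psi s - u - v * (s - s0)%:C) <= e * `|s - s0|) ->
  jet1 (fun t => Phi (s0 + t)) (Phi s0) (k * u) (k * v / 2).
Proof.
move=> r00 k1 hPhi hpsi.
pose r t := if t == 0 then k * v / 2 else
  (Phi (s0 + t) - Phi s0 - k * u * t%:C) / (t ^+ 2)%:C.
have C0 t : t != 0 -> (t ^+ 2)%:C != 0 :> R[i].
  by move=> t0; rewrite -(rmorph0 (@real_complex R)) (inj_eq (@complexI R)) sqrf_eq0.
exists r; split.
  move=> t; rewrite /r; case: eqVneq => [->|t0].
    by rewrite addr0 expr0n /= !(mulr0, mul0r, addr0).
  by have := C0 t t0; move: ((t ^+ 2)%:C) => X X0; field.
apply/cvg_cabsP => e e0.
have e30 : 0 < e / 3 by rewrite divr_gt0.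
have [d d0 hd] := hpsi _ e30.
exists (Num.min d r0); first by rewrite /= lt_min d0.
move=> t /=; rewrite /ball_ /= sub0r normrN lt_min => /andP[td tr].
rewrite /r; case: eqVneq => [_|t0]; first by rewrite subrr cabs0.
have hC := C0 t t0.
suff hm : cabs (Phi (s0 + t) - Phi s0 - (k * u * t%:C + k * v / 2 * (t ^+ 2)%:C))
    <= 2 * (e / 3 * `|t|) * `|t|.
  have -> : k * v / 2 - (Phi (s0 + t) - Phi s0 - k * u * t%:C) / (t ^+ 2)%:C =
    - ((Phi (s0 + t) - Phi s0 - (k * u * t%:C + k * v / 2 * (t ^+ 2)%:C)) / (t ^+ 2)%:C).
    by move: hC; move: ((t ^+ 2)%:C) => X X0; field.
  rewrite cabsN cabsM cabsV cabs_real normrX.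
  have tp : 0 < `|t| ^+ 2 by rewrite exprn_gt0 // normr_gt0.
  rewrite ltr_pdivrMr //; apply: (le_lt_trans hm).
  have -> : 2 * (e / 3 * `|t|) * `|t| = 2 / 3 * e * `|t| ^+ 2 by ring.
  by rewrite ltr_pM2r //; lra.
have hloc s1 s2 : `|s1 - s0| <= `|t| -> `|s2 - s0| <= `|t| -> s1 <= s2 ->
    cabs (Phi s2 - Phi s1 - k * ((u - v * s0%:C) * (s2 - s1)%:C +
      v * ((s2 ^+ 2 - s1 ^+ 2) / 2)%:C)) <= 2 * (e / 3 * `|t|) * (s2 - s1).
  move=> h1 h2 s12.
  have [a1 a2] : s0 - r0 < s1 /\ s2 < s0 + r0.
    move: (le_lt_trans h1 tr) (le_lt_trans h2 tr).
    by rewrite !ltr_norml => /andP[? ?] /andP[? ?]; split; lra.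
  have [-> hc] := hPhi _ _ a1 s12 a2.
  rewrite -mulrBr cabsM.
  have hs := @cint_approx _ s1 s2 psi (u - v * s0%:C) v (e / 3 * `|t|) s12 hc.
  rewrite -[X in _ <= X]mul1r; apply: ler_pM; rewrite ?cabs_ge0 //.
  apply: hs => s /andP[l1 l2].
  have st : `|s - s0| <= `|t|.
    move: h1 h2; rewrite !ler_norml => /andP[? ?] /andP[? ?].
    by apply/andP; split; lra.
  have -> : psi s - (u - v * s0%:C + v * s%:C) = psi s - u - v * (s - s0)%:C.
    by rewrite rmorphB /=; ring.
  apply: le_trans (hd _ (le_lt_trans st td)) _.
  by rewrite ler_wpM2l // ltW.
have n00 : `|s0 - s0| <= `|t| by rewrite subrr normr0.
have nt : `|s0 + t - s0| <= `|t| by rewrite addrC addKr.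
have [t1|t1] := leP 0 t.
  have := hloc s0 (s0 + t) n00 nt; rewrite lerDl => /(_ t1).
  rewrite [X in _ <= _ * X](_ : s0 + t - s0 = `|t|); last first.
    by rewrite ger0_norm //; ring.
  congr (cabs (_ - _) <= _); rewrite (_ : (s0 + t) ^+ 2 - s0 ^+ 2 = 2 * s0 * t + t ^+ 2); last by ring.
  rewrite (_ : s0 + t - s0 = t); last by ring.
  by field.
have := hloc (s0 + t) s0 nt n00; rewrite gerDl => /(_ (ltW t1)).
rewrite [X in _ <= _ * X](_ : s0 - (s0 + t) = `|t|); last first.
  by rewrite ltr0_norm //; ring.
rewrite -cabsN.
congr (cabs _ <= _); rewrite (_ : s0 ^+ 2 - (s0 + t) ^+ 2 = - (2 * s0 * t + t ^+ 2)); last by ring.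
rewrite (_ : s0 - (s0 + t) = - t); last by ring.
by field.
Qed.

End Jets.

(** * A primitive vanishing on the real axis *)

Section Primitive.
Variables (R : realType) (g : R[i] -> R[i]) (c : R).
Hypothesis g_diff : forall x y : R, - c < x -> exists D, cdiff g (x +i* y) D.
Hypothesis g_real : forall x : R, - c < x -> g (x +i* 0) = 0.

(** The integral along a vertical segment starting on the real axis. As g
    vanishes on that axis, Goursat's theorem makes it path independent, hence a
    primitive of g. *)
Definition vprim (z : R[i]) : R[i] :=
  'i%C * cint 0 (complex.Im z) (fun s => g (complex.Re z +i* s)).

Lemma vprim_real (x : R) : vprim (x +i* 0) = 0.
Proof.
rewrite /vprim /= /cint set_itv1 !Rintegral_set1 /=.
by rewrite !mulr0 addr0 mulr0.
Qed.

Lemma vprim_v (x y1 y2 : R) : - c < x -> 0 <= y1 -> y1 <= y2 ->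
  vprim (x +i* y2) - vprim (x +i* y1) = 'i%C * cint y1 y2 (fun s => g (x +i* s)) /\
  cts_on y1 y2 (fun s => g (x +i* s)).
Proof.
move=> cx y10 y12.
have hd a b : diff_on g x x a b.
  by move=> u v /andP[u1 u2] _; apply: g_diff; apply: lt_le_trans u1.
have xx : x <= x <= x by rewrite lexx.
have hc a b := diff_on_v (hd a b) xx.
split; last exact: hc.
by rewrite /vprim /= (cint_split y10 y12 (hc 0 y2)); ring.
Qed.

(** The boundary integral over the rectangle between the real axis and height y
    vanishes, and so does its bottom side. *)
Lemma vprim_h (y x1 x2 : R) : - c < x1 -> x1 <= x2 -> 0 <= y ->
  vprim (x2 +i* y) - vprim (x1 +i* y) = 1 * cint x1 x2 (fun s => g (s +i* y)) /\
  cts_on x1 x2 (fun s => g (s +i* y)).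
Proof.
move=> cx x12 y0.
have hd a b : diff_on g x1 x2 a b.
  by move=> u v /andP[u1 u2] _; apply: g_diff; apply: lt_le_trans u1.
split; last by apply: diff_on_h (hd y y) _; rewrite lexx.
have L0 : 0 <= x2 - x1 by rewrite subr_ge0.
have := @goursat R g x1 0 (x2 - x1) y L0 y0.
rewrite add0r (addrC x1) subrK => /(_ (hd _ _)).
rewrite /bint add0r (addrC x1) subrK => h.
have h0 : hint g x1 x2 0 = 0.
  rewrite -(@cint0 R x1 x2); apply: eq_cint => s /andP[s1 s2].
  by apply: g_real; apply: lt_le_trans s1.
move: h; rewrite h0 => h; rewrite /vprim /= -/(hint g x1 x2 y) mul1r.
rewrite -/(vint g 0 y x1) -/(vint g 0 y x2).
have E : hint g x1 x2 y - hint g x1 x2 y = 0 by rewrite subrr.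
have -> : 'i%C * vint g 0 y x2 - 'i%C * vint g 0 y x1 =
   (0 - hint g x1 x2 y + 'i%C * (vint g 0 y x2 - vint g 0 y x1)) + hint g x1 x2 y.
  by ring.
by rewrite h add0r.
Qed.

Lemma vprim_jet (x y : R) D : - c < x -> 0 < y -> cdiff g (x +i* y) D ->
  jet vprim (x +i* y) (g (x +i* y)) (D / 2).
Proof.
move=> cx y0 hD.
have h1 : jet1 (fun t => vprim ((x + t) +i* y)) (vprim (x +i* y))
    (1 * g (x +i* y)) (1 * D / 2).
  apply: (@jet1_cint R (fun s => vprim (s +i* y)) (fun s => g (s +i* y)) x (x + c)).
  - by move: cx; lra.
  - by rewrite cabs1.
  - by move=> s1 s2 l1 l2 _; apply: vprim_h; [lra|exact: l2|exact: ltW].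
  - move=> e /hD[r r0 hr]; exists r => // s hs.
    have E : s +i* y - x +i* y = (s - x)%:C by apply: complexP => /=; ring.
    by have := hr (s +i* y); rewrite E cabs_real => /(_ hs).
have h2 : jet1 (fun t => vprim (x +i* (y + t))) (vprim (x +i* y))
    ('i%C * g (x +i* y)) ('i%C * (D * 'i%C) / 2).
  apply: (@jet1_cint R (fun s => vprim (x +i* s)) (fun s => g (x +i* s)) y y) => //.
  - by rewrite cabs_i.
  - by move=> s1 s2 l1 l2 _; apply: vprim_v; [exact: cx|lra|exact: l2].
  - move=> e /hD[r r0 hr]; exists r => // s hs.
    have E : x +i* s - x +i* y = 'i%C * (s - y)%:C by apply: complexP => /=; ring.
    have := hr (x +i* s); rewrite E cabsM cabs_i mul1r cabs_real => /(_ hs).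
    by rewrite mulrA.
move=> w [->|->].
  have -> : (fun t : R => vprim (x +i* y + 1 * t%:C)) = (fun t => vprim ((x + t) +i* y)).
    by apply: funext => t; congr vprim; apply: complexP => /=; ring.
  by move: h1; rewrite expr1n mulrA.
have -> : (fun t : R => vprim (x +i* y + 'i%C * t%:C)) = (fun t => vprim (x +i* (y + t))).
  by apply: funext => t; congr vprim; apply: complexP => /=; ring.
by have -> : ('i%C ^+ 2) * (D / 2) = 'i%C * (D * 'i%C) / 2 by rewrite expr2; ring.
Qed.

Lemma vprim_cts (x y : R) : - c < x -> 0 <= y -> forall e : R, 0 < e ->
  exists2 d : R, 0 < d & forall x' y' : R, 0 <= y' -> `|x' - x| < d -> `|y' - y| < d ->
    cabs (vprim (x' +i* y') - vprim (x +i* y)) < e.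
Proof.
move=> cx y0 e e0.
have [D hD] := g_diff y cx; have [r r0 hr] := cdiff_cts hD ltr01.
pose M := 1 + cabs (g (x +i* y)).
have M0 : 0 < M by rewrite ltr_pwDl ?cabs_ge0.
pose d := Num.min (Num.min (r / 2) (x + c)) (e / (4 * M)).
have e4 : 0 < e / (4 * M) by rewrite divr_gt0 // mulr_gt0.
have gM s t : `|s - x| < d -> `|t - y| < d -> cabs (g (s +i* t)) <= M.
  rewrite /d !lt_min => /andP[/andP[h1 _] _] /andP[/andP[h2 _] _].
  rewrite -lerBlDr; apply: (le_trans (rnorm_lb _ _)); apply: ltW; apply: hr.
  apply: (le_lt_trans (cabs_le_ReIm _)) => /=; lra.
exists d.
  by rewrite !lt_min divr_gt0 //= e4 andbT; move: cx; lra.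
move=> x' y' y'0 hx hy.
have [hxc he1] : - c < x' /\ `|x' - x| < e / (4 * M).
  move: hx; rewrite /d !lt_min => /andP[/andP[_ h] ->]; split=> //.
  by move: h; rewrite ltr_norml => /andP[h _]; lra.
have he2 : `|y' - y| < e / (4 * M) by move: hy; rewrite /d !lt_min => /andP[_ ->].
have bound (p q : R) : `|p - q| < e / (4 * M) -> 2 * M * `|p - q| < e / 2.
  rewrite ltr_pdivlMr ?mulr_gt0 // => h.
  by rewrite -(ltr_pM2l (ltr0n R 2)) (_ : 2 * (2 * M * `|p - q|) = `|p - q| * (4 * M)) //; [lra|ring].
have d0 : 0 < d by rewrite !lt_min divr_gt0 //= e4 andbT; move: cx; lra.
have hh x1 x2 : x1 <= x2 -> - c < x1 -> `|x1 - x| < d -> `|x2 - x| < d ->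
    cabs (vprim (x2 +i* y') - vprim (x1 +i* y')) <= 2 * M * (x2 - x1).
  move=> x12 cx1 h1 h2; have [-> hc] := vprim_h cx1 x12 y'0.
  rewrite mul1r; apply: cint_bound => // s /andP[s1 s2]; apply: gM => //.
  by move: h1 h2; rewrite !ltr_norml => /andP[? ?] /andP[? ?]; apply/andP; split; lra.
have hv y1 y2 : y1 <= y2 -> 0 <= y1 -> `|y1 - y| < d -> `|y2 - y| < d ->
    cabs (vprim (x +i* y2) - vprim (x +i* y1)) <= 2 * M * (y2 - y1).
  move=> y12 y10 h1 h2; have [-> hc] := vprim_v cx y10 y12.
  rewrite cabsM cabs_i mul1r; apply: cint_bound => // s /andP[s1 s2]; apply: gM.
    by rewrite subrr normr0.
  by move: h1 h2; rewrite !ltr_norml => /andP[? ?] /andP[? ?]; apply/andP; split; lra.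
have z0 (u : R) : `|u - u| < d by rewrite subrr normr0.
have k1 : cabs (vprim (x' +i* y') - vprim (x +i* y')) < e / 2.
  apply: (le_lt_trans _ (bound _ _ he1)); have [l|l] := leP x x'.
    by rewrite ger0_norm ?subr_ge0 //; apply: hh.
  by rewrite cabs_distC distrC ger0_norm ?subr_ge0 ?(ltW l) //; apply: hh => //; exact: ltW.
have k2 : cabs (vprim (x +i* y') - vprim (x +i* y)) < e / 2.
  apply: (le_lt_trans _ (bound _ _ he2)); have [l|l] := leP y y'.
    by rewrite ger0_norm ?subr_ge0 //; apply: hv.
  by rewrite cabs_distC distrC ger0_norm ?subr_ge0 ?(ltW l) //; apply: hv => //; exact: ltW.
apply: (le_lt_trans (@rnorm_dist R (R[i]^o) _ (vprim (x +i* y')) _)).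
by rewrite -/(cabs (vprim (x' +i* y') - _)) -/(cabs (_ - vprim (x +i* y))); lra.
Qed.

End Primitive.

(** * The maximum principle on a half disc *)

Section HalfDisc.
Variable R : realType.
Implicit Types (P : R[i] -> R[i]).

Definition half_disc : set (R * R) := [set p | p.1 ^+ 2 + p.2 ^+ 2 <= 1 /\ 0 <= p.2].

Definition pt (p : R * R) : R[i] := p.1 +i* p.2.

Lemma cvg_sqsum (p : R * R) : (q.1 ^+ 2 + q.2 ^+ 2 : R) @[q --> p] --> p.1 ^+ 2 + p.2 ^+ 2.
Proof.
apply: cvgD; rewrite expr2; under eq_fun do rewrite expr2; apply: cvgM;
  (try exact: cvg_fst); exact: cvg_snd.
Qed.

Lemma half_disc_compact : compact half_disc.
Proof.
have hc : compact (`[-1, 1]%classic `*` `[0, 1]%classic : set (R * R)).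
  by apply: compact_setX; exact: segment_compact.
apply: (subclosed_compact _ hc).
  have -> : half_disc = [set p : R * R | p.1 ^+ 2 + p.2 ^+ 2 <= 1] `&` [set p : R * R | 0 <= p.2].
    by apply/seteqP; split=> p.
  apply: closedI.
    apply: (@preimage_closed _ _ (fun p : R * R => p.1 ^+ 2 + p.2 ^+ 2) [set x | x <= 1]).
      by move=> p _; exact: cvg_sqsum.
    exact: closed_le.
  apply: (@preimage_closed _ _ (fun p : R * R => p.2) [set x | 0 <= x]).
    by move=> p _; exact: cvg_snd.
  exact: closed_ge.
move=> [x y] [/= h1 h2]; rewrite !in_itv /=.
have hx : x ^+ 2 <= 1 by rewrite (le_trans _ h1) // lerDl sqr_ge0.
have hy : y ^+ 2 <= 1 by rewrite (le_trans _ h1) // lerDr sqr_ge0.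
split; last first.
  by rewrite h2 /= -(@ler_pXn2r _ 2) ?nnegrE // expr1n.
by rewrite -ler_norml -(@ler_pXn2r _ 2) ?nnegrE // real_normK ?num_real // expr1n.
Qed.

(** A maximum of Re (k P) + eps |z|^2 in the interior is excluded by the
    second differences: those of Re (k P) along the two axes cancel, since
    multiplication by i changes the sign of the second order term. *)
Lemma no_interior_max P (k : R[i]) (eps : R) (p : R * R) a b : 0 < eps ->
  p.1 ^+ 2 + p.2 ^+ 2 < 1 -> 0 < p.2 -> jet P (pt p) a b ->
  exists2 q, half_disc q &
    complex.Re (k * P (pt p)) + eps * (p.1 ^+ 2 + p.2 ^+ 2) <
    complex.Re (k * P (pt q)) + eps * (q.1 ^+ 2 + q.2 ^+ 2).
Proof.
move=> e0 hp p20 hj; apply: contrapT => hno.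
have {}hno q : half_disc q -> complex.Re (k * P (pt q)) + eps * (q.1 ^+ 2 + q.2 ^+ 2) <=
    complex.Re (k * P (pt p)) + eps * (p.1 ^+ 2 + p.2 ^+ 2).
  by move=> hq; rewrite leNgt; apply/negP => hl; apply: hno; exists q.
have [r1 [E1 h1]] := hj 1 (or_introl erefl).
have [r2 [E2 h2]] := hj 'i%C (or_intror erefl).
have k0 : 0 < eps / (cabs k + 1) by rewrite divr_gt0 // ltr_wpDl ?cabs_ge0.
move: h1 => /cvg_cabsP /(_ _ k0) [d1 /= d10 hd1].
move: h2 => /cvg_cabsP /(_ _ k0) [d2 /= d20 hd2].
have [d3 d30 hd3] : exists2 d : R, 0 < d & forall t, `|t| < d ->
    half_disc (p.1 + t, p.2) /\ half_disc (p.1, p.2 + t).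
  have m0 : 0 < 1 - (p.1 ^+ 2 + p.2 ^+ 2) by rewrite subr_gt0.
  have x1 : `|p.1| <= 1.
    rewrite -(@ler_pXn2r _ 2) ?nnegrE // real_normK ?num_real // expr1n.
    by have := sqr_ge0 p.2; lra.
  have y1 : `|p.2| <= 1.
    rewrite -(@ler_pXn2r _ 2) ?nnegrE // real_normK ?num_real // expr1n.
    by have := sqr_ge0 p.1; lra.
  exists (Num.min (Num.min 1 p.2) ((1 - (p.1 ^+ 2 + p.2 ^+ 2)) / 3)).
    by rewrite !lt_min p20 divr_gt0 //= ltr01.
  move=> t; rewrite !lt_min => /andP[/andP[t1 t2] t3].
  have tt : t ^+ 2 <= `|t|.
    by rewrite -real_normK ?num_real // expr2 ler_piMl ?normr_ge0 // ltW.
  have cross u : `|u| <= 1 -> 2 * (u * t) <= 2 * `|t|.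
    move=> hu; rewrite ler_pM2l // (le_trans (ler_norm _)) // normrM.
    by rewrite ler_piMl.
  split; split => /=; rewrite ?sqrrD.
  - by have := cross _ x1; rewrite mulr_natl; lra.
  - exact: ltW.
  - by have := cross _ y1; rewrite mulr_natl; lra.
  - by move: t2; rewrite ltr_norml => /andP[? ?]; lra.
pose t := Num.min (Num.min d1 d2) d3 / 2.
have t0 : 0 < t by rewrite divr_gt0 // !lt_min d10 d20 d30.
have [t1 t2 t3] : [/\ t < d1, t < d2 & t < d3].
  have hm : t < Num.min (Num.min d1 d2) d3 by rewrite /t; move: t0; rewrite /t; lra.
  by move: hm; rewrite !lt_min => /andP[/andP[-> ->] ->].
have nt : `|t| = t by rewrite ger0_norm // ltW.
have nt' : `|- t| = t by rewrite normrN.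
have [q1 q2] := hd3 t ltac:(by rewrite nt).
have [q3 q4] := hd3 (- t) ltac:(by rewrite nt').
have s1 := hno _ q1; have s2 := hno _ q2; have s3 := hno _ q3; have s4 := hno _ q4.
have P1 u : P (pt (p.1 + u, p.2)) = P (pt p) + 1 * a * u%:C + (u ^+ 2)%:C * r1 u.
  by rewrite -E1; congr P; apply: complexP => /=; ring.
have P2 u : P (pt (p.1, p.2 + u)) = P (pt p) + 'i%C * a * u%:C + (u ^+ 2)%:C * r2 u.
  by rewrite -E2; congr P; apply: complexP => /=; ring.
have hr u : `|u| = t -> cabs (1 ^+ 2 * b - r1 u) < eps / (cabs k + 1) /\
    cabs ('i%C ^+ 2 * b - r2 u) < eps / (cabs k + 1).
  by move=> hu; split; [apply: hd1|apply: hd2]; rewrite /ball_ /= sub0r normrN hu.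
have [c1 c2] := hr t nt; have [c3 c4] := hr (- t) nt'.
have Rk z : cabs z < eps / (cabs k + 1) -> complex.Re (k * z) < eps.
  rewrite ltr_pdivlMr ?ltr_wpDl ?cabs_ge0 // => hz.
  apply: (le_lt_trans (ler_norm _)); apply: (le_lt_trans (Re_le_cabs _)).
  rewrite cabsM; apply: le_lt_trans hz; rewrite mulrDr mulr1 mulrC lerDl; exact: cabs_ge0.
move: (Rk _ c1) (Rk _ c2) (Rk _ c3) (Rk _ c4).
move: s1 s2 s3 s4; rewrite !P1 !P2 /=.
set X1 := r1 t; set X2 := r2 t; set X3 := r1 (- t); set X4 := r2 (- t).
have i2 : 'i%C ^+ 2 = -1 :> R[i] by apply: complexP => /=; ring.
rewrite i2 expr1n !mul1r mulN1r.
have sq : (- t) ^+ 2 = t ^+ 2 by ring.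
rewrite sq rmorphN /=.
have tt0 : 0 < t ^+ 2 by rewrite exprn_gt0.
have ReS u (v : R[i]) : complex.Re (k * (u%:C * v)) = u * complex.Re (k * v).
  by case: (k) v => [k1 k2] [v1 v2] /=; ring.
rewrite !(mulrDr k) !mulrN !cReD !cReN !ReS => s1 s2 s3 s4 c1' c2' c3' c4'.
have hsum : t ^+ 2 * (complex.Re (k * X1) + complex.Re (k * X2) + complex.Re (k * X3)
   + complex.Re (k * X4) + 4 * eps) <= 0 by lra.
have : complex.Re (k * X1) + complex.Re (k * X2) + complex.Re (k * X3)
   + complex.Re (k * X4) + 4 * eps <= 0 by rewrite -(pmulr_rle0 _ tt0).
lra.
Qed.

(** Were |P| larger at p0 than on the boundary, then Re (k P) + eps |z|^2
    would have an interior maximum, for k the conjugate of P (p0) and eps so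
    small that the boundary values stay below the value at p0. *)
Lemma half_disc_max P (B : R) : 0 <= B ->
  {within half_disc, continuous (fun p => P (pt p) : R[i]^o)} ->
  (forall p, p.1 ^+ 2 + p.2 ^+ 2 < 1 -> 0 < p.2 -> exists a b, jet P (pt p) a b) ->
  (forall p, half_disc p -> p.1 ^+ 2 + p.2 ^+ 2 = 1 \/ p.2 = 0 -> cabs (P (pt p)) <= B) ->
  forall p, half_disc p -> cabs (P (pt p)) <= B.
Proof.
move=> B0 hc hj hB p0 hp0; rewrite leNgt; apply/negP => hlt.
pose k := (complex.Re (P (pt p0))) +i* (- complex.Im (P (pt p0))).
have ck : cabs k = cabs (P (pt p0)) by rewrite !cabsE /= sqrrN.
have hk : complex.Re (k * P (pt p0)) = cabs k ^+ 2.
  by rewrite ck cabs_sq cReM /=; ring.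
have K0 : 0 < cabs k by rewrite ck (le_lt_trans B0).
pose eps := cabs k * (cabs k - B) / 2.
have e0 : 0 < eps by rewrite divr_gt0 // mulr_gt0 // subr_gt0 ck.
pose v p := complex.Re (k * P (pt p)) + eps * (p.1 ^+ 2 + p.2 ^+ 2).
have vc : {within half_disc, continuous v}.
  apply/subspace_continuousP => p hp; apply: cvgD.
    apply: cvg_Re; apply: ccvgM; first exact: (@ccvg_cst R _ _ _ k).
    by move/subspace_continuousP: hc => /(_ p hp).
  apply: cvgM; first exact: cvg_cst.
  by apply: cvg_within_filter; exact: cvg_sqsum.
have [p1 hp1 hmax] := @compact_EVT_max _ _ v half_disc (ex_intro _ p0 hp0) half_disc_compact vc.
rewrite inE in hp1.
have {}hmax q : half_disc q -> v q <= v p1 by move=> hq; apply: hmax; rewrite inE.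
have [hb|hint] : (p1.1 ^+ 2 + p1.2 ^+ 2 = 1 \/ p1.2 = 0) \/
    (p1.1 ^+ 2 + p1.2 ^+ 2 < 1 /\ 0 < p1.2).
  case: (hp1) => h1 h2; move: h1 h2; rewrite le_eqVlt => /predU1P[h|h1]; first by left; left.
  by rewrite le_eqVlt => /predU1P[h|h2]; [left; right|right].
- have := hmax _ hp0; rewrite leNgt => /negP; apply.
  have h1 : v p1 <= cabs k * B + eps.
    apply: lerD.
      apply: (le_trans (ler_norm _)); apply: (le_trans (Re_le_cabs _)).
      by rewrite cabsM ler_wpM2l ?cabs_ge0 //; apply: hB.
    by rewrite -[X in _ <= X]mulr1 ler_pM2l //; case: hp1.
  apply: (le_lt_trans h1); rewrite /v hk.
  apply: (@lt_le_trans _ _ (cabs k ^+ 2)).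
    have : 0 < cabs k * (cabs k - B) by rewrite mulr_gt0 // subr_gt0 ck.
    by rewrite /eps; lra.
  by rewrite lerDl mulr_ge0 ?addr_ge0 ?sqr_ge0 // ltW.
- case: hint => i1 i2; have [a [b hab]] := hj p1 i1 i2.
  have [q hq hlq] := @no_interior_max P k eps p1 a b e0 i1 i2 hab.
  by have := hmax q hq; rewrite leNgt hlq.
Qed.

End HalfDisc.

Arguments half_disc {R}.

(** * Uniqueness of the analytic continuation *)

Section HalfDiscZero.
Variables (R : realType) (g : R[i] -> R[i]) (c : R).
Hypothesis c1 : 1 < c.
Hypothesis g_diff : forall x y : R, - c < x -> exists D, cdiff g (x +i* y) D.
Hypothesis g_real : forall x : R, - c < x -> g (x +i* 0) = 0.

(* modulus 1 on the unit circle, larger than 1 in the unit disc; its pole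
   lies below the real axis *)
Let psi (z : R[i]) : R[i] := (2 - 'i%C * z) * (2 * z + 'i%C)^-1.

Let psi_den (p : R * R) : 0 <= p.2 -> 2 * pt p + 'i%C != 0.
Proof.
move=> h; apply/negP => /eqP /(congr1 (@complex.Im R)) /=; lra.
Qed.

Let psi_jet (p : R * R) : 0 <= p.2 -> exists a b, jet psi (pt p) a b.
Proof.
move=> h; exists (- 'i%C * (2 * pt p + 'i%C)^-1 + (2 - 'i%C * pt p) * (- (2 / (2 * pt p + 'i%C) ^+ 2))).
exists ((2 - 'i%C * pt p) * (2 ^+ 2 / (2 * pt p + 'i%C) ^+ 3) +
  - 'i%C * (- (2 / (2 * pt p + 'i%C) ^+ 2))).
have j1 : jet (fun z => 2 - 'i%C * z) (pt p) (- 'i%C) 0.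
  move=> w _; apply: jet1_eq (jet1_affine (2 - 'i%C * pt p) (w * - 'i%C)) _ _ _ => //.
    by move=> t; ring.
  by rewrite mulr0.
have j2 : jet (fun z => (2 * z + 'i%C)^-1) (pt p) (- (2 / (2 * pt p + 'i%C) ^+ 2))
    (2 ^+ 2 / (2 * pt p + 'i%C) ^+ 3).
  move=> w _; apply: jet1_eq (@jet1_inv R _ (w * 2) (psi_den h)) _ _ _.
  - by move=> t; congr (_^-1); ring.
  - by rewrite mulrN mulrA.
  - by move: (psi_den h); move: (2 * pt p + 'i%C) => X X0; field.
by apply: jet_eq (jetM j1 j2) _ _; [rewrite addrC|rewrite mul0r addr0].
Qed.

Let psi_sq (p : R * R) :
  cabs (2 - 'i%C * pt p) ^+ 2 = cabs (2 * pt p + 'i%C) ^+ 2 + 3 * (1 - (p.1 ^+ 2 + p.2 ^+ 2)).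
Proof. by rewrite !cabs_sq /=; ring. Qed.

Let psi_circle (p : R * R) : 0 <= p.2 -> p.1 ^+ 2 + p.2 ^+ 2 = 1 -> cabs (psi (pt p)) = 1.
Proof.
move=> h hp; have := psi_sq p; rewrite hp subrr mulr0 addr0 => E.
have {}E : cabs (2 - 'i%C * pt p) = cabs (2 * pt p + 'i%C).
  by apply/eqP; rewrite -(@eqrXn2 _ 2) ?cabs_ge0 //; apply/eqP.
by rewrite cabsM cabsV E divff // lt0r_neq0 // cabs_gt0 // psi_den.
Qed.

Let psi_disc (p : R * R) : 0 <= p.2 -> p.1 ^+ 2 + p.2 ^+ 2 < 1 -> 1 < cabs (psi (pt p)).
Proof.
move=> h hp; rewrite cabsM cabsV ltr_pdivlMr ?cabs_gt0 ?psi_den // mul1r.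
by rewrite -(@ltr_pXn2r _ 2) ?nnegrE ?cabs_ge0 // psi_sq ltrDl mulr_gt0 // subr_gt0.
Qed.

Lemma pt_cvg (p : R * R) : pt q @[q --> p] --> (pt p : R[i]^o).
Proof.
apply/cvg_cabsP => e e0.
have e2 : 0 < e / 2 by rewrite divr_gt0.
have h1 : \forall q \near p, `|p.1 - q.1| < e / 2.
  by have /cvgrPdist_lt/(_ _ e2) : q.1 @[q --> p] --> p.1 by exact: cvg_fst.
have h2 : \forall q \near p, `|p.2 - q.2| < e / 2.
  by have /cvgrPdist_lt/(_ _ e2) : q.2 @[q --> p] --> p.2 by exact: cvg_snd.
apply: filterS2 h1 h2 => q h1 h2; apply: (le_lt_trans (cabs_le_ReIm _)) => /=.
lra.
Qed.

Let psi_cvg (p : R * R) : 0 <= p.2 -> psi (pt q) @[q --> p] --> (psi (pt p) : R[i]^o).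
Proof.
move=> h.
have hc (x : R[i]) : x @[q --> p] --> (x : R[i]^o) by exact: (@ccvg_cst R _ _ _ x).
have hp := @pt_cvg p.
have n1 : 2 - 'i%C * pt q @[q --> p] --> (2 - 'i%C * pt p : R[i]^o).
  by apply: ccvgD; [exact: hc|apply: ccvgN; apply: ccvgM; [exact: hc|exact: hp]].
have n2 : 2 * pt q + 'i%C @[q --> p] --> (2 * pt p + 'i%C : R[i]^o).
  by apply: ccvgD; [apply: ccvgM; [exact: hc|exact: hp]|exact: hc].
by apply: ccvgM; [exact: n1|apply: ccvgV; [exact: psi_den|exact: n2]].
Qed.

Let H := vprim g.

Let half_discx (p : R * R) : half_disc p -> - c < p.1.
Proof.
move=> [h1 h2]; have : `|p.1| <= 1.
  rewrite -(@ler_pXn2r _ 2) ?nnegrE // real_normK ?num_real // expr1n.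
  by have := sqr_ge0 p.2; lra.
by rewrite ler_norml => /andP[h _]; move: c1; lra.
Qed.

Let H_cvg (p : R * R) : half_disc p ->
  H (pt q) @[q --> within half_disc (nbhs p)] --> (H (pt p) : R[i]^o).
Proof.
move=> hp; apply/cvg_cabsP => e e0.
have [d d0 hd] := vprim_cts g_diff g_real (half_discx hp) (proj2 hp) e0.
have h1 : \forall q \near p, `|p.1 - q.1| < d.
  by have /cvgrPdist_lt/(_ _ d0) : q.1 @[q --> p] --> p.1 by exact: cvg_fst.
have h2 : \forall q \near p, `|p.2 - q.2| < d.
  by have /cvgrPdist_lt/(_ _ d0) : q.2 @[q --> p] --> p.2 by exact: cvg_snd.
apply: filterS2 h1 h2 => q; rewrite (distrC p.1) (distrC p.2) => h1 h2 [_ h3].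
by rewrite cabs_distC; exact: hd.
Qed.

Let PN N z := H z * psi z ^+ N.

Let PN_cvg N (p : R * R) : half_disc p ->
  PN N (pt q) @[q --> within half_disc (nbhs p)] --> (PN N (pt p) : R[i]^o).
Proof.
move=> hp; elim: N => [|N IH].
  by apply: ccvgM (H_cvg hp) _; under eq_fun do rewrite expr0; exact: (@ccvg_cst R _ _ _ 1).
have E q : PN N q * psi q = PN N.+1 q by rewrite /PN exprSr mulrA.
have hps : psi (pt q) @[q --> within half_disc (nbhs p)] --> (psi (pt p) : R[i]^o).
  by apply: cvg_within_filter; exact: psi_cvg (proj2 hp).
exact: ccvg_ext (ccvg_eq (ccvgM IH hps) (E _)) (fun q => E _).
Qed.

Let PN_jet N (p : R * R) : p.1 ^+ 2 + p.2 ^+ 2 < 1 -> 0 < p.2 ->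
  exists a b, jet (PN N) (pt p) a b.
Proof.
move=> h1 h2; have hp : half_disc p by split; exact: ltW.
have [D hD] := g_diff p.2 (half_discx hp).
have j1 := vprim_jet g_diff g_real (half_discx hp) h2 hD.
have [a [b j2]] := psi_jet (ltW h2).
have [a' [b' j3]] := jetX N j2.
do 2 eexists; exact: (jetM j1 j3).
Qed.

Lemma bernoulli_ineq (d : R) N : 0 <= d -> 1 + N%:R * d <= (1 + d) ^+ N.
Proof.
move=> d0; elim: N => [|N IH]; first by rewrite mul0r addr0 expr0.
rewrite exprSr; apply: (@le_trans _ _ ((1 + N%:R * d) * (1 + d))).
  have -> : (1 + N%:R * d) * (1 + d) = 1 + N.+1%:R * d + N%:R * d ^+ 2 by rewrite -natr1; ring.
  by rewrite lerDl mulr_ge0 ?sqr_ge0.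
by rewrite ler_wpM2r // addr_ge0.
Qed.

(** H vanishes on the diameter and |psi| = 1 on the half circle, so that
    |H psi^N| is at most max |H| on the boundary, hence inside, for every N. As
    |psi| > 1 inside, H vanishes there. *)
Lemma vprim_half_disc0 (p : R * R) : p.1 ^+ 2 + p.2 ^+ 2 < 1 -> 0 < p.2 -> H (pt p) = 0.
Proof.
move=> h1 h2; have hp : half_disc p by split; exact: ltW.
have [p1 hp1 hmax] := @compact_EVT_max _ _ (fun q => cabs (H (pt q))) half_disc
  (ex_intro _ p hp) (@half_disc_compact R) (ltac:(
    apply/subspace_continuousP => q hq; apply/cvgrPdist_lt => e e0;
    move/cvg_cabsP: (H_cvg hq) => /(_ e e0); apply: filterS => s hs;
    apply: le_lt_trans hs; rewrite ler_norml; apply/andP; split;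
    have := @rnorm_lb R (R[i]^o) (H (pt s)) (H (pt q));
    have := @rnorm_lb R (R[i]^o) (H (pt q)) (H (pt s));
    rewrite (@rnorm_distC R (R[i]^o) (H (pt s))) /cabs; lra)).
set M := cabs (H (pt p1)) in hmax.
have {}hmax q : half_disc q -> cabs (H (pt q)) <= M by move=> hq; apply: hmax; rewrite inE.
have M0 : 0 <= M by exact: cabs_ge0.
have key N : cabs (PN N (pt p)) <= M.
  apply: (half_disc_max M0) hp => //.
  - by apply/subspace_continuousP => q hq; exact: PN_cvg.
  - by move=> q; exact: PN_jet.
  - move=> q hq [hq1|hq2]; rewrite cabsM cabsX.
      by rewrite (psi_circle (proj2 hq) hq1) expr1n mulr1; exact: hmax.
    case: q hq hq2 => [q1 q2] hq /= ->; rewrite /H vprim_real cabs0 mul0r //.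
have r1 := psi_disc (ltW h2) h1.
apply: cabs_eq0; apply/eqP; rewrite eq_le cabs_ge0 andbT leNgt; apply/negP => hpos.
set h := cabs _ in hpos.
pose d := cabs (psi (pt p)) - 1.
have d0 : 0 < d by rewrite subr_gt0.
pose N := Num.bound (M / (h * d)).
have : M < h * (N%:R * d).
  have : M / (h * d) < N%:R.
    by have := archi_boundP (divr_ge0 M0 (ltW (mulr_gt0 hpos d0))).
  by rewrite ltr_pdivrMr ?mulr_gt0 // mulrCA.
rewrite ltNge => /negP; apply; apply: le_trans (key N).
rewrite cabsM cabsX ler_wpM2l ?cabs_ge0 //.
have b := bernoulli_ineq N (ltW d0).
rewrite (_ : 1 + d = cabs (psi (pt p))) in b; last by rewrite /d addrC subrK.
by apply: le_trans b; rewrite lerDr.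
Qed.

(** The derivative of vprim along vertical segments is i g, and vprim vanishes. *)
Lemma half_disc0 (p : R * R) : p.1 ^+ 2 + p.2 ^+ 2 < 1 -> 0 < p.2 -> g (pt p) = 0.
Proof.
move=> h1 h2; have hp : half_disc p by split; exact: ltW.
have cx := half_discx hp.
have [D hD] := g_diff p.2 cx.
apply: cabs_eq0; apply/eqP; rewrite eq_le cabs_ge0 andbT leNgt; apply/negP => hpos.
set h := cabs _ in hpos.
have e0 : 0 < h / 4 by rewrite divr_gt0.
have [r r0 hr] := cdiff_cts hD e0.
have y1 : p.2 <= 1.
  by rewrite -(@ler_pXn2r _ 2) ?nnegrE ?(ltW h2) // expr1n; have := sqr_ge0 p.1; lra.
have m0 : 0 < 1 - (p.1 ^+ 2 + p.2 ^+ 2) by rewrite subr_gt0.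
pose s := Num.min (Num.min (r / 2) 1) ((1 - (p.1 ^+ 2 + p.2 ^+ 2)) / 4).
have s0 : 0 < s by rewrite !lt_min !divr_gt0 //= ltr01.
have [s1 s2 s3] : [/\ s <= r / 2, s <= 1 & s <= (1 - (p.1 ^+ 2 + p.2 ^+ 2)) / 4].
  by have := lexx s; rewrite {2}/s !le_min => /andP[/andP[-> ->] ->].
have hz : vprim g (p.1 +i* p.2) = 0 by exact: (@vprim_half_disc0 p).
have hz' : vprim g (p.1 +i* (p.2 + s)) = 0.
  apply: (@vprim_half_disc0 (p.1, p.2 + s)) => /=; last by rewrite addr_gt0.
  have : s ^+ 2 <= s by rewrite expr2 ler_piMl // ltW.
  have : p.2 * s <= s by rewrite ler_piMl // ltW.
  rewrite sqrrD -mulr_natl; lra.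
have ps : p.2 <= p.2 + s by rewrite lerDl ltW.
have [] := vprim_v g_diff cx (ltW h2) ps.
rewrite hz hz' subrr => hi hc.
have {}hi : cint p.2 (p.2 + s) (fun t => g (p.1 +i* t)) = 0.
  by apply: cabs_eq0; have := congr1 (@cabs R) hi; rewrite cabs0 cabsM cabs_i mul1r.
have := @cint_approx R p.2 (p.2 + s) _ (g (pt p)) 0 (h / 4) ps hc.
have Es : p.2 + s - p.2 = s by rewrite addrC addKr.
rewrite Es hi mul0r addr0 sub0r cabsN cabsM cabs_real ger0_norm ?(ltW s0) //.
rewrite -/h => hh.
have : h * s <= 2 * (h / 4) * s.
  apply: hh => t /andP[t1 t2]; rewrite mul0r addr0; apply: ltW; apply: hr.
  have -> : p.1 +i* t - p.1 +i* p.2 = 'i%C * (t - p.2)%:C by apply: complexP => /=; ring.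
  by rewrite cabsM cabs_i mul1r cabs_real ger0_norm ?subr_ge0 //; lra.
rewrite ler_pM2r //; lra.
Qed.

End HalfDiscZero.

Section Identity.
Variable R : realType.
Implicit Types (G : R[i] -> R[i]).

Definition cj (z : R[i]) : R[i] := complex.Re z +i* (- complex.Im z).

Lemma cabs_cj z : cabs (cj z) = cabs z.
Proof. by rewrite !cabsE /= sqrrN. Qed.

(** An affine change of variable turns a half disc with diameter on the real
    axis that contains z into the unit half disc. *)
Lemma identity_upper G : (forall z, 0 < complex.Re z -> exists D, cdiff G z D) ->
  (forall x : R, 0 < x -> G x%:C = 0) ->
  forall z, 0 < complex.Re z -> 0 < complex.Im z -> G z = 0.
Proof.
move=> hG h0 [x y] /= x0 y0.
(* a disc inside the right half plane, centred on the real axis *)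
pose X := (x ^+ 2 + y ^+ 2) / x.
have y20 : 0 < y ^+ 2 by rewrite exprn_gt0.
have xX : x * X = x ^+ 2 + y ^+ 2 by rewrite /X mulrCA divff ?mulr1 // lt0r_neq0.
have hX : x < X by rewrite -(ltr_pM2l x0) xX expr2 ltrDl.
pose rho := X - x / 4.
have rho0 : 0 < rho by rewrite /rho; lra.
pose g w := G (X%:C + rho%:C * w).
have cabs_rho : cabs rho%:C = rho by rewrite cabs_real gtr0_norm.
have c1 : 1 < X / rho by rewrite ltr_pdivlMr // mul1r /rho; lra.
have gd s t : - (X / rho) < s -> exists D, cdiff g (s +i* t) D.
  rewrite -mulNr ltr_pdivrMr // => hs.
  have [|D hD] := hG (X%:C + rho%:C * (s +i* t)).
    by rewrite /= mul0r subr0; move: hs; rewrite mulrC; lra.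
  exists (D * rho%:C) => e e0.
  have er0 : 0 < e / rho by rewrite divr_gt0.
  have [r r0 hr] := hD _ er0; exists (r / rho); first by rewrite divr_gt0.
  move=> w hw; have := hr (X%:C + rho%:C * w).
  have E : X%:C + rho%:C * w - (X%:C + rho%:C * (s +i* t)) = rho%:C * (w - s +i* t) by ring.
  rewrite E cabsM cabs_rho mulrC -ltr_pdivlMr // => /(_ hw).
  have -> : e / rho * (cabs (w - s +i* t) * rho) = e * cabs (w - s +i* t).
    by field; rewrite lt0r_neq0.
  by rewrite mulrA.
have g0 s : - (X / rho) < s -> g (s +i* 0) = 0.
  rewrite -mulNr ltr_pdivrMr // => hs.
  rewrite /g (_ : X%:C + rho%:C * (s +i* 0) = (X + rho * s)%:C); last first.
    by apply: complexP => /=; ring.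
  by apply: h0; move: hs; rewrite mulrC; lra.
have rn0 : rho != 0 by rewrite lt0r_neq0.
have := @half_disc0 R g (X / rho) c1 gd g0 ((x - X) / rho, y / rho) _ (divr_gt0 y0 rho0).
rewrite /g /pt /= (_ : X%:C + rho%:C * _ = x +i* y); last first.
  by apply: complexP => /=; field.
apply; rewrite !expr_div_n -mulrDl ltr_pdivrMr ?exprn_gt0 // mul1r.
rewrite (_ : (x - X) ^+ 2 + y ^+ 2 = X ^+ 2 - x * X); last by rewrite xX -[in RHS]xX; nra.
rewrite (_ : rho ^+ 2 = X ^+ 2 - x * X + (x * X / 2 + x ^+ 2 / 16)); last by rewrite /rho; field.
by rewrite ltrDl addr_gt0 // divr_gt0 // ?exprn_gt0 // mulr_gt0 //; lra.
Qed.

(** The lower quadrant is reduced to the upper one by the reflection that maps G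
    to the function w |-> conj (G (conj w)). *)
Lemma identity_Cplus G : (forall z, 0 < complex.Re z -> exists D, cdiff G z D) ->
  (forall x : R, 0 < x -> G x%:C = 0) ->
  forall z, 0 < complex.Re z -> G z = 0.
Proof.
move=> hG h0 z z0; have [i0|i0|i0] := ltgtP 0 (complex.Im z).
- exact: identity_upper.
- pose G' w := cj (G (cj w)).
  have cjB u v : cj (u - v) = cj u - cj v.
    by apply: complexP => /=; rewrite ?(cReD, cImD, cReN, cImN) /= ?opprD.
  have cjM u v : cj (u * v) = cj u * cj v.
    by apply: complexP; rewrite /= !(cReM, cImM) /=; ring.
  have cjK u : cj (cj u) = u by apply: complexP; rewrite /= ?opprK.
  have : G' (cj z) = 0.
    apply: identity_upper => //=; last by rewrite oppr_gt0.
    + move=> w w0; have [|D hD] := hG (cj w); first exact: w0.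
      exists (cj D) => e e0; have [r r0 hr] := hD e e0; exists r => // v hv.
      have := hr (cj v); rewrite -cjB cabs_cj => /(_ hv).
      have -> : G' v - G' w - cj D * (v - w) = cj (G (cj v) - G (cj w) - D * cj (v - w)).
        by rewrite /G' (cjB (_ - _)) (cjB (G _)) cjM cjK.
      by rewrite cabs_cj.
    + move=> x x0; rewrite /G' (_ : cj x%:C = x%:C) ?h0 //.
        by apply: complexP => /=; rewrite ?oppr0.
      by apply: complexP => /=; rewrite ?oppr0.
  by rewrite /G' cjK => /(congr1 cj); rewrite cjK => ->; apply: complexP => /=; rewrite ?oppr0.
- by rewrite (_ : z = (complex.Re z)%:C) ?h0 //; apply: complexP => /=.
Qed.

End Identity.

(** * Uniqueness of Bochner integrals *)

Section Fibers.
Variables (R : realType).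
Local Notation mR := (measurableTypeR R).
Variables (m : {finite_measure set mR -> \bar R}) (D : set mR).
Hypothesis mD : measurable D.
Variables (W : eqType) (q : R -> W) (r : seq W).
Hypotheses (ur : uniq r) (qr : forall t, q t \in r)
  (mq : forall w, measurable (q @^-1` [set w] : set mR)).

Definition fiber_mass w := fine (m (D `&` q @^-1` [set w])).

Lemma fiber_mass_ge0 w : 0 <= fiber_mass w.
Proof. by rewrite fine_ge0. Qed.

Lemma fiber_massE w : (m (D `&` q @^-1` [set w]) = (fiber_mass w)%:E)%E.
Proof. by rewrite /fiber_mass fineK // fin_num_measure //; apply: measurableI. Qed.

Lemma integral_fibers (psi : W -> R) : (forall w, 0 <= psi w) ->
  (\int[m]_(t in D) (psi (q t))%:E = (\sum_(w <- r) fiber_mass w * psi w)%:E)%E.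
Proof.
move=> psi0.
transitivity (\int[m]_(t in D) (\sum_(w <- r) (psi w * \1_(q @^-1` [set w]) t)%:E))%E.
  apply: eq_integral => t _; rewrite sumEFin; congr (_%:E).
  rewrite (bigD1_seq (q t)) //= indicE mem_set // mulr1 big1 ?addr0 // => w wq.
  by rewrite indicE memNset ?mulr0 // => /= h; move: wq; rewrite h eqxx.
rewrite ge0_integral_sum //.
- rewrite -sumEFin; apply: eq_bigr => w _.
  under eq_integral do rewrite EFinM.
  have -> : (\int[m]_(t in D) ((psi w)%:E * (\1_(q @^-1` [set w]) t)%:E) =
      (psi w)%:E * \int[m]_(t in D) (\1_(q @^-1` [set w]) t)%:E)%E.
    apply: ge0_integralZl; [exact: mD| | |by rewrite lee_fin].
      by apply/measurable_EFinP; exact: measurable_indic.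
    by move=> t _; rewrite lee_fin indicE ler0n.
  by rewrite integral_indic // (setIC _ D) muleC EFinM -fiber_massE.
- move=> w; apply/measurable_EFinP; apply: measurable_funM.
    exact: measurable_cst.
  exact: measurable_indic.
- by move=> w t _; rewrite lee_fin mulr_ge0 // indicE ler0n.
Qed.

(** A simple integral is a sum over the values in V. Any finite-valued q through
    which the function factors may be used in place of these values, which
    allows several functions to be compared on the same pieces. *)
Lemma simple_integral_fibers (V : normedModType R[i]) (h : W -> V) :
  simple_integral m D (h \o q) = \sum_(w <- r) (fiber_mass w)%:C *: h w.
Proof.
have fr : finite_set (range (h \o q)).
  apply: (@sub_finite_set _ _ [set` [seq h w | w <- r]]); last exact: finite_seq.
  by move=> _ [t _ <-] /=; apply: map_f.
rewrite /simple_integral fsbig_finite //=.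
pose F : seq V := finmap.enum_fset (fset_set (range (h \o q))).
have hm v : fine (m (D `&` (h \o q) @^-1` [set v])) =
    \sum_(w <- r) fiber_mass w * (h w == v)%:R.
  have mA : measurable (D `&` (h \o q) @^-1` [set v]).
    apply: measurableI => //.
    have -> : (h \o q) @^-1` [set v] = \bigcup_(w in [set w | w \in r /\ h w = v]) (q @^-1` [set w]).
      apply/seteqP; split=> [t /= ht|t [w /= [_ <-] ->]//]; by exists (q t).
    apply: fin_bigcup_measurable => //.
    by apply: (@sub_finite_set _ _ [set` r]); [move=> w []|exact: finite_seq].
  have := @integral_fibers (fun w => (h w == v)%:R) (fun w => ler0n _ _).
  have -> : (\int[m]_(t in D) ((h (q t) == v)%:R)%:E)%E =
      (\int[m]_(t in D) (\1_((h \o q) @^-1` [set v]) t)%:E)%E.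
    apply: eq_integral => t _; rewrite indicE (_ : (t \in _) = (h (q t) == v)) //.
    by apply/idP/eqP => [|h1]; rewrite inE.
  move=> E; apply: EFin_inj; rewrite -E fineK ?fin_num_measure //.
  rewrite integral_mkcond.
  rewrite (_ : (fun t => _) \_ D = (fun t => (\1_(D `&` (h \o q) @^-1` [set v]) t)%:E)).
    by rewrite integral_indic // setIT.
  apply: funext => t; rewrite patchE !indicE in_setI.
  by case: (t \in D).
under eq_bigr do rewrite hm.
have -> : \sum_(v <- F) (\sum_(w <- r) fiber_mass w * (h w == v)%:R)%:C *: v =
    \sum_(v <- F) \sum_(w <- r) (fiber_mass w * (h w == v)%:R)%:C *: v.
  by apply: eq_bigr => v _; rewrite rmorph_sum scaler_suml.
rewrite exchange_big /=; apply: eq_bigr => w _.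
have [hw|hw] := boolP (h w \in F).
  rewrite (bigD1_seq (h w)) ?finmap.fset_uniq //= eqxx mulr1 big1 ?addr0 // => v vw.
  by rewrite eq_sym (negbTE vw) mulr0 scale0r.
have -> : fiber_mass w = 0.
  rewrite /fiber_mass (_ : _ `&` _ = set0) ?measure0 //.
  apply/seteqP; split=> // t [_ /= qt].
  by move: hw => /negP; apply; rewrite (in_fset_set fr); apply/mem_set; exists t => //=; rewrite qt.
by rewrite scale0r big1 // => v _; rewrite mul0r scale0r.
Qed.

End Fibers.

Section BochnerUnique.
Variables (R : realType) (V : normedModType R[i]).
Local Notation mR := (measurableTypeR R).
Variables (m : {finite_measure set mR -> \bar R}) (D : set mR).
Hypothesis mD : measurable D.
Implicit Types (f : R -> V) (s : {fimfun R >-> V}).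

(* enough measurability of f to integrate its distance to simple functions *)
Definition dist_measurable f := forall v : V, measurable_fun D (fun t : mR => rnorm (f t - v)).

(** Both sides are sums over the common partition by the pair of values (s t, s'
    t). *)
Lemma simple_integral_dist s s' :
  (forall v, measurable (s @^-1` [set v] : set mR)) ->
  (forall v, measurable (s' @^-1` [set v] : set mR)) ->
  ((rnorm (simple_integral m D s - simple_integral m D s'))%:E <=
   \int[m]_(t in D) (rnorm (s t - s' t))%:E)%E.
Proof.
move=> ms ms'.
pose q t := (s t, s' t).
pose r := undup [seq (a, b) | a <- finmap.enum_fset (fset_set (range s)),
  b <- finmap.enum_fset (fset_set (range s'))].
have ur : uniq r by exact: undup_uniq.
have fs : finite_set (range s) by exact: fimfunP.
have fs' : finite_set (range s') by exact: fimfunP.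
have qr t : q t \in r.
  rewrite mem_undup; apply/allpairsP; exists (s t, s' t); split=> //=.
    by rewrite (in_fset_set fs) inE; exists t.
  by rewrite (in_fset_set fs') inE; exists t.
have mq w : measurable (q @^-1` [set w] : set mR).
  have -> : q @^-1` [set w] = (s @^-1` [set w.1]) `&` (s' @^-1` [set w.2]).
    by apply/seteqP; split=> t /=; rewrite /q; case: w => a b /= [-> ->].
  exact: measurableI.
have E1 := simple_integral_fibers m mD ur qr mq (fun w : V * V => w.1).
have E2 := simple_integral_fibers m mD ur qr mq (fun w : V * V => w.2).
have -> : simple_integral m D s = simple_integral m D ((fun w : V * V => w.1) \o q) by [].
have -> : simple_integral m D s' = simple_integral m D ((fun w : V * V => w.2) \o q) by [].
rewrite E1 E2 -sumrB.
have E3 : (\int[m]_(t in D) (rnorm (s t - s' t))%:E)%E = _ :=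
  integral_fibers m mD ur qr mq (fun w : V * V => rnorm_ge0 (w.1 - w.2)).
rewrite E3.
rewrite lee_fin; apply: (le_trans (rnorm_sum _ _ _)); apply: ler_sum => w _.
by rewrite -scalerBr rnormZ cabs_real ger0_norm // fiber_mass_ge0.
Qed.

Lemma simple_dist_measurable s : (forall v, measurable (s @^-1` [set v] : set mR)) ->
  dist_measurable s.
Proof.
move=> ms v _ B mB.
have fs : finite_set (range s) by exact: fimfunP.
have -> : D `&` (fun t => rnorm (s t - v)) @^-1` B =
    \bigcup_(w in range s `&` [set w | B (rnorm (w - v))]) (D `&` (s @^-1` [set w])).
  apply/seteqP; split=> [t [Dt /= h]|t [w [_ /= h] [Dt /= E]]]; last by split; rewrite //= E.
  by exists (s t); [split=> //=; exists t|split].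
apply: fin_bigcup_measurable; first by apply: sub_finite_set fs => w [].
by move=> w _; exact: measurableI.
Qed.

Lemma dist_measurable_simple f s : dist_measurable f ->
  (forall v, measurable (s @^-1` [set v] : set mR)) ->
  measurable_fun D (fun t : mR => rnorm (f t - s t)).
Proof.
move=> mf ms _ B mB.
have fs : finite_set (range s) by exact: fimfunP.
have -> : D `&` (fun t => rnorm (f t - s t)) @^-1` B = \bigcup_(v in range s)
    ((D `&` (fun t => rnorm (f t - v)) @^-1` B) `&` (s @^-1` [set v])).
  apply/seteqP; split=> [t [Dt /= h]|t [v _ [[Dt /= h]] /= ->]]; last by split.
  by exists (s t); [exists t|split].
apply: fin_bigcup_measurable => // v _; apply: measurableI => //.
exact: mf.
Qed.

(** The operator bochner_integral chooses a value; uniqueness makes any value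
    that satisfies the specification equal to the chosen one. *)
Lemma is_bochner_integral_unique f y y' : dist_measurable f ->
  is_bochner_integral m D f y -> is_bochner_integral m D f y' -> y = y'.
Proof.
move=> mf [s [ms _ is_ cs]] [s' [ms' _ is' cs']].
apply/eqP; rewrite -subr_eq0; apply/eqP/rnorm_eq0/eqP.
rewrite eq_le rnorm_ge0 andbT; apply/ler_addgt0Pr => e e0; rewrite add0r.
have e4 : 0 < e / 4 by rewrite divr_gt0.
move/fine_cvgP: is_ => [fin1 /cvgrPdist_lt/(_ _ e4) h1].
move/fine_cvgP: is' => [fin2 /cvgrPdist_lt/(_ _ e4) h2].
move/cvg_rnormP: cs => /(_ _ e4) h3; move/cvg_rnormP: cs' => /(_ _ e4) h4.
near \oo => n.
have k1 : `|0 - (fine \o (fun n => \int[m]_(t in D) (rnorm (f t - s n t))%:E)%E) n| < e / 4 by near: n.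
have k2 : `|0 - (fine \o (fun n => \int[m]_(t in D) (rnorm (f t - s' n t))%:E)%E) n| < e / 4 by near: n.
have k3 : rnorm (y - simple_integral m D (s n)) < e / 4 by near: n.
have k4 : rnorm (y' - simple_integral m D (s' n)) < e / 4 by near: n.
have k5 : (\int[m]_(t in D) (rnorm (f t - s n t))%:E)%E \is a fin_num by near: n.
have k6 : (\int[m]_(t in D) (rnorm (f t - s' n t))%:E)%E \is a fin_num by near: n.
have h5 := simple_integral_dist (ms n) (ms' n).
have h6 : (\int[m]_(t in D) (rnorm (s n t - s' n t))%:E <=
   \int[m]_(t in D) (rnorm (f t - s n t))%:E + \int[m]_(t in D) (rnorm (f t - s' n t))%:E)%E.
  rewrite -ge0_integralD //; first last.
  - by apply/measurable_EFinP; exact: dist_measurable_simple.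
  - by move=> t _; rewrite lee_fin rnorm_ge0.
  - by apply/measurable_EFinP; exact: dist_measurable_simple.
  - by move=> t _; rewrite lee_fin rnorm_ge0.
  apply: ge0_le_integral => //.
  - by move=> t _; rewrite lee_fin rnorm_ge0.
  - by apply/measurable_EFinP; apply: dist_measurable_simple => //;
     exact: simple_dist_measurable.
  - by apply: emeasurable_funD; apply/measurable_EFinP; exact: dist_measurable_simple.
  - move=> t _; rewrite -EFinD lee_fin (rnorm_distC (f t)).
    exact: rnorm_dist.
have {h5 h6} h7 := le_trans h5 h6.
rewrite -(fineK k5) -(fineK k6) -EFinD lee_fin in h7.
move: k1 k2; rewrite !sub0r !normrN /= !ger0_norm ?fine_ge0 ?integral_ge0 //;
  try (by move=> t _; rewrite lee_fin rnorm_ge0).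
move=> k1 k2.
have d1 := rnorm_dist y (simple_integral m D (s n)) y'.
have d2 := rnorm_dist (simple_integral m D (s n)) (simple_integral m D (s' n)) y'.
rewrite (rnorm_distC y') in k4; lra.
Unshelve. all: by end_near. Qed.

End BochnerUnique.

(** * Bochner integrals of bounded continuous functions as limits of Riemann sums *)

Section Limits.
Variables (R : realType).

(** Sequential completeness, a property shared by X and by the scalars R[i]^o. *)
Definition has_limits (V : normedModType R[i]) := forall u : nat -> V,
  (forall e : R, 0 < e -> exists N, forall p n, (N <= p)%N -> (N <= n)%N ->
     rnorm (u p - u n) < e) ->
  exists l : V, u n @[n --> \oo] --> l.

Lemma complete_has_limits (V : completeNormedModType R[i]) : has_limits V.
Proof.
move=> u hu; apply/cvg_ex/cauchy_cvgP/cauchyP => e e0.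
have eE : e = (complex.Re e)%:C.
  by move: e0; rewrite ltcE /= => /andP[/eqP i0 _]; apply: complexP => /=.
have : 0 < complex.Re e by move: e0; rewrite ltcE /= => /andP[].
move=> /hu[N hN]; exists (u N); exists N => // n /= Nn.
by rewrite -ball_normE /ball_ /= eE normE_rnorm ltcR; exact: hN.
Qed.

Lemma complex_has_limits : has_limits (R[i]^o).
Proof.
move=> u hu.
have cv (p : R[i] -> R) : (forall x y, p (x - y) = p x - p y) ->
    (forall x, `|p x| <= cabs x) -> cvg (p (u n) @[n --> \oo]).
  move=> pB pa; apply/cauchy_cvgP/cauchyP => e /hu[N hN].
  exists (p (u N)); exists N => // n /= Nn.
  rewrite -ball_normE /ball_ /= -pB; apply: (le_lt_trans (pa _)); exact: hN.
have /cvg_ex[a ha] := cv _ (@cReB R) (@Re_le_cabs R).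
have /cvg_ex[b hb] := cv _ (@cImB R) (@Im_le_cabs R).
exists (a +i* b); apply/cvg_cabsP => e e0.
have e2 : 0 < e / 2 by rewrite divr_gt0.
move/cvgrPdist_lt: ha => /(_ _ e2) ha; move/cvgrPdist_lt: hb => /(_ _ e2) hb.
apply: filterS2 ha hb => n h1 h2; apply: (le_lt_trans (cabs_le_ReIm _)).
by rewrite cReB cImB /=; lra.
Qed.

End Limits.

Section Steps.
Variables (R : realType) (V : normedModType R[i]).
Local Notation mR := (measurableTypeR R).
Implicit Types (phi : R -> V) (d : R) (N : nat) (m : {finite_measure set mR -> \bar R}).

(** Continuous and bounded on [0, +oo); nothing is assumed at negative points,
    where the values of a semigroup are not meaningful. *)
Definition bcont phi :=
  (forall t, 0 <= t -> forall e : R, 0 < e -> exists2 r : R, 0 < r &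
     forall s, 0 <= s -> `|s - t| < r -> rnorm (phi s - phi t) < e) /\
  exists M : R, forall t, 0 <= t -> rnorm (phi t) <= M.

(** The index N is given to all the points outside [0, N d), where stepfun is 0. *)
Definition stepidx d N (t : R) : nat :=
  if (0 <= t) && (t < N%:R * d) then Num.truncn (t / d) else N.

Definition stepfun d N phi (t : R) : V :=
  if (stepidx d N t < N)%N then phi ((stepidx d N t)%:R * d) else 0.

Lemma stepidx_le d N t : 0 < d -> (stepidx d N t <= N)%N.
Proof.
move=> d0; rewrite /stepidx; case: ifP => // /andP[t0 tN].
have /andP[h1 _] := truncn_itv (divr_ge0 t0 (ltW d0)).
rewrite -(@ler_nat R); apply: (le_trans h1); rewrite ler_pdivrMr //; exact: ltW.
Qed.

Lemma stepidx_fiber d N k : 0 < d -> (k < N)%N ->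
  stepidx d N @^-1` [set k] = `[k%:R * d, k.+1%:R * d[%classic.
Proof.
move=> d0 kN; apply/seteqP; split=> t /=.
  rewrite /stepidx; case: ifP => [/andP[t0 _] <-|_ E]; last by move: kN; rewrite E ltnn.
  have /andP[h1 h2] := truncn_itv (divr_ge0 t0 (ltW d0)).
  by rewrite in_itv /= -ler_pdivlMr // h1 -ltr_pdivrMr.
rewrite in_itv /= => /andP[h1 h2].
have t0 : 0 <= t by apply: le_trans h1; rewrite mulr_ge0 // ltW.
have tN : t < N%:R * d by apply: (lt_le_trans h2); rewrite ler_pM2r // ler_nat.
rewrite /stepidx t0 tN /=; apply: truncn_def.
by rewrite ler_pdivlMr // h1 ltr_pdivrMr.
Qed.

Lemma stepidx_measurable d N k : 0 < d -> measurable (stepidx d N @^-1` [set k] : set mR).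
Proof.
move=> d0; have [kN|kN|->] := ltngtP k N.
- by rewrite stepidx_fiber //; exact: measurable_itv.
- rewrite (_ : _ @^-1` _ = set0) //; apply/seteqP; split=> // t /= h.
  by have := stepidx_le N t d0; rewrite h leqNgt kN.
- rewrite (_ : _ @^-1` _ = ~` `[0, N%:R * d[%classic); first by apply: measurableC; exact: measurable_itv.
  apply/seteqP; split=> t /=; rewrite in_itv /= /stepidx.
    case: ifP => [/andP[t0 tN] E _|_ _ //].
    have /andP[h1 _] := truncn_itv (divr_ge0 t0 (ltW d0)).
    by move: tN; rewrite -ltr_pdivrMr // ltNge -E h1.
  by case: ifP.
Qed.

Lemma stepfun_finite d N phi : finite_set (range (stepfun d N phi)).
Proof.
apply: (@sub_finite_set _ _ [set` 0 :: [seq phi (k%:R * d) | k <- iota 0 N]]); last exact: finite_seq.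
move=> _ [t _ <-] /=; rewrite /stepfun; case: ifP => h; last by rewrite mem_head.
rewrite inE; apply/orP; right; apply/mapP; exists (stepidx d N t) => //.
by rewrite mem_iota.
Qed.

HB.instance Definition _ d N phi := @FiniteImage.Build R V (stepfun d N phi) (stepfun_finite d N phi).

Definition stepval d N phi (k : nat) : V := if (k < N)%N then phi (k%:R * d) else 0.

Lemma stepfun_measurable d N phi v : 0 < d ->
  measurable (stepfun d N phi @^-1` [set v] : set mR).
Proof.
move=> d0.
have -> : stepfun d N phi @^-1` [set v] = \bigcup_(k in [set k | (k <= N)%N /\ stepval d N phi k = v])
    (stepidx d N @^-1` [set k]).
  apply/seteqP; split=> [t /= h|t [k /= [_ h] E]]; last by rewrite /stepfun E.
  by exists (stepidx d N t) => //=; split=> //; exact: stepidx_le.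
apply: fin_bigcup_measurable; last by move=> k _; exact: stepidx_measurable.
apply: (@sub_finite_set _ _ [set` iota 0 N.+1]); last exact: finite_seq.
by move=> k [/= kN _]; change (k \in iota 0 N.+1); rewrite mem_iota add0n ltnS.
Qed.

Definition rsum d N m phi : V :=
  \sum_(k < N) (fine (m `[k%:R * d, k.+1%:R * d[%classic))%:C *: phi (k%:R * d).

Lemma simple_integral_step d N m phi : 0 < d ->
  simple_integral m (Rplus R) (stepfun d N phi) = rsum d N m phi.
Proof.
move=> d0.
have mD : measurable (Rplus R : set mR) by exact: measurable_itv.
have ui : uniq (iota 0 N.+1) by exact: iota_uniq.
have qi t : stepidx d N t \in iota 0 N.+1.
  by rewrite mem_iota /= add0n ltnS stepidx_le.
have := simple_integral_fibers m mD ui qi (fun k => stepidx_measurable N k d0) (stepval d N phi).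
have -> : simple_integral m (Rplus R) (stepval d N phi \o stepidx d N) =
  simple_integral m (Rplus R) (stepfun d N phi) by [].
move=> ->; rewrite -[iota 0 N.+1]/(index_iota 0 N.+1) big_nat_recr //=.
rewrite {2}/stepval ltnn scaler0 addr0 big_mkord; apply: eq_bigr => k _.
rewrite /stepval ltn_ord; congr (_%:C *: _); rewrite /fiber_mass stepidx_fiber //.
congr (fine (m _)); apply: setIidr => t; rewrite /Rplus /= !in_itv /= andbT => /andP[h _].
by apply: le_trans h; rewrite mulr_ge0 // ltW.
Qed.

Lemma bcont_bound phi : bcont phi -> exists2 M : R, 0 <= M & forall t, 0 <= t -> rnorm (phi t) <= M.
Proof.
move=> [_ [M hM]]; exists M => //; exact: le_trans (rnorm_ge0 _) (hM 0 (lexx 0)).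
Qed.

Lemma bcont_dist_measurable phi : bcont phi -> dist_measurable (Rplus R : set mR) phi.
Proof.
move=> [hc _] v; apply: subspace_continuous_measurable_fun; first exact: measurable_itv.
apply/subspace_continuousP => t; rewrite /Rplus /= in_itv /= andbT => t0.
apply/cvgrPdist_lt => e e0; have [r r0 hr] := hc t t0 e e0.
have : \forall s \near t, `|s - t| < r.
  by exists r => //= s; rewrite /ball_ /= distrC.
apply: filterS => s st; rewrite /= in_itv /= andbT => s0.
have h := hr s s0 st; apply: le_lt_trans h; rewrite ler_norml; apply/andP; split.
  have := rnorm_dist (phi s) (phi t) v; rewrite -/(rnorm _); lra.
have := rnorm_dist (phi t) (phi s) v; rewrite (rnorm_distC (phi t) (phi s)); lra.
Qed.

(** The meshes h / (n + 1), used up to (n + 1) h, become fine while the covered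
    intervals exhaust [0, +oo). As h is a multiple of them, a translation by h
    maps the points of the mesh to such points. *)
Definition mesh (h : R) n := h / n.+1%:R.

Lemma mesh_gt0 h n : 0 < h -> 0 < mesh h n.
Proof. by move=> h0; rewrite divr_gt0. Qed.

Definition mesh_num n := (n.+1 * n.+1)%N.

Lemma mesh_range h n : (mesh_num n)%:R * mesh h n = n.+1%:R * h.
Proof.
have : n.+1%:R != 0 :> R by rewrite pnatr_eq0.
by rewrite /mesh /mesh_num natrM; move: (n.+1%:R) => x x0; field.
Qed.

Lemma stepfun_cvg phi h t : 0 < h -> bcont phi -> 0 <= t ->
  stepfun (mesh h n) (mesh_num n) phi t @[n --> \oo] --> phi t.
Proof.
move=> h0 [hc _] t0; apply/cvg_rnormP => e e0.
have [r r0 hr] := hc t t0 e e0.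
exists (maxn (Num.bound (t / h)) (Num.bound (h / r))) => // n /=; rewrite geq_max => /andP[n1 n2].
have d0 := mesh_gt0 n h0.
have tN : t < (mesh_num n)%:R * mesh h n.
  rewrite mesh_range -ltr_pdivrMr //; apply: (lt_le_trans (archi_boundP (divr_ge0 t0 (ltW h0)))).
  by rewrite ler_nat (leq_trans n1).
have dr : mesh h n < r.
  rewrite /mesh ltr_pdivrMr // mulrC -ltr_pdivrMr //.
  apply: (lt_le_trans (archi_boundP (divr_ge0 (ltW h0) (ltW r0)))).
  by rewrite ler_nat (leq_trans n2).
have /andP[i1 i2] := truncn_itv (divr_ge0 t0 (ltW d0)).
rewrite /stepfun /stepidx t0 tN /=.
have -> : (Num.truncn (t / mesh h n) < mesh_num n)%N.
  by rewrite -(@ltr_nat R); apply: (le_lt_trans i1); rewrite ltr_pdivrMr.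
rewrite rnorm_distC; apply: hr; first by rewrite mulr_ge0 // ltW.
rewrite ler_pdivlMr // in i1; rewrite ltr_pdivrMr // -natr1 mulrDl mul1r in i2.
by rewrite distrC ger0_norm ?subr_ge0 //; lra.
Qed.

Hypothesis limV : has_limits V.

Lemma step_integral_cvg0 m phi h : 0 < h -> bcont phi ->
  (\int[m]_(t in Rplus R) (rnorm (phi t - stepfun (mesh h n) (mesh_num n) phi t))%:E)%E
     @[n --> \oo] --> 0%E.
Proof.
move=> h0 hb; have [M M0 hM] := bcont_bound hb.
have mD : measurable (Rplus R : set mR) by exact: measurable_itv.
pose f n (t : mR) := (rnorm (phi t - stepfun (mesh h n) (mesh_num n) phi t))%:E.
have mf n : measurable_fun (Rplus R) (f n).
  apply/measurable_EFinP; apply: dist_measurable_simple => //.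
    exact: bcont_dist_measurable.
  by move=> v; apply: stepfun_measurable; exact: mesh_gt0.
have h1 : {ae m, forall t : mR, Rplus R t -> f ^~ t @ \oo --> cst 0%E t}.
  apply: aeW => t; rewrite /Rplus /= in_itv /= andbT => t0.
  apply/fine_cvgP; split; first by near=> n.
  apply/cvgrPdist_lt => e e0.
  have /cvg_rnormP/(_ e e0) := stepfun_cvg h0 hb t0.
  by apply: filterS => n hn; rewrite /= sub0r normrN ger0_norm // rnorm_ge0.
have h2 : m.-integrable (Rplus R : set mR) (cst (M + M)%:E).
  exact: finite_measure_integrable_cst.
have h3 : {ae m, forall (t : mR) n, Rplus R t -> (`|f n t| <= cst (M + M)%:E t)%E}.
  apply: aeW => t n; rewrite /Rplus /= in_itv /= andbT => t0.
  rewrite /f /= ger0_norm ?rnorm_ge0 // lee_fin.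
  apply: (le_trans (rnormB _ _)); apply: lerD; first exact: hM.
  rewrite /stepfun; case: ifP => _; last by rewrite rnorm0.
  by apply: hM; rewrite mulr_ge0 // ltW // mesh_gt0.
have [_ _] := dominated_convergence mD mf (@measurable_cst _ _ _ _ _ _) h1 h2 h3.
by rewrite integral0.
Unshelve. all: by end_near. Qed.

(** The Riemann sums are the integrals of the step functions, and these converge
    to phi in mean by dominated convergence. *)
Lemma rsum_cvg m phi h : 0 < h -> bcont phi ->
  rsum (mesh h n) (mesh_num n) m phi @[n --> \oo] --> bochner_integral m (Rplus R) phi.
Proof.
move=> h0 hb.
have mD : measurable (Rplus R : set mR) by exact: measurable_itv.
have hmf := bcont_dist_measurable hb.
pose s n : {fimfun R >-> V} := stepfun (mesh h n) (mesh_num n) phi.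
have ms n v : measurable (s n @^-1` [set v] : set mR).
  by apply: stepfun_measurable; exact: mesh_gt0.
have hI := step_integral_cvg0 m h0 hb.
have E n : simple_integral m (Rplus R) (s n) = rsum (mesh h n) (mesh_num n) m phi.
  by apply: simple_integral_step; exact: mesh_gt0.
have [y hy] : exists y : V, rsum (mesh h n) (mesh_num n) m phi @[n --> \oo] --> y.
  apply: limV => e e0; have e2 : 0 < e / 2 by rewrite divr_gt0.
  move/fine_cvgP: hI => [[N1 _ fin1] /cvgrPdist_lt/(_ _ e2)[N2 _ h1]].
  have hn n : (maxn N1 N2 <= n)%N ->
      (\int[m]_(t in Rplus R) (rnorm (phi t - s n t))%:E < (e / 2)%:E)%E.
    rewrite geq_max => /andP[n1 n2].
    have := h1 n n2; rewrite /= sub0r normrN => hlt.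
    rewrite -(fineK (fin1 n n1)) lte_fin; apply: le_lt_trans hlt.
    exact: ler_norm.
  exists (maxn N1 N2) => p n pN nN.
  rewrite -!E -lte_fin.
  apply: (le_lt_trans (simple_integral_dist m mD (ms p) (ms n))).
  apply: (@le_lt_trans _ _ (\int[m]_(t in Rplus R) (rnorm (phi t - s p t))%:E +
     \int[m]_(t in Rplus R) (rnorm (phi t - s n t))%:E)%E); last first.
    have -> : e = e / 2 + e / 2 by field.
    by rewrite EFinD; apply: lteD; exact: hn.
  rewrite -ge0_integralD //; first last.
  - by apply/measurable_EFinP; exact: dist_measurable_simple.
  - by move=> t _; rewrite lee_fin rnorm_ge0.
  - by apply/measurable_EFinP; exact: dist_measurable_simple.
  - by move=> t _; rewrite lee_fin rnorm_ge0.
  apply: ge0_le_integral => //.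
  - by move=> t _; rewrite lee_fin rnorm_ge0.
  - by apply/measurable_EFinP; apply: dist_measurable_simple => //;
     exact: simple_dist_measurable.
  - by apply: emeasurable_funD; apply/measurable_EFinP; exact: dist_measurable_simple.
  - move=> t _; rewrite -EFinD lee_fin (rnorm_distC (phi t)).
    exact: rnorm_dist.
have hby : is_bochner_integral m (Rplus R) phi y.
  exists s; split => //.
  - apply: aeW => t; rewrite /Rplus /= in_itv /= andbT => t0.
    exact: stepfun_cvg.
  - by under eq_fun do rewrite E.
suff -> : bochner_integral m (Rplus R) phi = y by [].
apply: (is_bochner_integral_unique mD hmf _ hby).
by rewrite /bochner_integral; apply: getPex; exists y.
Qed.

End Steps.

(** * Calculus of the integrals *)

Section BochnerCalculus.
Variables (R : realType).
Local Notation mR := (measurableTypeR R).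
Implicit Types (V : normedModType R[i]) (m : {finite_measure set mR -> \bar R}).

Lemma rsum_cvg1 V (limV : has_limits V) m (phi : R -> V) : bcont phi ->
  rsum (mesh 1 n) (mesh_num n) m phi @[n --> \oo] --> bochner_integral m (Rplus R) phi.
Proof. exact: rsum_cvg. Qed.
Arguments rsum_cvg1 {V} limV m {phi}.

Lemma cvg_eqP V (u v : nat -> V) (a b : V) : u n @[n --> \oo] --> a -> v n @[n --> \oo] --> b ->
  (forall n, u n = v n) -> a = b.
Proof.
move=> ha hb E; have Euv : u = v by apply: funext.
rewrite Euv in ha; have hV : hausdorff_space V by exact: norm_hausdorff.
exact: (cvg_unique (T := V) hV ha hb).
Qed.

Lemma vcvgB V (I : Type) (F : set_system I) {FF : Filter F} (u v : I -> V) (a b : V) :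
  u t @[t --> F] --> a -> v t @[t --> F] --> b -> u t - v t @[t --> F] --> a - b.
Proof. exact: cvgB. Qed.

Lemma bcont_cst V (v : V) : bcont (fun _ : R => v).
Proof.
split; last by exists (rnorm v).
by move=> t _ e e0; exists 1 => // s _ _; rewrite subrr rnorm0.
Qed.

Definition lin_bounded V V' (S : V -> V') (K : R) :=
  [/\ forall x y, S (x + y) = S x + S y, forall (c : R[i]) x, S (c *: x) = c *: S x
    & forall x, rnorm (S x) <= K * rnorm x].

Lemma lin_boundedB V V' (S : V -> V') K x y : lin_bounded S K -> S (x - y) = S x - S y.
Proof. by move=> [h1 h2 _]; rewrite h1 -scaleN1r h2 scaleN1r. Qed.

Lemma lin_bounded0 V V' (S : V -> V') K : lin_bounded S K -> S 0 = 0.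
Proof. by move=> [_ h2 _]; rewrite -(scale0r (0 : V)) h2 scale0r. Qed.

Lemma lin_bounded_pos V V' (S : V -> V') K : lin_bounded S K ->
  exists2 K', 0 < K' & lin_bounded S K'.
Proof.
move=> [h1 h2 h3]; exists (`|K| + 1); first by rewrite ltr_wpDl.
split=> // x; apply: (le_trans (h3 x)); rewrite ler_wpM2r ?rnorm_ge0 //.
by apply: (le_trans (ler_norm K)); rewrite lerDl.
Qed.

Lemma lin_bounded_cvg V V' (S : V -> V') K (I : Type) (F : set_system I) {FF : Filter F}
    (u : I -> V) (a : V) : lin_bounded S K -> u t @[t --> F] --> a ->
  S (u t) @[t --> F] --> S a.
Proof.
move=> /lin_bounded_pos[K' K0 hS] /cvg_rnormP hu; apply/cvg_rnormP => e e0.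
have eK : 0 < e / K' by rewrite divr_gt0.
move: (hu _ eK); apply: filterS => t ht.
rewrite -(lin_boundedB _ _ hS); case: hS => _ _ hS; apply: (le_lt_trans (hS _)).
by rewrite mulrC -ltr_pdivlMr.
Qed.

Lemma lin_bounded_sum V V' (S : V -> V') K (I : Type) (r : seq I) (P : pred I) (f : I -> V) :
  lin_bounded S K -> S (\sum_(i <- r | P i) f i) = \sum_(i <- r | P i) S (f i).
Proof.
move=> hS; have h0 := lin_bounded0 hS; case: hS => h1 _ _.
by elim/big_rec2 : _ => [|i a b _ <-]; [exact: h0|exact: h1].
Qed.

Lemma bcont_lin V V' (S : V -> V') K (phi : R -> V) : lin_bounded S K -> bcont phi ->
  bcont (fun t => S (phi t)).
Proof.
move=> /lin_bounded_pos[K' K0 hS] hphi; have [M M0 hM] := bcont_bound hphi.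
have hS' := hS; case: hS' => _ _ h3; split; last first.
  by exists (K' * M) => t t0; apply: (le_trans (h3 _)); rewrite ler_pM2l //; exact: hM.
move=> t t0 e e0; have eK : 0 < e / K' by rewrite divr_gt0.
case: hphi => hc _; have [r r0 hr] := hc t t0 _ eK; exists r => // s s0 st.
rewrite -(lin_boundedB _ _ hS); apply: (le_lt_trans (h3 _)).
by rewrite mulrC -ltr_pdivlMr //; exact: hr.
Qed.

Lemma bochner_lin V V' (limV : has_limits V) (limV' : has_limits V') (S : V -> V') K m
    (phi : R -> V) : lin_bounded S K -> bcont phi ->
  S (bochner_integral m (Rplus R) phi) = bochner_integral m (Rplus R) (fun t => S (phi t)).
Proof.
move=> hS hphi.
have c1 : S (rsum (mesh 1 n) (mesh_num n) m phi) @[n --> \oo] -->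
    S (bochner_integral m (Rplus R) phi) by exact: lin_bounded_cvg hS (rsum_cvg1 limV m hphi).
apply: (cvg_eqP c1 (rsum_cvg1 limV' m (bcont_lin hS hphi))) => n.
rewrite /rsum (lin_bounded_sum _ _ _ hS); apply: eq_bigr => k _.
by case: hS => _ -> _.
Qed.

Lemma bcontD V (phi psi : R -> V) : bcont phi -> bcont psi -> bcont (fun t => phi t + psi t).
Proof.
move=> [h1 [M1 k1]] [h2 [M2 k2]]; split; last first.
  by exists (M1 + M2) => t t0; apply: (le_trans (rnormD _ _)); apply: lerD; [exact: k1|exact: k2].
move=> t t0 e e0; have e2 : 0 < e / 2 by rewrite divr_gt0.
have [r1 r10 hr1] := h1 t t0 _ e2; have [r2 r20 hr2] := h2 t t0 _ e2.
exists (Num.min r1 r2); first by rewrite lt_min r10.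
move=> s s0; rewrite lt_min => /andP[/(hr1 s s0) a1 /(hr2 s s0) a2].
rewrite opprD addrACA; apply: (le_lt_trans (rnormD _ _)); lra.
Qed.

Lemma bcontN V (phi : R -> V) : bcont phi -> bcont (fun t => - phi t).
Proof.
move=> [h1 [M1 k1]]; split; last by exists M1 => t t0; rewrite rnormN; exact: k1.
move=> t t0 e e0; have [r r0 hr] := h1 t t0 _ e0; exists r => // s s0 st.
by rewrite -opprD rnormN; exact: hr.
Qed.

Lemma bcontB V (phi psi : R -> V) : bcont phi -> bcont psi -> bcont (fun t => phi t - psi t).
Proof. by move=> h1 h2; apply: bcontD => //; exact: bcontN. Qed.

Lemma bochnerB V (limV : has_limits V) m (phi psi : R -> V) : bcont phi -> bcont psi ->
  bochner_integral m (Rplus R) (fun t => phi t - psi t) =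
  bochner_integral m (Rplus R) phi - bochner_integral m (Rplus R) psi.
Proof.
move=> h1 h2.
have c1 : rsum (mesh 1 n) (mesh_num n) m phi - rsum (mesh 1 n) (mesh_num n) m psi @[n --> \oo] -->
    bochner_integral m (Rplus R) phi - bochner_integral m (Rplus R) psi.
  exact: vcvgB (rsum_cvg1 limV m h1) (rsum_cvg1 limV m h2).
apply: (cvg_eqP (rsum_cvg1 limV m (bcontB h1 h2)) c1) => n.
by rewrite /rsum -sumrB; apply: eq_bigr => k _; rewrite scalerBr.
Qed.

Lemma cvg_rnorm V (I : Type) (F : set_system I) {FF : Filter F} (u : I -> V) a :
  u t @[t --> F] --> a -> rnorm (u t) @[t --> F] --> rnorm a.
Proof.
move=> /cvg_rnormP hu; apply/cvgrPdist_lt => e /hu; apply: filterS => t ht.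
have := rnorm_lb a (u t); have := rnorm_lb (u t) a; rewrite (rnorm_distC (u t)) => h1 h2.
by rewrite ltr_norml; apply/andP; split; lra.
Qed.

Lemma cvg_rnorm_le V (u : nat -> V) a (B : R) : u n @[n --> \oo] --> a ->
  (forall n, rnorm (u n) <= B) -> rnorm a <= B.
Proof.
move=> hu hB; have h : rnorm (u n) @[n --> \oo] --> rnorm a by exact: cvg_rnorm.
rewrite -(cvg_lim (@Rhausdorff R) h); apply: limr_le; first by apply/cvg_ex; exists (rnorm a).
by apply: nearW => n.
Qed.

Lemma cvg_rnorm_le_eps V (u : nat -> V) a (B : R) (ep : nat -> R) : u n @[n --> \oo] --> a ->
  ep n @[n --> \oo] --> 0 -> (forall n, rnorm (u n) <= B + ep n) -> rnorm a <= B.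
Proof.
move=> hu he hB; have h : rnorm (u n) @[n --> \oo] --> rnorm a by exact: cvg_rnorm.
have hBe : B + ep n @[n --> \oo] --> B.
  by rewrite -[X in _ --> X]addr0; apply: cvgD => //; exact: cvg_cst.
apply: (ler_cvg_to h hBe); exact: nearW.
Qed.

(** Monotonicity of g makes the Riemann sums of g lie below its integral. *)
Lemma bochner_bound V (limV : has_limits V) m (phi : R -> V) (g : R -> R) : bcont phi ->
  measurable_fun (Rplus R : set mR) g -> (forall t, 0 <= t -> 0 <= g t) ->
  (forall s t, 0 <= s -> s <= t -> g s <= g t) -> (forall t, 0 <= t -> rnorm (phi t) <= g t) ->
  ((rnorm (bochner_integral m (Rplus R) phi))%:E <= \int[m]_(t in Rplus R) (g t)%:E)%E.
Proof.
move=> hphi mg g0 gm hg.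
have mD : measurable (Rplus R : set mR) by exact: measurable_itv.
have key n : ((rnorm (rsum (mesh 1 n) (mesh_num n) m phi))%:E <= \int[m]_(t in Rplus R) (g t)%:E)%E.
  have d0 : 0 < mesh (1 : R) n by exact: mesh_gt0.
  set d := mesh 1 n in d0 *; set N := mesh_num n.
  pose psi k := if (k < N)%N then g (k%:R * d) else 0.
  have kd k : 0 <= k%:R * d by rewrite mulr_ge0 // ltW.
  have psi0 k : 0 <= psi k by rewrite /psi; case: ifP => // _; exact: g0.
  have ui : uniq (iota 0 N.+1) by exact: iota_uniq.
  have qi t : stepidx d N t \in iota 0 N.+1.
    by rewrite mem_iota /= add0n ltnS stepidx_le.
  have := integral_fibers m mD ui qi (fun k => stepidx_measurable N k d0) psi0.
  have psiN : psi N = 0 by rewrite /psi ltnn.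
  rewrite -[iota 0 N.+1]/(index_iota 0 N.+1) big_nat_recr //= psiN mulr0 addr0.
  rewrite big_mkord => E.
  apply: (@le_trans _ _ (\int[m]_(t in Rplus R) (psi (stepidx d N t))%:E)%E).
    rewrite E lee_fin; apply: (le_trans (rnorm_sum _ _ _)); apply: ler_sum => k _.
    rewrite rnormZ cabs_real ger0_norm ?fine_ge0 //.
    have -> : fiber_mass m (Rplus R) (stepidx d N) k = fine (m `[k%:R * d, k.+1%:R * d[%classic).
      rewrite /fiber_mass stepidx_fiber //.
      congr (fine (m _)); apply: setIidr => t; rewrite /Rplus /= !in_itv /= andbT => /andP[h _].
      exact: le_trans (kd _) h.
    by rewrite /psi ltn_ord ler_wpM2l ?fine_ge0 //; exact: hg.
  apply: ge0_le_integral => //.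
  - by move=> t _; rewrite lee_fin.
  - apply/measurable_EFinP.
    pose gc t : R[i]^o := (g t)%:C.
    have -> : (fun t => psi (stepidx d N t)) = (fun t => rnorm (stepfun d N gc t - 0)).
      apply: funext => t; rewrite subr0 /= /stepfun /psi; case: ifP => _; last by rewrite rnorm0.
      by rewrite -[RHS]/(cabs _) cabs_real ger0_norm // g0.
    exact: (@simple_dist_measurable R (R[i]^o) (Rplus R) mD (stepfun d N gc)
      (fun v => stepfun_measurable _ _ v d0) 0).
  - by apply/measurable_EFinP.
  - move=> t; rewrite /Rplus /= in_itv /= andbT => t0; rewrite lee_fin /psi /stepidx.
    case: ifP => [|_]; last by exact: g0.
    case: ifP => [/andP[_ tN] _|]; last by rewrite ltnn.
    have /andP[h1 _] := truncn_itv (divr_ge0 t0 (ltW d0)).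
    by apply: gm => //; rewrite -ler_pdivlMr.
have [->|fin] := eqVneq (\int[m]_(t in Rplus R) (g t)%:E)%E +oo%E; first by rewrite leey.
have fin' : (\int[m]_(t in Rplus R) (g t)%:E)%E \is a fin_num.
  rewrite ge0_fin_numE ?lt_neqAle ?fin ?leey //.
  by apply: integral_ge0 => t; rewrite /Rplus /= in_itv /= andbT => t0; rewrite lee_fin g0.
rewrite -(fineK fin') lee_fin; apply: (cvg_rnorm_le (rsum_cvg1 limV m hphi)) => n.
by rewrite -lee_fin fineK.
Qed.

Lemma bochner_bound_cst V (limV : has_limits V) m (phi : R -> V) (M : R) : bcont phi ->
  (forall t, 0 <= t -> rnorm (phi t) <= M) ->
  rnorm (bochner_integral m (Rplus R) phi) <= M * fine (m (Rplus R)).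
Proof.
move=> hphi hM.
have mD : measurable (Rplus R : set mR) by exact: measurable_itv.
have M0 : 0 <= M by exact: le_trans (rnorm_ge0 _) (hM 0 (lexx 0)).
have := @bochner_bound V limV m phi (fun=> M) hphi (@measurable_cst _ _ _ _ _ _)
  (fun _ _ => M0) (fun _ _ _ _ => lexx M) hM.
have E : (\int[m]_(t in Rplus R) M%:E)%E = (M%:E * m (Rplus R))%E := integral_cst m mD M%:E.
have fm : m (Rplus R) = (fine (m (Rplus R)))%:E by rewrite fineK // fin_num_measure.
by rewrite E fm -EFinM lee_fin.
Qed.

(** The bound d is uniform in phi: all these functions are dominated by min (C,
    d t), whose integral tends to 0 with d. *)
Lemma bochner_small V (limV : has_limits V) m (C e : R) : 0 <= C -> 0 < e ->
  exists2 d : R, 0 < d & forall phi : R -> V, bcont phi ->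
    (forall t, 0 <= t -> rnorm (phi t) <= C) -> (forall t, 0 <= t -> rnorm (phi t) <= d * t) ->
    rnorm (bochner_integral m (Rplus R) phi) <= e.
Proof.
move=> C0 e0.
have mD : measurable (Rplus R : set mR) by exact: measurable_itv.
pose g n (t : R) := Num.min C (t / n.+1%:R).
have mg n : measurable_fun (Rplus R : set mR) (g n).
  by apply: measurable_minr => //; apply: measurable_funM => //; exact: measurable_cst.
have g0 n t : 0 <= t -> 0 <= g n t by move=> t0; rewrite le_min C0 divr_ge0.
have h1 : {ae m, forall t : mR, Rplus R t -> (fun n => (g n t)%:E) @ \oo --> cst 0%E t}.
  apply: aeW => t; rewrite /Rplus /= in_itv /= andbT => t0.
  apply/fine_cvgP; split; first by near=> n.
  apply/cvgrPdist_lt => d d0; exists (Num.bound (t / d)) => // n /= hn.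
  rewrite sub0r normrN ger0_norm; last exact: g0.
  rewrite /g gt_min ltr_pdivrMr // mulrC -ltr_pdivrMr //; apply/orP; right.
  apply: (lt_le_trans (archi_boundP (divr_ge0 t0 (ltW d0)))).
  by rewrite ler_nat (leq_trans hn).
have h2 : m.-integrable (Rplus R : set mR) (cst C%:E).
  exact: finite_measure_integrable_cst.
have h3 : {ae m, forall (t : mR) n, Rplus R t -> (`|(g n t)%:E| <= cst C%:E t)%E}.
  apply: aeW => t n; rewrite /Rplus /= in_itv /= andbT => t0.
  by rewrite lee_fin ger0_norm ?g0 // ge_min lexx.
have mg' n : measurable_fun (Rplus R : set mR) (fun t => (g n t)%:E) by apply/measurable_EFinP.
have [_ _] := dominated_convergence mD mg' (@measurable_cst _ _ _ _ _ _) h1 h2 h3.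
rewrite integral0 => /fine_cvgP[[N1 _ fin1] /cvgrPdist_lt/(_ _ e0)[N2 _ hlt]].
pose n := maxn N1 N2.
have fn : (\int[m]_(t in Rplus R) (g n t)%:E)%E \is a fin_num := fin1 n (leq_maxl _ _).
have ln : `|0 - fine (\int[m]_(t in Rplus R) (g n t)%:E)%E| < e := hlt n (leq_maxr _ _).
exists (n.+1%:R)^-1; first by rewrite invr_gt0.
move=> phi hphi k1 k2.
have := @bochner_bound V limV m phi (g n) hphi (mg n) (g0 n) _ _.
rewrite -(fineK fn) lee_fin => hb; apply: le_trans (hb _ _) _.
- move=> s t s0 st; rewrite /g le_min ge_min lexx /= ge_min.
  by apply/orP; right; rewrite ler_pM2r // invr_gt0.
- by move=> t t0; rewrite /g le_min k1 //= mulrC; exact: k2.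
- move: ln; rewrite /= sub0r normrN => ln; apply: ltW; apply: le_lt_trans ln; exact: ler_norm.
Unshelve. all: by end_near. Qed.

End BochnerCalculus.
Arguments rsum_cvg1 {R V} limV m {phi}.

Section SignedCalculus.
Variables (R : realType).
Local Notation mR := (measurableTypeR R).
Implicit Types (V : normedModType R[i]) (m : {finite_measure set mR -> \bar R}).

Definition sint V m1 m2 (phi : R -> V) : V :=
  bochner_integral m1 (Rplus R) phi - bochner_integral m2 (Rplus R) phi.

(** The Jordan decomposition is another way of writing nu as a difference of
    finite measures, and Riemann sums depend on nu alone. *)
Lemma charge_integral_diff V (limV : has_limits V) (nu : {charge set mR -> \bar R}) m1 m2
    (phi : R -> V) : (forall A : set mR, measurable A -> nu A = (m1 A - m2 A)%E) -> bcont phi ->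
  charge_integral nu (Rplus R) phi = sint m1 m2 phi.
Proof.
move=> hnu hphi; rewrite /charge_integral /sint.
set PN := projT2 (cid (projT2 (cid (Hahn_decomposition nu)))); set mp := jordan_pos PN; set mn := jordan_neg PN.
have cB (p q : {finite_measure set mR -> \bar R}) :
    rsum (mesh 1 n) (mesh_num n) p phi - rsum (mesh 1 n) (mesh_num n) q phi @[n --> \oo] -->
    bochner_integral p (Rplus R) phi - bochner_integral q (Rplus R) phi.
  exact: vcvgB (rsum_cvg1 limV p hphi) (rsum_cvg1 limV q hphi).
apply: (cvg_eqP (cB mp mn) (cB m1 m2)) => n.
rewrite /rsum -!sumrB; apply: eq_bigr => k _; rewrite -!scalerBl -!rmorphB /=.
set I : set mR := `[_, _[%classic; have mI : measurable I by exact: measurable_itv.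
congr (_%:C *: _); rewrite -!fineB ?fin_num_measure //; congr fine.
rewrite -hnu // (jordan_decomp PN mI) /cadd /=; congr (_ + _)%E.
by rewrite cscaleN1.
Qed.

Definition cm_diff m1 m2 : cmeasure R :=
  CMeasure (cadd (charge_of_finite_measure m1) (copp (charge_of_finite_measure m2))) czero.

Lemma cm_integral_diff V (limV : has_limits V) m1 m2 (phi : R -> V) : bcont phi ->
  cm_integral (cm_diff m1 m2) phi = sint m1 m2 phi.
Proof.
move=> hphi; rewrite /cm_integral.
rewrite (charge_integral_diff limV (m1 := m1) (m2 := m2)) //.
rewrite (charge_integral_diff limV (m1 := m1) (m2 := m1) _ hphi).
  by rewrite {2}/sint subrr scaler0 addr0.
by move=> A mA; rewrite /= subee // fin_num_measure.
Qed.

Lemma sint_lin V V' (limV : has_limits V) (limV' : has_limits V') (S : V -> V') K m1 m2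
    (phi : R -> V) : lin_bounded S K -> bcont phi ->
  S (sint m1 m2 phi) = sint m1 m2 (fun t => S (phi t)).
Proof.
move=> hS hphi; rewrite /sint (lin_boundedB _ _ hS).
by rewrite (bochner_lin limV limV' _ hS hphi) (bochner_lin limV limV' _ hS hphi).
Qed.

Lemma sintB V (limV : has_limits V) m1 m2 (phi psi : R -> V) : bcont phi -> bcont psi ->
  sint m1 m2 (fun t => phi t - psi t) = sint m1 m2 phi - sint m1 m2 psi.
Proof.
by move=> h1 h2; rewrite /sint !bochnerB // !opprD !opprK addrACA.
Qed.

Lemma sint_small V (limV : has_limits V) m1 m2 (C e : R) : 0 <= C -> 0 < e ->
  exists2 d : R, 0 < d & forall phi : R -> V, bcont phi ->
    (forall t, 0 <= t -> rnorm (phi t) <= C) -> (forall t, 0 <= t -> rnorm (phi t) <= d * t) ->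
    rnorm (sint m1 m2 phi) <= e.
Proof.
move=> C0 e0; have e2 : 0 < e / 2 by rewrite divr_gt0.
have [d1 d10 h1] := bochner_small limV m1 C0 e2.
have [d2 d20 h2] := bochner_small limV m2 C0 e2.
exists (Num.min d1 d2); first by rewrite lt_min d10.
move=> phi hphi k1 k2; apply: (le_trans (rnormB _ _)).
have -> : e = e / 2 + e / 2 by field.
by apply: lerD; [apply: h1|apply: h2] => // t t0; apply: (le_trans (k2 t t0));
  rewrite ler_wpM2r // ge_min lexx ?orbT.
Qed.

End SignedCalculus.

(** * The complex exponential *)

Section Cexp.
Variable R : realType.
Implicit Types (a b : R) (z w : R[i]).

Lemma expR_sub1 a : `|expR a - 1| <= `|a| * expR `|a|.
Proof.
have h1 := expR_ge1Dx a; have h2 := expR_ge1Dx (- a).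
have [a0|a0] := leP 0 a.
  rewrite ger0_norm; last by rewrite subr_ge0 (le_trans _ h1) // lerDl.
  have h3 : (1 - a) * expR a <= 1.
    rewrite -[X in _ <= X](mulVf (lt0r_neq0 (expR_gt0 a))) -expRN.
    by rewrite ler_pM2r ?expR_gt0.
  by rewrite (ger0_norm a0); rewrite mulrBl mul1r in h3; lra.
have e1 : expR a <= 1 by rewrite -expR0 ler_expR ltW.
rewrite ler0_norm; last by lra.
apply: (@le_trans _ _ (- a)); first by lra.
rewrite (ltr0_norm a0) ler_peMr ?oppr_ge0 ?(ltW a0) //.
by rewrite -expR0 ler_expR oppr_ge0 ltW.
Qed.

Lemma expR_taylor1 a : `|expR a - 1 - a| <= `|a| ^+ 2 * expR `|a|.
Proof.
have h1 := expR_ge1Dx a; have h2 := expR_ge1Dx (- a).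
rewrite ger0_norm; last by lra.
have h3 : (1 - a) * expR a <= 1.
  rewrite -[X in _ <= X](mulVf (lt0r_neq0 (expR_gt0 a))) -expRN.
  by rewrite ler_pM2r ?expR_gt0.
have h4 : expR a - 1 - a <= a * (expR a - 1) by rewrite mulrBl mul1r in h3; lra.
apply: (le_trans h4); apply: (le_trans (ler_norm _)); rewrite normrM expr2 -mulrA.
by rewrite ler_wpM2l // expR_sub1.
Qed.

Lemma sin_le_abs b : `|sin b| <= `|b|.
Proof.
have sub (x : R) : 0 <= x -> `|sin x| <= x.
  rewrite le_eqVlt => /predU1P[<-|x0]; first by rewrite sin0 normr0.
  have [c _] := @MVT_segment R sin cos 0 x (ltW x0)
    (fun y _ => is_derive_sin y) (continuous_subspaceT (@continuous_sin R)).
  rewrite sin0 !subr0 => ->; rewrite normrM [X in _ * X]ger0_norm ?(ltW x0) //.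
  by rewrite ler_piMl ?(ltW x0) // ler_norml cos_geN1 cos_le1.
have [b0|b0] := leP 0 b; first by rewrite [X in _ <= X]ger0_norm //; exact: sub.
rewrite -normrN -sinN -[X in _ <= X]normrN [X in _ <= X]ger0_norm ?oppr_ge0 ?(ltW b0) //.
by apply: sub; rewrite oppr_ge0 ltW.
Qed.

Lemma cos_sub1 b : `|cos b - 1| <= `|b| ^+ 2.
Proof.
have sub (x : R) : 0 <= x -> `|cos x - 1| <= x ^+ 2.
  rewrite le_eqVlt => /predU1P[<-|x0].
    by rewrite cos0 subrr normr0 expr0n.
  have [c] := @MVT_segment R cos (fun y => - sin y) 0 x (ltW x0)
    (fun y _ => is_derive_cos y) (continuous_subspaceT (@continuous_cos R)).
  rewrite in_itv /= => /andP[c0 cx].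
  rewrite cos0 !subr0 => ->; rewrite normrM normrN [X in _ * X]ger0_norm ?(ltW x0) //.
  rewrite expr2 ler_wpM2r ?(ltW x0) //; apply: (le_trans (sin_le_abs _)).
  by rewrite ger0_norm.
have [b0|b0] := leP 0 b; first by rewrite [X in _ <= X ^+ 2]ger0_norm //; exact: sub.
rewrite -cosN -[X in _ <= X ^+ 2]normrN [X in _ <= X ^+ 2]ger0_norm ?oppr_ge0 ?(ltW b0) //.
by apply: sub; rewrite oppr_ge0 ltW.
Qed.

Lemma sin_sub_id b : `|sin b - b| <= `|b| ^+ 2.
Proof.
have sub (x : R) : 0 <= x -> `|sin x - x| <= x ^+ 2.
  rewrite le_eqVlt => /predU1P[<-|x0].
    by rewrite sin0 subrr normr0 expr0n.
  have hd y : is_derive y (1 : R) (fun y : R => sin y - y) (cos y - 1).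
    by apply: is_deriveB.
  have hc : continuous (fun y : R => sin y - y).
    by move=> y; apply: cvgB; [exact: continuous_sin|exact: cvg_id].
  have [c] := @MVT_segment R (fun y => sin y - y) (fun y => cos y - 1) 0 x (ltW x0)
    (fun y _ => hd y) (continuous_subspaceT hc).
  rewrite in_itv /= => /andP[c0 cx].
  rewrite sin0 !subr0 => ->; rewrite normrM [X in _ * X]ger0_norm ?(ltW x0) //.
  rewrite expr2 ler_wpM2r ?(ltW x0) //.
  have [d] := @MVT_segment R cos (fun y => - sin y) 0 c c0
    (fun y _ => is_derive_cos y) (continuous_subspaceT (@continuous_cos R)).
  rewrite cos0 subr0 => _ ->; rewrite normrM normrN [X in _ * X]ger0_norm //.
  apply: (@le_trans _ _ c) => //; rewrite ler_piMl // ler_norml sin_geN1 sin_le1 //.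
have [b0|b0] := leP 0 b; first by rewrite [X in _ <= X ^+ 2]ger0_norm //; exact: sub.
have -> : `|sin b - b| = `|sin (- b) - - b| by rewrite sinN opprK -normrN opprB addrC.
rewrite -[X in _ <= X ^+ 2]normrN.
rewrite [X in _ <= X ^+ 2]ger0_norm ?oppr_ge0 ?(ltW b0) //.
by apply: sub; rewrite oppr_ge0 ltW.
Qed.

Lemma cexpD z w : cexp (z + w) = cexp z * cexp w.
Proof.
rewrite /cexp cReD cImD expRD cosD sinD.
by apply: complexP; rewrite !(cReM, cImM) /=; ring.
Qed.

Lemma cexp0 : cexp (0 : R[i]) = 1.
Proof. by rewrite /cexp /= expR0 cos0 sin0; apply: complexP => /=; ring. Qed.

Lemma cabs_cexp z : cabs (cexp z) = expR (complex.Re z).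
Proof.
rewrite /cexp cabsM cabs_real ger0_norm ?expR_ge0 //.
by rewrite [cabs (_ +i* _)]cabsE /= cos2Dsin2 sqrtr1 mulr1.
Qed.

Lemma cexp_taylor1 z : cabs (cexp z - 1 - z) <= 4 * cabs z ^+ 2 * expR (cabs z).
Proof.
set c := cabs z; set a := complex.Re z; set b := complex.Im z.
have ac : `|a| <= c by exact: Re_le_cabs.
have bc : `|b| <= c by exact: Im_le_cabs.
have c0 : 0 <= c by exact: cabs_ge0.
have ea : expR `|a| <= expR c by rewrite ler_expR.
have ea' : expR a <= expR c by rewrite ler_expR (le_trans (ler_norm _)).
have e1 : 1 <= expR c by rewrite -expR0 ler_expR.
have a2 : `|a| ^+ 2 <= c ^+ 2 by rewrite ler_pXn2r ?nnegrE.
have b2 : `|b| ^+ 2 <= c ^+ 2 by rewrite ler_pXn2r ?nnegrE.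
have k1 : `|expR a - 1 - a| <= c ^+ 2 * expR c.
  by apply: (le_trans (expR_taylor1 _)); apply: ler_pM => //; rewrite ?exprn_ge0 ?expR_ge0.
have k2 : `|expR a * (cos b - 1)| <= c ^+ 2 * expR c.
  rewrite normrM (ger0_norm (expR_ge0 _)) mulrC; apply: ler_pM => //; rewrite ?expR_ge0 //.
  exact: le_trans (cos_sub1 _) b2.
have k3 : `|expR a * (sin b - b)| <= c ^+ 2 * expR c.
  rewrite normrM (ger0_norm (expR_ge0 _)) mulrC; apply: ler_pM => //; rewrite ?expR_ge0 //.
  exact: le_trans (sin_sub_id _) b2.
have k4 : `|b * (expR a - 1)| <= c ^+ 2 * expR c.
  rewrite normrM expr2 -mulrA; apply: ler_pM => //.
  by apply: (le_trans (expR_sub1 _)); apply: ler_pM => //; rewrite ?expR_ge0.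
apply: (le_trans (cabs_le_ReIm _)).
have -> : complex.Re (cexp z - 1 - z) = (expR a - 1 - a) + expR a * (cos b - 1).
  by rewrite !(cReD, cReN) /cexp cReM /= -/a -/b; ring.
have -> : complex.Im (cexp z - 1 - z) = expR a * (sin b - b) + b * (expR a - 1).
  by rewrite !(cImD, cImN) /cexp cImM /= -/a -/b; ring.
have := ler_normD (expR a - 1 - a) (expR a * (cos b - 1)).
have := ler_normD (expR a * (sin b - b)) (b * (expR a - 1)).
have -> : 4 * c ^+ 2 * expR c = 4 * (c ^+ 2 * expR c) by ring.
move: k1 k2 k3 k4; move: (c ^+ 2 * expR c) => B; lra.
Qed.

Lemma cexp_sub1 z : cabs (cexp z - 1) <= cabs z + 4 * cabs z ^+ 2 * expR (cabs z).
Proof.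
have -> : cexp z - 1 = (cexp z - 1 - z) + z by rewrite subrK.
by apply: (le_trans (cabsD _ _)); rewrite addrC lerD2l; exact: cexp_taylor1.
Qed.

Lemma cexp_near0 z (e : R) : 0 < e ->
  exists2 r : R, 0 < r & forall t : R, 0 <= t -> t < r -> cabs (cexp (t%:C * z) - 1) < e.
Proof.
move=> e0; set c := cabs z; have c0 : 0 <= c by exact: cabs_ge0.
pose B := 1 + 4 * c * expR c.
have B0 : 0 < B by rewrite ltr_pwDl // !mulr_ge0 // expR_ge0.
have cB : 0 < c + 1 by rewrite ltr_wpDl.
exists (Num.min 1 (e / ((c + 1) * B))).
  by rewrite lt_min ltr01 divr_gt0 // mulr_gt0.
move=> t t0; rewrite lt_min => /andP[t1].
rewrite ltr_pdivlMr ?mulr_gt0 // => te.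
apply: (le_lt_trans (cexp_sub1 _)); rewrite cabsM cabs_real ger0_norm // -/c.
have tc : t * c <= c by rewrite ler_piMl // ltW.
have tc0 : 0 <= t * c by rewrite mulr_ge0.
apply: le_lt_trans te.
apply: (@le_trans _ _ (t * c * B)); last first.
  by rewrite -mulrA ler_wpM2l // ler_wpM2r ?(ltW B0) // lerDl.
have -> : t * c * B = t * c + 4 * ((t * c) * (c * expR c)) by rewrite /B; ring.
have -> : 4 * (t * c) ^+ 2 * expR (t * c) = 4 * ((t * c) * ((t * c) * expR (t * c))) by ring.
rewrite lerD2l ler_pM2l // ler_wpM2l //.
by apply: ler_pM => //; rewrite ?expR_ge0 // ler_expR.
Qed.

End Cexp.

(** * Bounded semigroups *)

Section ExpMeasure.
Variable R : realType.
Local Notation mR := (measurableTypeR R).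

Definition exp_dist (l : R) (l0 : 0 < l) : {finite_measure set mR -> \bar R} :=
  exponential_distribution_exponential_prob__canonical__measure_function_FiniteMeasure l0.

Lemma exp_dist_itv (l : R) (l0 : 0 < l) (a b : R) : 0 <= a -> a < b ->
  fine (exp_dist l0 `[a, b[%classic) = expR (- l * a) - expR (- l * b).
Proof.
move=> a0 ab.
have cexpNM : continuous (fun z : R^o => expR (- l * z)).
  move=> z; apply: continuous_comp; last exact: continuous_expR.
  by apply: continuousM => //; apply: (@continuousN _ R^o); exact: cst_continuous.
have -> : exp_dist l0 `[a, b[%classic = (\int[lebesgue_measure]_(x in `[a, b[) (exponential_pdf l x)%:E)%E by [].
rewrite integral_itv_bndo_bndc; last first.
  by apply/measurable_EFinP; apply: measurable_funS (measurable_exponential_pdf l).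
rewrite (@continuous_FTC2 _ _ (fun x => - expR (- l * x))) //=.
- by rewrite opprK addrC.
- apply: (@continuous_subspaceW R^o _ _ [set` `[0, +oo[%R]).
    by move=> x /=; rewrite !in_itv /= andbT => /andP[h _]; exact: le_trans h.
  exact: within_continuous_exponential_pdf.
- split.
  + by move=> z _; exact: ex_derive.
  + by apply/cvg_at_right_filter; apply: cvgN; exact: cexpNM.
  + by apply/cvg_at_left_filter; apply: cvgN; exact: cexpNM.
- move=> z; rewrite in_itv/= => /andP[z0 _].
  apply: derive1_exponential_pdf; rewrite in_itv/= andbT; exact: le_lt_trans z0.
Qed.

End ExpMeasure.

Section Semigroup.
Variables (R : realType) (V : normedModType R[i]).
Local Notation mR := (measurableTypeR R).
Implicit Types (T : R -> V -> V) (M : R).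

(** Bounded strongly continuous semigroups. They are used on X, but also on the
    scalars, where they yield Laplace transforms. *)
Definition sg T M := [/\ forall t, 0 <= t -> lin_bounded (T t) M,
  forall x, T 0 x = x,
  forall s t x, 0 <= s -> 0 <= t -> T (s + t) x = T s (T t x)
  & forall x (e : R), 0 < e -> exists2 r : R, 0 < r &
      forall t, 0 <= t -> t < r -> rnorm (T t x - x) < e].

(** The graph of the generator, that is, of - A. *)
Definition gen T (x y : V) := forall e : R, 0 < e -> exists2 r : R, 0 < r &
  forall h, 0 < h -> h < r -> rnorm ((h^-1)%:C *: (T h x - x) - y) < e.

Lemma sg_pos T M : sg T M -> exists2 K, 0 < K & sg T K.
Proof.
move=> [h1 h2 h3 h4]; exists (`|M| + 1); first by rewrite ltr_wpDl.
split=> // t /h1 [k1 k2 k3]; split=> // x; apply: (le_trans (k3 x)).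
rewrite ler_wpM2r ?rnorm_ge0 //.
by apply: (le_trans (ler_norm M)); rewrite lerDl.
Qed.

Lemma sg_bcont T M x : sg T M -> bcont (fun s => T s x).
Proof.
move=> /sg_pos[K K0 [h1 h2 h3 h4]]; split; last first.
  by exists (K * rnorm x) => t /h1[_ _]; exact.
move=> t t0 e e0; have eK : 0 < e / K by rewrite divr_gt0.
have [r r0 hr] := h4 x _ eK; exists r => // s s0.
have key a b : 0 <= a -> a <= b -> b - a < r -> rnorm (T b x - T a x) < e.
  move=> a0 ab bar; have ba0 : 0 <= b - a by rewrite subr_ge0.
  have -> : T b x = T a (T (b - a) x) by rewrite -h3 // addrC subrK.
  have ha := h1 a a0; rewrite -(lin_boundedB _ _ ha); case: ha => _ _ k3.
  apply: (le_lt_trans (k3 _)); rewrite mulrC -ltr_pdivlMr //; exact: hr.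
have [st|ts] := leP s t.
  rewrite distrC ger0_norm ?subr_ge0 // => hst; rewrite rnorm_distC; exact: key.
rewrite ger0_norm ?subr_ge0 ?(ltW ts) // => hst; apply: key => //; exact: ltW.
Qed.

Lemma gen_unique T x y y' : gen T x y -> gen T x y' -> y = y'.
Proof.
move=> h1 h2; apply/eqP; rewrite -subr_eq0; apply/eqP/rnorm_eq0/eqP.
rewrite eq_le rnorm_ge0 andbT; apply/ler_addgt0Pr => e e0; rewrite add0r.
have e2 : 0 < e / 2 by rewrite divr_gt0.
have [r1 r10 k1] := h1 _ e2; have [r2 r20 k2] := h2 _ e2.
pose h := Num.min r1 r2 / 2.
have m0 : 0 < Num.min r1 r2 by rewrite lt_min r10.
have h0 : 0 < h by rewrite divr_gt0.
have : h < Num.min r1 r2 by rewrite /h; lra.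
rewrite lt_min => /andP[hr1 hr2].
have a1 := k1 h h0 hr1; have a2 := k2 h h0 hr2.
apply: (le_trans (rnorm_dist y ((h^-1)%:C *: (T h x - x)) y')).
rewrite (rnorm_distC y); lra.
Qed.

Lemma gen_lin T M (S : V -> V) K x y : sg T M -> lin_bounded S K ->
  (forall t z, 0 <= t -> S (T t z) = T t (S z)) -> gen T x y -> gen T (S x) (S y).
Proof.
move=> hT /lin_bounded_pos[L L0 hS] hc hg e e0.
have eL : 0 < e / L by rewrite divr_gt0.
have [r r0 hr] := hg _ eL; exists r => // h h0 h1.
rewrite -hc ?(ltW h0) // -(lin_boundedB _ _ hS); have := hS => -[_ k2 k3].
rewrite -k2 -(lin_boundedB _ _ hS); apply: (le_lt_trans (k3 _)).
by rewrite mulrC -ltr_pdivlMr //; exact: hr.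
Qed.

Lemma gen_comb T M c x y x' y' : sg T M -> gen T x y -> gen T x' y' ->
  gen T (x + c *: x') (y + c *: y').
Proof.
move=> [h1 _ _ _] hg hg' e e0.
have e2 : 0 < e / 2 by rewrite divr_gt0.
have ec : 0 < e / 2 / (cabs c + 1) by rewrite divr_gt0 // ltr_wpDl ?cabs_ge0.
have [r1 r10 k1] := hg _ e2; have [r2 r20 k2] := hg' _ ec.
exists (Num.min r1 r2); first by rewrite lt_min r10.
move=> h h0; rewrite lt_min => /andP[hr1 hr2].
have [l1 l2 _] := h1 h (ltW h0).
have -> : (h^-1)%:C *: (T h (x + c *: x') - (x + c *: x')) - (y + c *: y') =
  ((h^-1)%:C *: (T h x - x) - y) + c *: ((h^-1)%:C *: (T h x' - x') - y').
  have -> : T h (x + c *: x') - (x + c *: x') = (T h x - x) + c *: (T h x' - x').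
    by rewrite l1 l2 opprD addrACA -scalerBr.
  by rewrite scalerDr opprD addrACA [c *: (_ - y')]scalerBr !scalerA mulrC.
apply: (le_lt_trans (rnormD _ _)); rewrite rnormZ.
have a1 := k1 h h0 hr1; have a2 := k2 h h0 hr2.
have : cabs c * rnorm ((h^-1)%:C *: (T h x' - x') - y') <= e / 2.
  apply: (@le_trans _ _ ((cabs c + 1) * (e / 2 / (cabs c + 1)))).
    by apply: ler_pM; rewrite ?cabs_ge0 ?rnorm_ge0 ?lerDl // ltW.
  by rewrite mulrC divfK // lt0r_neq0 // ltr_wpDl ?cabs_ge0.
lra.
Qed.

(** Splitting [0, s] into n pieces bounds an increment of the orbit of x by
    n times an increment over s / n. *)
Lemma sg_increment T M x y s : sg T M -> 0 <= M -> gen T x y -> 0 <= s ->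
  rnorm (T s x - x) <= s * (M * rnorm y).
Proof.
move=> hT M0 hg; have [h1 h2 h3 h4] := hT.
rewrite le_eqVlt => /predU1P[<-|s0].
  by rewrite h2 subrr rnorm0 mul0r.
apply/ler_addgt0Pr => e e0.
have e1 : 0 < e / (s * (M + 1)) by rewrite divr_gt0 // mulr_gt0 // ltr_wpDl.
have [r r0 hr] := hg _ e1.
pose n := Num.bound (s / r); pose h := s / n.+1%:R.
have n0 : 0 < n.+1%:R :> R by [].
have h0 : 0 < h by rewrite divr_gt0.
have hr' : h < r.
  rewrite /h ltr_pdivrMr // mulrC -ltr_pdivrMr //.
  apply: (lt_trans (archi_boundP (divr_ge0 (ltW s0) (ltW r0)))).
  by rewrite ltr_nat.
have step k : rnorm (T (k%:R * h) x - x) <= k%:R * (M * rnorm (T h x - x)).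
  elim: k => [|k IH]; first by rewrite !mul0r h2 subrr rnorm0.
  apply: (le_trans (rnorm_dist _ (T (k%:R * h) x) _)).
  have kh : 0 <= k%:R * h by rewrite mulr_ge0 // ltW.
  have -> : T (k.+1%:R * h) x = T (k%:R * h) (T h x).
    by rewrite -h3 // ?(ltW h0) //; congr T; rewrite -natr1 mulrDl mul1r.
  have hk := h1 _ kh; rewrite -(lin_boundedB _ _ hk); case: hk => _ _ k3.
  by rewrite -natr1 mulrDl mul1r addrC; apply: lerD.
have := step n.+1.
have -> : n.+1%:R * h = s by rewrite /h mulrC divfK // lt0r_neq0.
move=> /le_trans; apply.
have hb : rnorm (T h x - x) <= h * (rnorm y + e / (s * (M + 1))).
  have := hr h h0 hr'.
  have -> : rnorm (T h x - x) = h * rnorm ((h^-1)%:C *: (T h x - x)).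
    rewrite rnormZ cabs_real ger0_norm ?invr_ge0 ?(ltW h0) // mulrA divff ?mul1r //.
    by rewrite lt0r_neq0.
  move=> k; rewrite ler_pM2l //.
  have := rnorm_lb ((h^-1)%:C *: (T h x - x)) y; lra.
apply: (@le_trans _ _ (n.+1%:R * (M * (h * (rnorm y + e / (s * (M + 1))))))).
  by rewrite ler_wpM2l ?(ltW n0) // ler_wpM2l.
have -> : n.+1%:R * (M * (h * (rnorm y + e / (s * (M + 1))))) =
    s * (M * rnorm y) + M / (M + 1) * e.
  rewrite /h; move: n0; move: (n.+1%:R) => N N0; field.
  by rewrite !lt0r_neq0 // ltr_wpDl.
rewrite lerD2l ler_piMl ?(ltW e0) // ler_pdivrMr ?ltr_wpDl // mul1r lerDl //.
Qed.

Lemma sum_shift (U : zmodType) (f : nat -> U) N j :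
  \sum_(k < N) f k - \sum_(k < N) f (j + k)%N = \sum_(k < j) f k - \sum_(k < j) f (N + k)%N.
Proof.
have E p q : \sum_(k < p + q) f k = \sum_(k < p) f k + \sum_(k < q) f (p + k)%N.
  by rewrite big_split_ord.
have := E N j; rewrite addnC E => h.
by apply/eqP; rewrite subr_eq addrAC eq_sym subr_eq; apply/eqP.
Qed.

Hypothesis limV : has_limits V.

Section Resolvent.
Variables (T : R -> V -> V) (M : R) (l : R).
Hypotheses (hT : sg T M) (l0 : 0 < l).

(** This is l (l + A)^-1 y: the orbit of y at an exponentially distributed time. *)
Definition resol y := bochner_integral (exp_dist l0) (Rplus R) (fun s => T s y).

(** On the Riemann sums of mesh h / (n + 1), whose weights are geometric,
    translating the orbit by h multiplies the sum by exp (l h), except for the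
    terms over [0, h), in which T s y is replaced by y. *)
Lemma resol_shift y h (w : R) : 0 < h -> 0 <= w ->
  (forall s, 0 <= s -> s < h -> rnorm (T s y - y) <= w) ->
  rnorm (resol y - (expR (- l * h))%:C *: T h (resol y) - (1 - expR (- l * h))%:C *: y)
    <= (1 - expR (- l * h)) * w.
Proof.
move=> h0 w0 hw; have [K K0 hK] := sg_pos hT; have [h1 h2 h3 h4] := hK.
have hb := sg_bcont y hK.
pose E := expR (- l * h).
have E1 : E < 1 by rewrite /E -expR0 ltr_expR mulNr oppr_lt0 mulr_gt0.
have E0 : 0 < E by exact: expR_gt0.
have cv := rsum_cvg limV (m := exp_dist l0) h0 hb.
pose u n := rsum (mesh h n) (mesh_num n) (exp_dist l0) (fun s => T s y).
have Sb : lin_bounded (fun x => x - E%:C *: T h x) (1 + E * K).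
  have [k1 k2 k3] := h1 h (ltW h0); split.
  - by move=> a b; rewrite k1 scalerDr opprD addrACA.
  - by move=> c a; rewrite k2 scalerBr !scalerA (mulrC c).
  - move=> a; apply: (le_trans (rnormB _ _)); rewrite mulrDl mul1r lerD2l.
    rewrite rnormZ cabs_real ger0_norm ?(ltW E0) // -mulrA.
    by rewrite ler_pM2l.
have cS := lin_bounded_cvg Sb cv.
have {cS} cS : u n - E%:C *: T h (u n) @[n --> \oo] --> resol y - E%:C *: T h (resol y) by exact: cS.
apply: (cvg_rnorm_le_eps (u := fun n => u n - E%:C *: T h (u n) - (1 - E)%:C *: y)
  (ep := fun n => E ^+ n.+1 * (K * rnorm y))).
- exact: vcvgB cS (cvg_cst _).
- rewrite -[X in _ --> X](mul0r (K * rnorm y)); apply: cvgM; last exact: cvg_cst.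
  have := @cvg_expr _ E; rewrite ger0_norm ?(ltW E0) // => /(_ E1).
  move/cvgrPdist_lt => hE; apply/cvgrPdist_lt => e /hE [N _ hN].
  by exists N => // n Nn; apply: hN; exact: leq_trans Nn (leqnSn n).
move=> n.
pose d := mesh h n; pose N := mesh_num n; pose q := expR (- l * d).
have d0 : 0 < d by exact: mesh_gt0.
have q0 : 0 < q by exact: expR_gt0.
have q1 : q < 1 by rewrite /q -expR0 ltr_expR mulNr oppr_lt0 mulr_gt0.
have kd k : 0 <= k%:R * d by rewrite mulr_ge0 // ltW.
have qk k : expR (- l * (k%:R * d)) = q ^+ k.
  by rewrite /q -expRM_natl -mulr_natl; congr expR; ring.
have dh : n.+1%:R * d = h by rewrite /d /mesh mulrC divfK // pnatr_eq0.
have qh : q ^+ n.+1 = E by rewrite -qk dh.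
pose f k := (q ^+ k)%:C *: T (k%:R * d) y.
have uE : u n = (1 - q)%:C *: \sum_(k < N) f k.
  rewrite /u /rsum scaler_sumr; apply: eq_bigr => k _.
  rewrite exp_dist_itv //; last by rewrite ltr_pM2r // ltr_nat.
  by rewrite !qk /f scalerA -rmorphM /= mulrBl mul1r -exprS.
have UE : E%:C *: T h (u n) = (1 - q)%:C *: \sum_(k < N) f (n.+1 + k)%N.
  have hS := h1 h (ltW h0); have [_ k2 _] := hS.
  rewrite uE k2 (lin_bounded_sum _ _ _ hS) scalerA mulrC -scalerA scaler_sumr.
  congr (_ *: _); apply: eq_bigr => k _; rewrite /f k2 -h3 ?(ltW h0) // scalerA -rmorphM /=.
  by rewrite exprD qh natrD mulrDl dh.
rewrite UE {1}uE -scalerBr sum_shift.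
have geo j : (1 - q) * \sum_(k < j) q ^+ k = 1 - q ^+ j by rewrite -[RHS]opprB subrX1 -mulNr opprB.
have -> : (1 - E)%:C *: y = (1 - q)%:C *: \sum_(k < n.+1) ((q ^+ k)%:C *: y).
  by rewrite -scaler_suml scalerA -qh -geo rmorphM rmorph_sum.
rewrite -scalerBr rnormZ cabs_real ger0_norm; last by rewrite subr_ge0 ltW.
rewrite addrAC -sumrB.
apply: (@le_trans _ _ ((1 - q) * (\sum_(k < n.+1) (q ^+ k * w) +
   \sum_(k < n.+1) (q ^+ k * (E ^+ n.+1 * (K * rnorm y)))))).
  rewrite ler_pM2l ?subr_gt0 //; apply: (le_trans (rnormB _ _)); apply: lerD;
    apply: (le_trans (rnorm_sum _ _ _)); apply: ler_sum => k _.
    rewrite /f -scalerBr rnormZ cabs_real ger0_norm ?exprn_ge0 ?(ltW q0) //.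
    rewrite ler_pM2l ?exprn_gt0 //; apply: hw => //.
    by rewrite -dh ltr_pM2r // ltr_nat.
  rewrite /f rnormZ cabs_real ger0_norm ?exprn_ge0 ?(ltW q0) //.
  have -> : q ^+ (N + k) = q ^+ k * E ^+ n.+1 by rewrite exprD mulrC /N /mesh_num exprM qh.
  rewrite -mulrA ler_pM2l ?exprn_gt0 // ler_pM2l ?exprn_gt0 //.
  by have [_ _ k3] := h1 _ (kd (N + k)%N); exact: k3.
rewrite -!mulr_suml -mulrDr mulrA geo qh mulrDr lerD2l.
rewrite ler_piMl // ?mulr_ge0 ?exprn_ge0 ?(ltW E0) ?(ltW K0) ?rnorm_ge0 //.
by rewrite lerBlDr lerDl ltW.
Qed.

(** The resolvent equation (l + A) (resol y) = l y, where - A is the generator. *)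
Lemma resol_gen y : gen T (resol y) (l%:C *: (resol y - y)).
Proof.
move=> e e0; have [K K0 hK] := sg_pos hT; have [h1 h2 h3 h4] := hK.
set v := resol y.
pose B := rnorm (v - y) + 1.
have B0 : 0 < B by rewrite ltr_wpDl ?rnorm_ge0.
pose L := l + l ^+ 2 * expR l.
have L0 : 0 < L by rewrite addr_gt0 // mulr_gt0 ?exprn_gt0 // expR_gt0.
have w0 : 0 < e / 2 / L by rewrite !divr_gt0.
have [r r0 hr] := h4 y _ w0.
have s0 : 0 < e / 2 / (l ^+ 2 * expR l * B).
  by rewrite !divr_gt0 // !mulr_gt0 // ?exprn_gt0 // expR_gt0.
exists (Num.min (Num.min r 1) (e / 2 / (l ^+ 2 * expR l * B))).
  by rewrite !lt_min r0 ltr01 s0.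
move=> h h0; rewrite !lt_min => /andP[/andP[hr' h1'] hs].
have := @resol_shift y h (e / 2 / L) h0 (ltW w0).
have hw s : 0 <= s -> s < h -> rnorm (T s y - y) <= e / 2 / L.
  by move=> s0' sh; apply: ltW; apply: hr => //; exact: lt_trans hr'.
move=> /(_ hw); rewrite -/v; set err := (X in rnorm X) => herr.
pose F := expR (l * h).
have FE : F * expR (- l * h) = 1 by rewrite /F -expRD mulNr subrr expR0.
have F1 : 1 <= F by rewrite /F -expR0 ler_expR mulr_ge0 // ltW.
have F0 : 0 < F by exact: expR_gt0.
have key : T h v - v = (F - 1)%:C *: (v - y) - F%:C *: err.
  have E1 : F%:C *: err = F%:C *: v - T h v - (F - 1)%:C *: y.
    by rewrite /err !scalerBr !scalerA -!rmorphM /= FE mulrBr FE mulr1 scale1r.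
  rewrite E1 scalerBr opprB subrKA rmorphB /= scalerBl scale1r opprB.
  by rewrite [RHS]addrC subrKA.
have lh0 : 0 <= l * h by rewrite mulr_ge0 ?ltW.
have tay : `|F - 1 - l * h| <= h * (h * (l ^+ 2 * expR l)).
  apply: (le_trans (expR_taylor1 _)); rewrite (ger0_norm lh0).
  have -> : (l * h) ^+ 2 * expR (l * h) = h * (h * (l ^+ 2 * expR (l * h))) by ring.
  rewrite !ler_pM2l // ?exprn_gt0 // ler_expR ler_piMr ?ltW //.
have -> : (h^-1)%:C *: (T h v - v) - l%:C *: (v - y) =
    ((F - 1 - l * h) / h)%:C *: (v - y) - (F / h)%:C *: err.
  rewrite key scalerBr !scalerA -!rmorphM /= addrAC -scalerBl -rmorphB /=.
  congr (_%:C *: _ - _%:C *: _); last by rewrite mulrC.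
  by field; rewrite lt0r_neq0.
apply: (le_lt_trans (rnormB _ _)); rewrite !rnormZ !cabs_real !normrM.
rewrite (ger0_norm (ltW F0)) [`|h^-1|]ger0_norm ?invr_ge0 ?(ltW h0) //.
have b1 : `|F - 1 - l * h| / h * rnorm (v - y) < e / 2.
  apply: (@le_lt_trans _ _ (h * (l ^+ 2 * expR l * B))); last first.
    by rewrite -ltr_pdivlMr // !mulr_gt0 // ?exprn_gt0 // expR_gt0.
  rewrite mulrA; apply: ler_pM; rewrite ?rnorm_ge0 ?divr_ge0 ?(ltW h0) //.
    by rewrite ler_pdivrMr // [X in _ <= X]mulrC.
  by rewrite /B lerDl.
have b2 : F / h * rnorm err <= e / 2.
  apply: (@le_trans _ _ ((F - 1) / h * (e / 2 / L))).
    have -> : (F - 1) / h * (e / 2 / L) = F / h * ((1 - expR (- l * h)) * (e / 2 / L)).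
      by rewrite [in RHS]mulrA; congr (_ * _); rewrite mulrAC mulrBr FE mulr1.
    by rewrite ler_pM2l // divr_gt0.
  apply: (@le_trans _ _ (L * (e / 2 / L))); last first.
    by rewrite mulrC divfK // lt0r_neq0.
  rewrite ler_pM2r // ler_pdivrMr // /L mulrDl.
  have : F - 1 - l * h <= h * (h * (l ^+ 2 * expR l)) by apply: le_trans tay; exact: ler_norm.
  have : h * (h * (l ^+ 2 * expR l)) <= l ^+ 2 * expR l * h.
    rewrite [X in _ <= X]mulrC ler_pM2l // ler_piMl ?ltW //.
    by rewrite mulr_gt0 ?exprn_gt0 // expR_gt0.
  lra.
lra.
Qed.

End Resolvent.
End Semigroup.

(** * Consequences of the resolvent equation *)

Section ResolventCalculus.
Variables (R : realType) (V : normedModType R[i]).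
Local Notation mR := (measurableTypeR R).
Hypothesis limV : has_limits V.
Implicit Types (T : R -> V -> V) (M : R).

Lemma bochner_orbit_lin T M (m : {finite_measure set mR -> \bar R}) : sg T M ->
  lin_bounded (fun y => bochner_integral m (Rplus R) (fun s => T s y)) (M * fine (m (Rplus R))).
Proof.
move=> hT; have [h1 _ _ _] := hT.
have hb y := sg_bcont y hT.
split.
- move=> x y.
  have cB : rsum (mesh 1 n) (mesh_num n) m (fun s => T s x) +
      rsum (mesh 1 n) (mesh_num n) m (fun s => T s y) @[n --> \oo] -->
      bochner_integral m (Rplus R) (fun s => T s x) + bochner_integral m (Rplus R) (fun s => T s y).
    by apply: cvgD; exact: rsum_cvg1.
  apply: (cvg_eqP (rsum_cvg1 limV m (hb (x + y))) cB) => n.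
  rewrite /rsum -big_split; apply: eq_bigr => k _ /=; rewrite -scalerDr.
  have kd : 0 <= k%:R * mesh 1 n :> R by rewrite mulr_ge0 // ltW // mesh_gt0.
  by have [-> _ _] := h1 _ kd.
- move=> c x.
  have Sc : lin_bounded (fun x : V => c *: x) (cabs c).
    by split=> [a b|a b|a]; rewrite ?scalerDr ?rnormZ // !scalerA mulrC.
  have cS : c *: rsum (mesh 1 n) (mesh_num n) m (fun s => T s x) @[n --> \oo] -->
      c *: bochner_integral m (Rplus R) (fun s => T s x).
    by apply: (lin_bounded_cvg Sc); exact: rsum_cvg1.
  apply: (cvg_eqP (rsum_cvg1 limV m (hb (c *: x))) cS) => n.
  rewrite /rsum scaler_sumr; apply: eq_bigr => k _ /=.
  have kd : 0 <= k%:R * mesh 1 n :> R by rewrite mulr_ge0 // ltW // mesh_gt0.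
  by have [_ -> _] := h1 _ kd; rewrite !scalerA mulrC.
- move=> x; rewrite mulrAC; apply: bochner_bound_cst => // t /h1[_ _]; exact.
Qed.

Lemma exp_dist_mass (l : R) (l0 : 0 < l) : fine (exp_dist l0 (Rplus R)) <= 1.
Proof.
rewrite -[X in _ <= X]/(fine (1%:E : \bar R)); apply: fine_le => //.
  by rewrite fin_num_measure //; exact: measurable_itv.
have := @probability_le1 _ _ R (exponential_distribution_exponential_prob__canonical__probability_measure_Probability l0)
  (Rplus R); apply; exact: measurable_itv.
Qed.

Lemma resol_lin T M (l : R) (l0 : 0 < l) : sg T M -> 0 <= M -> lin_bounded (resol T l0) M.
Proof.
move=> hT M0; have [k1 k2 k3] := bochner_orbit_lin (exp_dist l0) hT; split=> // x.
apply: (le_trans (k3 x)); rewrite ler_wpM2r ?rnorm_ge0 // ler_piMr //.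
exact: exp_dist_mass.
Qed.

Lemma resol_comm T M (l : R) (l0 : 0 < l) t y : sg T M -> 0 <= t ->
  resol T l0 (T t y) = T t (resol T l0 y).
Proof.
move=> hT t0; have [h1 h2 h3 h4] := hT.
rewrite /resol (bochner_lin limV limV _ (h1 t t0) (sg_bcont y hT)).
have hc : bcont (fun s => T s (T t y)) by exact: sg_bcont hT.
apply: (cvg_eqP (rsum_cvg1 limV (exp_dist l0) hc)
  (rsum_cvg1 limV (exp_dist l0) (bcont_lin (h1 t t0) (sg_bcont y hT)))) => n.
rewrite /rsum; apply: eq_bigr => k _.
have kd : 0 <= k%:R * mesh 1 n :> R by rewrite mulr_ge0 // ltW // mesh_gt0.
by rewrite -!h3 // addrC.
Qed.

(** The resolvent commutes with the generator; applying it to resol_gen gives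
    its left inverse. *)
Lemma resol_left T M (l : R) (l0 : 0 < l) x y : sg T M -> 0 <= M -> gen T x y ->
  resol T l0 (x - (l^-1)%:C *: y) = x.
Proof.
move=> hT M0 hg.
have hl := resol_lin l0 hT M0.
have g1 := resol_gen limV hT l0 x.
have g2 : gen T (resol T l0 x) (resol T l0 y).
  by apply: (gen_lin hT hl) hg => t z t0; exact: resol_comm hT t0.
have E := gen_unique g1 g2.
rewrite (lin_boundedB _ _ hl); have [_ -> _] := hl.
rewrite -E scalerA -rmorphM /= mulVf ?lt0r_neq0 // scale1r opprB addrC subrK //.
Qed.

(** The generator is closed: gen x y says x = resol (x - y / l), and resol is
    continuous. *)
Lemma gen_closed T M (u w : nat -> V) x y : sg T M -> 0 <= M ->
  (forall n, gen T (u n) (w n)) -> u n @[n --> \oo] --> x -> w n @[n --> \oo] --> y ->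
  gen T x y.
Proof.
move=> hT M0 hg hu hw.
have l0 : 0 < (1 : R) by [].
have hl := resol_lin l0 hT M0.
have E : resol T l0 (x - y) = x.
  have c1 : resol T l0 (u n - w n) @[n --> \oo] --> resol T l0 (x - y).
    by apply: (lin_bounded_cvg hl); exact: vcvgB.
  apply: (cvg_eqP c1 hu) => n.
  by have := resol_left l0 hT M0 (hg n); rewrite invr1 scale1r.
have := resol_gen limV hT l0 (x - y); rewrite E scale1r opprB addrC subrK //.
Qed.

(** A vector annihilated by the generator is fixed by all the resolvents
    l / (l + A), and these tend to 0 on the range of A as l tends to 0. *)
Lemma gen_injective T M x : sg T M -> 0 <= M ->
  (forall z (e : R), 0 < e -> exists v w, gen T v w /\ rnorm (z - w) < e) ->
  gen T x 0 -> x = 0.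
Proof.
move=> hT M0 hd hx; apply: rnorm_eq0; apply/eqP; rewrite eq_le rnorm_ge0 andbT.
apply/ler_addgt0Pr => e e0; rewrite add0r.
have e2 : 0 < e / (2 * (M + 1)) by rewrite divr_gt0 // mulr_gt0 // ltr_wpDl.
have [v [w [hvw hzw]]] := hd x _ e2.
pose C := (M + 1) * rnorm v + 1.
have C0 : 0 < C by rewrite ltr_wpDl // mulr_ge0 ?rnorm_ge0 // addr_ge0.
have l0 : 0 < e / 2 / C by rewrite !divr_gt0.
set l := e / 2 / C in l0.
have hl := resol_lin l0 hT M0; have [_ k2 k3] := hl.
have Ex := resol_left l0 hT M0 hx; rewrite scaler0 subr0 in Ex.
have Ew : resol T l0 w = l%:C *: (resol T l0 v - v).
  have := resol_left l0 hT M0 hvw; rewrite (lin_boundedB _ _ hl) k2 => E.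
  rewrite -{2}E opprB [_ + (_ - _)]addrC subrK scalerA -rmorphM /= divff ?scale1r //.
  by rewrite lt0r_neq0.
have -> : x = resol T l0 (x - w) + resol T l0 w by rewrite (lin_boundedB _ _ hl) subrK Ex.
apply: (le_trans (rnormD _ _)).
have b1 : rnorm (resol T l0 (x - w)) <= e / 2.
  apply: (le_trans (k3 _)); apply: (@le_trans _ _ ((M + 1) * (e / (2 * (M + 1))))).
    by apply: ler_pM; rewrite ?rnorm_ge0 ?lerDl // ltW.
  have : M + 1 != 0 by rewrite lt0r_neq0 // ltr_wpDl.
  by move=> h; rewrite le_eqVlt; apply/orP; left; apply/eqP; field; rewrite h.
have b2 : rnorm (resol T l0 w) <= e / 2.
  rewrite Ew rnormZ cabs_real ger0_norm ?(ltW l0) //.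
  apply: (@le_trans _ _ (l * C)).
    rewrite ler_pM2l //; apply: (le_trans (rnormB _ _)).
    apply: (@le_trans _ _ (M * rnorm v + rnorm v)); first by rewrite lerD2r.
    by rewrite /C mulrDl mul1r lerDl.
  by rewrite /l divfK // lt0r_neq0.
have -> : e = e / 2 + e / 2 by field.
exact: (lerD b1 b2).
Qed.

(** Here 1 + R1 - 2 R2 = (1 - R1) (1 - R2) = A^2 (1 + A)^-1 (2 + A)^-1, where R1
    = (1 + A)^-1 and R2 = 2 (2 + A)^-1. If it annihilates x, then A (R1 x - R2
    x) = 0, so that R1 x = R2 x, whence R1 x = x and A x = 0. *)
Lemma regularizer_injective T M (l1 : 0 < (1 : R)) (l2 : 0 < (2 : R)) x : sg T M -> 0 <= M ->
  (forall z (e : R), 0 < e -> exists v w, gen T v w /\ rnorm (z - w) < e) ->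
  x + resol T l1 x - 2 *: resol T l2 x = 0 -> x = 0.
Proof.
move=> hT M0 hd E.
set a := resol T l1 x in E; set b := resol T l2 x in E.
have ga : gen T a (a - x).
  by have := resol_gen limV hT l1 x; rewrite scale1r.
have gb : gen T b (2 *: (b - x)) by have := resol_gen limV hT l2 x; rewrite rmorph_nat.
have gab := gen_comb (-1) hT ga gb.
have E0 : a - x + -1 *: (2 *: (b - x)) = 0.
  by rewrite -E scaleN1r scalerBr opprB addrA scaler_nat mulr2n addrA subrK [a + x]addrC.
rewrite E0 scaleN1r in gab.
have /eqP := gen_injective hT M0 hd gab; rewrite subr_eq0 => /eqP ab.
have xa : a = x.
  have /(gen_unique ga) : gen T a (2 *: (a - x)) by rewrite {1}ab [in X in _ *: X]ab.
  rewrite scaler_nat mulr2n => /eqP.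
  by rewrite -subr_eq0 opprD addrA subrr sub0r oppr_eq0 subr_eq0 => /eqP.
by rewrite xa subrr in ga; exact: gen_injective hT M0 hd ga.
Qed.

End ResolventCalculus.

Section Twist.
Variables (R : realType) (V : normedModType R[i]).
Implicit Types (T : R -> V -> V) (M eta : R).

(** The generator - A becomes i eta - A, so that a spectral point i eta of A is
    moved to 0. *)
Definition twist T eta (s : R) (x : V) : V := cexp ((s * eta)%:C * 'i%C) *: T s x.

Lemma cabs_cexp_i (b : R) : cabs (cexp (b%:C * 'i%C)) = 1.
Proof. by rewrite cabs_cexp /= mulr0 mul0r subr0 expR0. Qed.

Lemma sg_twist T M eta : sg T M -> sg (twist T eta) M.
Proof.
move=> hT; have [h1 h2 h3 h4] := hT; split.
- move=> t t0; have [k1 k2 k3] := h1 t t0; rewrite /twist; split.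
  + by move=> x y; rewrite k1 scalerDr.
  + by move=> c x; rewrite k2 !scalerA mulrC.
  + by move=> x; rewrite rnormZ cabs_cexp_i mul1r.
- by move=> x; rewrite /twist h2 mul0r mul0r cexp0 scale1r.
- move=> s t x s0 t0; rewrite /twist h3 //.
  have [_ k2 _] := h1 s s0; rewrite k2 scalerA -cexpD.
  by congr (cexp _ *: _); rewrite mulrDl rmorphD /= mulrDl.
- move=> x e e0.
  have e2 : 0 < e / 2 by rewrite divr_gt0.
  have e3 : 0 < e / 2 / (rnorm x + 1) by rewrite divr_gt0 // ltr_wpDl ?rnorm_ge0.
  have [r1 r10 k1] := h4 x _ e2.
  have [r2 r20 k2] := cexp_near0 (eta%:C * 'i%C) e3.
  exists (Num.min r1 r2); first by rewrite lt_min r10.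
  move=> t t0; rewrite lt_min => /andP[t1 t2].
  have a1 := k1 t t0 t1; have a2 := k2 t t0 t2; rewrite mulrA -rmorphM /= in a2.
  rewrite /twist; have -> : cexp ((t * eta)%:C * 'i%C) *: T t x - x =
     cexp ((t * eta)%:C * 'i%C) *: (T t x - x) + (cexp ((t * eta)%:C * 'i%C) - 1) *: x.
    by rewrite scalerBr scalerBl scale1r subrKA.
  apply: (le_lt_trans (rnormD _ _)); rewrite !rnormZ cabs_cexp_i mul1r.
  have : cabs (cexp ((t * eta)%:C * 'i%C) - 1) * rnorm x <= e / 2.
    apply: (@le_trans _ _ (e / 2 / (rnorm x + 1) * (rnorm x + 1))).
      by apply: ler_pM; rewrite ?cabs_ge0 ?rnorm_ge0 ?lerDl // ltW.
    by rewrite divfK // lt0r_neq0 // ltr_wpDl ?rnorm_ge0.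
  lra.
Qed.

Lemma cexp_diff0 (w : R[i]) (e : R) : 0 < e -> exists2 r : R, 0 < r &
  forall h : R, 0 < h -> h < r ->
    cabs ((h^-1)%:C * (cexp (h%:C * w) - 1) - w) < e.
Proof.
move=> e0; set c := cabs w; have c0 : 0 <= c by exact: cabs_ge0.
pose C := 4 * c ^+ 2 * expR c + 1.
have C0 : 0 < C by rewrite /C ltr_wpDl // mulr_ge0 ?expR_ge0 // mulr_ge0 ?sqr_ge0.
exists (Num.min 1 (e / C)); first by rewrite lt_min ltr01 divr_gt0.
move=> h h0; rewrite lt_min => /andP[h1 hC].
set E := cexp _.
have -> : (h^-1)%:C * (E - 1) - w = (h^-1)%:C * (E - 1 - h%:C * w).
  by rewrite [RHS]mulrBr mulrA -rmorphM /= mulVf ?mul1r // lt0r_neq0.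
rewrite cabsM cabs_real ger0_norm ?invr_ge0 ?(ltW h0) // mulrC ltr_pdivrMr //.
apply: (le_lt_trans (cexp_taylor1 _)).
rewrite cabsM cabs_real (ger0_norm (ltW h0)) -/c.
apply: (@le_lt_trans _ _ (h * (h * (4 * c ^+ 2 * expR c)))).
  rewrite exprMn.
  have -> : 4 * (h ^+ 2 * c ^+ 2) * expR (h * c) =
    h * (h * (4 * c ^+ 2 * expR (h * c))) by ring.
  rewrite (ler_pM2l h0) (ler_pM2l h0); apply: ler_wpM2l; first by rewrite mulr_ge0 ?sqr_ge0.
  by rewrite ler_expR ler_piMl // ltW.
rewrite [X in _ < X]mulrC ltr_pM2l //.
apply: (@le_lt_trans _ _ (h * C)); first by rewrite ler_pM2l // lerDl.
by rewrite -ltr_pdivlMr.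
Qed.

Lemma add_cancel (U : zmodType) (p q k e y : U) :
  p + q - (y + k) = (p - e) + ((q - k) + (e - y)).
Proof. by rewrite opprD addrACA [(q - k) + _]addrC [in RHS]addrA subrKA. Qed.

Lemma gen_twist T M eta x y : sg T M -> gen T x y ->
  gen (twist T eta) x (y + (eta%:C * 'i%C) *: x).
Proof.
move=> hT hg e e0.
have e3 : 0 < e / 3 by rewrite divr_gt0.
have ex : 0 < e / 3 / (rnorm x + 1) by rewrite divr_gt0 // ltr_wpDl ?rnorm_ge0.
have ey : 0 < e / 3 / (rnorm y + 1) by rewrite divr_gt0 // ltr_wpDl ?rnorm_ge0.
have [r1 r10 k1] := hg _ e3.
have [r2 r20 k2] := cexp_diff0 (eta%:C * 'i%C) ex.
have [r3 r30 k3] := cexp_near0 (eta%:C * 'i%C) ey.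
exists (Num.min (Num.min r1 r2) r3); first by rewrite !lt_min r10 r20.
move=> h h0; rewrite !lt_min => /andP[/andP[hr1 hr2] hr3].
have a1 := k1 h h0 hr1; have a2 := k2 h h0 hr2; have a3 := k3 h (ltW h0) hr3.
rewrite mulrA -rmorphM /= in a2; rewrite mulrA -rmorphM /= in a3; rewrite /twist.
move: a2 a3 (cabs_cexp_i (h * eta)); set E := cexp _ => a2 a3 E1.
have -> : (h^-1)%:C *: (E *: T h x - x) - (y + (eta%:C * 'i%C) *: x) =
   E *: ((h^-1)%:C *: (T h x - x) - y) + (((h^-1)%:C * (E - 1) - eta%:C * 'i%C) *: x + (E - 1) *: y).
  have -> : E *: T h x - x = E *: (T h x - x) + (E - 1) *: x.
    by rewrite scalerBr scalerBl scale1r subrKA.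
  have -> : (h^-1)%:C *: (E *: (T h x - x) + (E - 1) *: x) =
      E *: ((h^-1)%:C *: (T h x - x)) + ((h^-1)%:C * (E - 1)) *: x.
    by rewrite scalerDr !scalerA (mulrC E).
  rewrite [E *: (_ - y)]scalerBr [((h^-1)%:C * (E - 1) - _) *: x]scalerBl.
  rewrite [(E - 1) *: y]scalerBl scale1r; exact: add_cancel.
have bnd (c : R[i]) (z : V) : cabs c < e / 3 / (rnorm z + 1) -> cabs c * rnorm z <= e / 3.
  move=> hc; apply: (@le_trans _ _ (e / 3 / (rnorm z + 1) * (rnorm z + 1))).
    by apply: ler_pM; rewrite ?cabs_ge0 ?rnorm_ge0 ?lerDl // ltW.
  by rewrite divfK // lt0r_neq0 // ltr_wpDl ?rnorm_ge0.
apply: (le_lt_trans (rnormD _ _)); rewrite rnormZ E1 mul1r.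
have := rnormD (((h^-1)%:C * (E - 1) - eta%:C * 'i%C) *: x) ((E - 1) *: y).
rewrite !rnormZ; have := bnd _ _ a2; have := bnd _ _ a3; lra.
Qed.

Lemma twistK T eta : twist (twist T eta) (- eta) = T.
Proof.
apply: funext => s; apply: funext => x; rewrite /twist scalerA -cexpD.
by rewrite mulrN rmorphN /= mulNr addNr cexp0 scale1r.
Qed.

Lemma gen_twistE T M eta x y : sg T M ->
  gen (twist T eta) x y <-> gen T x (y - (eta%:C * 'i%C) *: x).
Proof.
move=> hT; split=> h; last first.
  by have := gen_twist eta hT h; rewrite subrK.
have := gen_twist (- eta) (sg_twist eta hT) h.
by rewrite twistK rmorphN /= mulNr scaleNr.
Qed.

End Twist.

Section ApproximateEigenvectors.
Variables (R : realType) (V : normedModType R[i]).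
Hypothesis limV : has_limits V.

(** If T has no approximate fixed vectors, its generator is onto with a
    bounded inverse: the solutions v of y + l v = B v, with B the generator,
    are bounded as l tends to 0, hence form a Cauchy family. *)
Lemma gen_onto (T : R -> V -> V) (M c : R) : sg T M -> 0 <= M -> 0 < c ->
  (forall u w, gen T u w -> c * rnorm u <= rnorm w) ->
  forall y, exists v, gen T v y.
Proof.
move=> hT M0 c0 hc y.
pose l n : R := n.+1%:R^-1.
have l0 n : 0 < l n by rewrite invr_gt0.
pose v n := - ((l n)^-1)%:C *: resol T (l0 n) y.
have hv n : gen T (v n) (y + (l n)%:C *: v n).
  have g0 : gen T 0 0.
    move=> e e0; exists 1 => // h h0 _; have [h1 _ _ _] := hT.
    by rewrite (lin_bounded0 (h1 h (ltW h0))) subrr scaler0 subrr rnorm0.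
  have := gen_comb (- ((l n)^-1)%:C) hT g0 (resol_gen limV hT (l0 n) y).
  rewrite !add0r scalerA mulNr -rmorphM /= mulVf ?lt0r_neq0 // scaleN1r opprB.
  rewrite /v scalerA mulrN -rmorphM /= divff ?lt0r_neq0 // scaleN1r.
  exact.
have lv n : rnorm ((l n)%:C *: v n) <= M * rnorm y.
  have -> : (l n)%:C *: v n = - resol T (l0 n) y.
    by rewrite /v scalerA mulrN -rmorphM /= divff ?lt0r_neq0 // scaleN1r.
  by rewrite rnormN; have [_ _ k3] := resol_lin limV (l0 n) hT M0; exact: k3.
pose C := (1 + M) * rnorm y / c + 1.
have C0 : 0 < C by rewrite ltr_wpDl // divr_ge0 ?(ltW c0) // mulr_ge0 ?rnorm_ge0 // addr_ge0.
have vC n : rnorm (v n) <= C.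
  have h : rnorm (v n) <= (1 + M) * rnorm y / c.
    rewrite ler_pdivlMr // mulrC; apply: (le_trans (hc _ _ (hv n))).
    by apply: (le_trans (rnormD _ _)); rewrite mulrDl mul1r lerD2l.
  by apply: (le_trans h); rewrite lerDl.
have lvC n : rnorm ((l n)%:C *: v n) <= l n * C.
  by rewrite rnormZ cabs_real ger0_norm ?(ltW (l0 n)) // ler_pM2l.
have lsmall (e : R) : 0 < e -> exists N, forall n, (N <= n)%N -> l n * C < e.
  move=> e0; exists (Num.bound (C / e)) => n hn.
  rewrite /l mulrC ltr_pdivrMr // mulrC -ltr_pdivrMr //.
  apply: (lt_trans (archi_boundP (divr_ge0 (ltW C0) (ltW e0)))).
  by rewrite ltr_nat ltnS.
have [x hx] : exists x : V, v n @[n --> \oo] --> x.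
  apply: limV => e e0.
  have e2 : 0 < c * e / 2 by rewrite divr_gt0 // mulr_gt0.
  have [N hN] := lsmall _ e2; exists N => p n pN nN.
  have g := gen_comb (-1) hT (hv p) (hv n).
  rewrite !scaleN1r in g; have := hc _ _ g.
  have -> : y + (l p)%:C *: v p - (y + (l n)%:C *: v n) = (l p)%:C *: v p - (l n)%:C *: v n.
    by rewrite opprD addrACA subrr add0r.
  move=> h; rewrite -(ltr_pM2l c0); apply: (le_lt_trans h).
  apply: (le_lt_trans (rnormB _ _)).
  have -> : c * e = c * e / 2 + c * e / 2 by field.
  exact: (ltrD (le_lt_trans (lvC p) (hN p pN)) (le_lt_trans (lvC n) (hN n nN))).
exists x; apply: (gen_closed limV hT M0 hv hx).
apply/cvg_rnormP => e e0; have [N hN] := lsmall _ e0; exists N => // n /= Nn.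
rewrite opprD addrA subrr sub0r rnormN; apply: (le_lt_trans (lvC n)); exact: hN.
Qed.

End ApproximateEigenvectors.

(** * Laplace and Stieltjes transforms on the right half-plane *)

Section Mult.
Variable R : realType.
Implicit Types (z w : R[i]) (s t : R).

(** The semigroup of multiplication by exp (- s z) on the scalars, whose
    generator is multiplication by - z. Its orbit through 1 is the Laplace
    kernel, and its resolvent is a Laplace transform. *)
Definition mult z (s : R) (x : R[i]^o) : R[i]^o := cexp (- (s%:C * z)) * x.

Lemma cabs_cexp_le1 z s : 0 <= complex.Re z -> 0 <= s -> cabs (cexp (- (s%:C * z))) <= 1.
Proof.
move=> z0 s0; rewrite cabs_cexp cReN cReM /= mul0r subr0 -expR0 ler_expR.
by rewrite oppr_le0 mulr_ge0.
Qed.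

Lemma sg_mult z : 0 <= complex.Re z -> sg (mult z) 1.
Proof.
move=> z0; split.
- move=> t t0; rewrite /mult; split.
  + by move=> x y; exact: mulrDr.
  + by move=> c x; exact: mulrCA.
  + move=> x; rewrite -[rnorm _]/(cabs _) cabsM ler_wpM2r ?cabs_ge0 //; exact: cabs_cexp_le1.
- by move=> x; rewrite /mult mul0r oppr0 cexp0 mul1r.
- by move=> s t x _ _; rewrite /mult rmorphD /= mulrDl opprD cexpD mulrA.
- move=> x e e0.
  have ex : 0 < e / (cabs x + 1) by rewrite divr_gt0 // ltr_wpDl ?cabs_ge0.
  have [r r0 hr] := cexp_near0 (- z) ex; exists r => // t t0 tr.
  have := hr t t0 tr; rewrite mulrN /mult => h.
  have -> : cexp (- (t%:C * z)) * x - x = (cexp (- (t%:C * z)) - 1) * x by rewrite mulrBl mul1r.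
  rewrite -[rnorm _]/(cabs _) cabsM; apply: (@le_lt_trans _ _ (cabs (cexp (- (t%:C * z)) - 1) * (cabs x + 1))).
    by rewrite ler_wpM2l ?cabs_ge0 // lerDl.
  by rewrite -ltr_pdivlMr // ltr_wpDl ?cabs_ge0.
Qed.

Lemma gen_mult z (x : R[i]^o) : gen (mult z) x (- z * x).
Proof.
move=> e e0.
have ex : 0 < e / (cabs x + 1) by rewrite divr_gt0 // ltr_wpDl ?cabs_ge0.
have [r r0 hr] := cexp_diff0 (- z) ex; exists r => // h h0 h1.
have := hr h h0 h1; rewrite mulrN /mult; move: (cexp _) => E k.
have -> : (h^-1)%:C *: (E * x - x : R[i]^o) - - z * x = ((h^-1)%:C * (E - 1) - - z) * x.
  by rewrite [RHS]mulrBl; congr (_ - _); rewrite -[LHS]/(_ * _) -mulrA mulrBl mul1r.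
rewrite -[rnorm _]/(cabs _) cabsM; apply: (@le_lt_trans _ _ (cabs ((h^-1)%:C * (E - 1) - - z) * (cabs x + 1))).
  by rewrite ler_wpM2l ?cabs_ge0 // lerDl.
by rewrite -ltr_pdivlMr // ltr_wpDl ?cabs_ge0.
Qed.

Lemma bcont_cexp z : 0 <= complex.Re z -> bcont (fun s => cexp (- (s%:C * z)) : R[i]^o).
Proof.
move=> z0; have := sg_bcont (1 : R[i]^o) (sg_mult z0).
by under [X in bcont X]eq_fun do rewrite /mult mulr1.
Qed.

End Mult.

Section Lap.
Variable R : realType.
Local Notation mR := (measurableTypeR R).
Local Notation limC := (@complex_has_limits R).
Implicit Types (z w : R[i]) (s t : R) (m : {finite_measure set mR -> \bar R}).

Definition lap m z : R[i] := bochner_integral m (Rplus R) (fun s => cexp (- (s%:C * z)) : R[i]^o).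

Lemma laplace_diff m1 m2 z : 0 <= complex.Re z ->
  laplace (cm_diff m1 m2) z = lap m1 z - lap m2 z.
Proof. by move=> z0; exact: cm_integral_diff limC _ _ _ (bcont_cexp z0). Qed.

Lemma Re_ge0_addl_neq0 (l : R) z : 0 < l -> 0 <= complex.Re z -> l%:C + z != 0.
Proof.
move=> l0 z0; apply/negP => /eqP /(congr1 (@complex.Re R)); rewrite cReD /= => E.
by move: (ltr_wpDr z0 l0); rewrite E ltxx.
Qed.

Lemma lap_exp_dist (l : R) (l0 : 0 < l) z : 0 <= complex.Re z ->
  lap (exp_dist l0) z = l%:C / (l%:C + z).
Proof.
move=> z0; have hT := sg_mult z0.
have E1 : resol (mult z) l0 (1 : R[i]^o) = lap (exp_dist l0) z.
  by rewrite /resol /lap; congr (bochner_integral _ _ _); apply: funext => s; rewrite /mult mulr1.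
have := gen_unique (gen_mult z (resol (mult z) l0 1)) (resol_gen limC hT l0 1).
rewrite E1 -[_ *: _]/(_ * _); set v := lap _ _ => E.
have n0 := Re_ge0_addl_neq0 l0 z0.
apply: (mulIf n0); rewrite (mulfVK n0) mulrDr (mulrC v z) -[z * v]opprK -mulNr E.
by rewrite mulrBr mulr1 opprB (mulrC v) addrC subrK.
Qed.

(** Differentiation under the integral sign. *)
Lemma bochner_cdiff m (Phi : R[i] -> R -> R[i]^o) (D : R -> R[i]^o) z (r C : R) :
  0 < r -> 0 <= C -> bcont D -> (forall w, cabs (w - z) < r -> bcont (Phi w)) ->
  (forall w t, cabs (w - z) < r -> 0 <= t ->
     cabs (Phi w t - Phi z t - D t * (w - z)) <= C * cabs (w - z) ^+ 2) ->
  cdiff (fun w => bochner_integral m (Rplus R) (Phi w)) z (bochner_integral m (Rplus R) D).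
Proof.
move=> r0 C0 hD hP hb e e0.
set B := fine (m (Rplus R)); have B0 : 0 <= B by exact: fine_ge0.
have CB0 : 0 < C * B + 1 by rewrite ltr_wpDl // mulr_ge0.
exists (Num.min r (e / (C * B + 1))); first by rewrite lt_min r0 divr_gt0.
move=> w; rewrite lt_min => /andP[wr we].
have hz : bcont (Phi z) by apply: hP; rewrite subrr cabs0.
have hw := hP w wr.
have lin : @lin_bounded R (R[i]^o) (R[i]^o) (fun x => x * (w - z)) (cabs (w - z)).
  split; [by move=> x y; exact: mulrDl|by move=> c x; rewrite -[RHS]/(_ * _) mulrA|].
  by move=> x; rewrite -[X in X <= _]/(cabs _) cabsM mulrC.
rewrite (bochner_lin limC limC m lin hD) -!(bochnerB limC) //; last 2 first.
- exact: bcontB.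
- exact: bcont_lin lin hD.
apply: (le_trans (bochner_bound_cst limC m _ (M := C * cabs (w - z) ^+ 2) _)).
- by apply: bcontB; [exact: bcontB|exact: bcont_lin lin hD].
- by move=> t t0; exact: hb.
rewrite -/B expr2 mulrA mulrAC ler_wpM2r ?cabs_ge0 //.
apply: (@le_trans _ _ (cabs (w - z) * (C * B + 1))); last by rewrite -ler_pdivlMr // ltW.
by rewrite mulrAC mulrC ler_wpM2l ?cabs_ge0 // lerDl.
Qed.

Lemma mul_expRN_le (x t : R) : 0 < x -> 0 <= t -> t * expR (- (t * x)) <= x^-1.
Proof.
move=> x0 t0; rewrite expRN ler_pdivrMr ?expR_gt0 //.
rewrite mulrC ler_pdivlMr //; apply: (le_trans _ (expR_ge1Dx _)).
by rewrite lerDr.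
Qed.

(** By cexp_taylor1 the second order remainder of exp (- t w) at z is at most 4
    t^2 |k|^2 exp (- t x / 2), where k = w - z, x = Re z and |k| < x / 2, and t
    exp (- t x / 4) <= 4 / x. *)
Lemma lap_cdiff m z : 0 < complex.Re z -> exists D, cdiff (lap m) z D.
Proof.
set x := complex.Re z => x0.
exists (bochner_integral m (Rplus R) (fun t => - t%:C * cexp (- (t%:C * z)) : R[i]^o)).
have xz : 0 <= complex.Re z by exact: ltW.
have x2 : 0 < x / 2 by rewrite divr_gt0.
apply: (bochner_cdiff m (r := x / 2) (C := 64 / x ^+ 2)) => //.
- by rewrite divr_ge0 // sqr_ge0.
- have hb := bcont_cexp xz; split; last first.
    exists x^-1 => t t0; rewrite -[rnorm _]/(cabs _) cabsM cabsN cabs_real ger0_norm //.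
    rewrite cabs_cexp cReN cReM /= mul0r subr0; exact: mul_expRN_le.
  move=> t t0 e e0; have e2 : 0 < e / 2 by rewrite divr_gt0.
  have et : 0 < e / 2 / (t + 1) by rewrite divr_gt0 // ltr_wpDl.
  case: hb => hc _; have [r r0 hr] := hc t t0 _ et.
  exists (Num.min r (e / 2)); first by rewrite lt_min r0.
  move=> s s0; rewrite lt_min => /andP[/(hr s s0) a1 a2].
  set p := cexp (- (s%:C * z)) in a1 *; set q := cexp (- (t%:C * z)) in a1 *.
  have -> : - s%:C * p - - t%:C * q = (t - s)%:C * p + t%:C * (q - p).
    by rewrite rmorphB /=; ring.
  rewrite -[rnorm _]/(cabs _); apply: (le_lt_trans (cabsD _ _)).
  rewrite cabsM cabs_real [cabs (t%:C * _)]cabsM cabs_real.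
  have b1 : `|t - s| * cabs p < e / 2.
    apply: le_lt_trans a2; rewrite distrC ler_piMr // /p; exact: cabs_cexp_le1.
  have b2 : `|t| * cabs (q - p) <= e / 2.
    rewrite ger0_norm // cabs_distC; apply: (@le_trans _ _ ((t + 1) * (e / 2 / (t + 1)))).
      by apply: ler_pM; rewrite ?cabs_ge0 ?lerDl // ltW.
    by rewrite mulrC divfK // lt0r_neq0 // ltr_wpDl.
  have -> : e = e / 2 + e / 2 by field.
  exact: (ltr_leD b1 b2).
- move=> w wz; apply: bcont_cexp.
  have := le_lt_trans (Re_le_cabs _) wz; rewrite cReB -/x ltr_norml => /andP[h _]; lra.
- move=> w t wz t0.
  pose k := w - z; have -> : w = z + k by rewrite addrC subrK.
  rewrite [z + k - z]addrAC subrr add0r; rewrite -/k in wz.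
  have -> : cexp (- (t%:C * (z + k))) - cexp (- (t%:C * z)) - - t%:C * cexp (- (t%:C * z)) * k =
     cexp (- (t%:C * z)) * (cexp (- (t%:C * k)) - 1 - - (t%:C * k)).
    by rewrite mulrDr opprD cexpD; ring.
  rewrite cabsM cabs_cexp cReN cReM /= mul0r subr0 -/x.
  apply: (@le_trans _ _ (expR (- (t * x)) * (4 * (t * cabs k) ^+ 2 * expR (t * cabs k)))).
    rewrite ler_pM2l ?expR_gt0 //; have := cexp_taylor1 (- (t%:C * k)).
    by rewrite cabsN cabsM cabs_real ger0_norm.
  apply: (@le_trans _ _ (4 * cabs k ^+ 2 * (t * expR (- (t * (x / 4)))) ^+ 2)).
    have -> : expR (- (t * x)) * (4 * (t * cabs k) ^+ 2 * expR (t * cabs k)) =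
        4 * cabs k ^+ 2 * (t ^+ 2 * (expR (- (t * x)) * expR (t * cabs k))) by ring.
    apply: ler_wpM2l; first by rewrite mulr_ge0 ?sqr_ge0.
    rewrite [X in _ <= X]exprMn; apply: ler_wpM2l; first exact: sqr_ge0.
    rewrite -expRD expr2 -expRD.
    rewrite ler_expR; have -> : - (t * (x / 4)) + - (t * (x / 4)) = t * - (x / 2) by field.
    have -> : - (t * x) + t * cabs k = t * (cabs k - x) by ring.
    by rewrite ler_wpM2l //; lra.
  have -> : 64 / x ^+ 2 * cabs k ^+ 2 = 4 * cabs k ^+ 2 * ((x / 4)^-1) ^+ 2.
    by field; rewrite lt0r_neq0.
  apply: ler_wpM2l; first by rewrite mulr_ge0 ?sqr_ge0.
  have h : t * expR (- (t * (x / 4))) <= (x / 4)^-1 by apply: mul_expRN_le => //; rewrite divr_gt0.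
  have h0 : 0 <= t * expR (- (t * (x / 4))) by rewrite mulr_ge0 ?expR_ge0.
  by rewrite ler_pXn2r // nnegrE //; exact: le_trans h.
Qed.

(** |exp (- t (z + x)) - exp (- t z)| is at most 2 and at most t x. *)
Lemma lap_right_cts m z : 0 <= complex.Re z ->
  lap m (z + x%:C) @[x --> 0^'+] --> (lap m z : R[i]^o).
Proof.
move=> z0; apply/cvg_cabsP => e e0.
have e2 : 0 < e / 2 by rewrite divr_gt0.
have [d d0 hd] := bochner_small limC m (ler0n R 2) e2.
have : \forall x \near (0 : R)^'+, 0 < x /\ x < d.
  near=> x; split; [near: x; exact: nbhs_right_gt|near: x; exact: nbhs_right_lt].
apply: filterS => x [x0 xd].
have xz : 0 <= complex.Re (z + x%:C) by rewrite cReD /= addr_ge0 // ltW.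
rewrite /lap -(bochnerB limC) //; [|exact: bcont_cexp|exact: bcont_cexp].
apply: (@le_lt_trans _ _ (e / 2)); last by lra.
apply: hd; first by apply: bcontB; exact: bcont_cexp.
  move=> t t0; apply: (le_trans (rnormB _ _)).
  by rewrite -[2]/(1 + 1); apply: lerD; exact: cabs_cexp_le1.
move=> t t0; rewrite mulrDr opprD cexpD.
have -> : cexp (- (t%:C * z)) - cexp (- (t%:C * z)) * cexp (- (t%:C * x%:C)) =
  cexp (- (t%:C * z)) * (1 - cexp (- (t%:C * x%:C))) by rewrite mulrBr mulr1.
rewrite -[rnorm _]/(cabs _) cabsM; apply: (@le_trans _ _ (1 * (d * t))); last by rewrite mul1r.
apply: ler_pM; rewrite ?cabs_ge0 ?cabs_cexp_le1 //.
have -> : 1 - cexp (- (t%:C * x%:C)) = (1 - expR (- (t * x)))%:C.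
  by rewrite -rmorphM -rmorphN /cexp /= cos0 sin0 -[1 +i* 0]/(1 : R[i]) mulr1 rmorphB.
have tx : 0 <= t * x by rewrite mulr_ge0 // ltW.
rewrite cabs_real ger0_norm; last by rewrite subr_ge0 -expR0 ler_expR oppr_le0.
have := expR_ge1Dx (- (t * x)) => h.
apply: (@le_trans _ _ (t * x)); first by rewrite lerBlDr -lerBlDl.
by rewrite mulrC ler_wpM2r // ltW.
Unshelve. all: by end_near. Qed.

Lemma cvg_right_shift z : (z + x%:C) @[x --> (0 : R)^'+] --> (z : R[i]^o).
Proof.
apply/cvg_cabsP => e e0.
have : \forall x \near (0 : R)^'+, 0 < x /\ x < e.
  near=> x; split; [near: x; exact: nbhs_right_gt|near: x; exact: nbhs_right_lt].
apply: filterS => x [x0 xe]; rewrite opprD addrA subrr sub0r cabsN cabs_real ger0_norm // ltW.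
Unshelve. all: by end_near. Qed.

(** On the open half-plane this is identity_Cplus; the imaginary axis is reached
    as a limit from the right. *)
Lemma identity_closed (G H : R[i] -> R[i]) :
  (forall z, 0 < complex.Re z -> exists D, cdiff G z D) ->
  (forall z, 0 < complex.Re z -> exists D, cdiff H z D) ->
  (forall x : R, 0 < x -> G x%:C = H x%:C) ->
  forall z, 0 <= complex.Re z ->
    G (z + x%:C) @[x --> (0 : R)^'+] --> (G z : R[i]^o) ->
    H (z + x%:C) @[x --> (0 : R)^'+] --> (H z : R[i]^o) -> G z = H z.
Proof.
move=> hG hH GH.
have E z : 0 < complex.Re z -> G z = H z.
  move=> z0; apply/eqP; rewrite -subr_eq0; apply/eqP.
  apply: (@identity_Cplus R (fun z => G z - H z)) z z0 => [z z0|x x0]; last by rewrite GH // subrr.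
  have [D hD] := hG z z0; have [D' hD'] := hH z z0; exists (D - D').
  exact: cdiffB.
move=> z z0 cG cH; have hV : hausdorff_space (R[i]^o) by exact: norm_hausdorff.
apply: (cvg_unique (T := R[i]^o) hV cG).
apply: cvg_trans cH; apply: near_eq_cvg.
have : \forall x \near (0 : R)^'+, 0 < x by exact: nbhs_right_gt.
by apply: filterS => x x0; rewrite E // cReD /= ltr_wpDl.
Qed.

End Lap.

Section StieltjesTransform.
Variable R : realType.
Local Notation mR := (measurableTypeR R).
Local Notation limC := (@complex_has_limits R).
Implicit Types (z w : R[i]) (s t c : R) (m : {finite_measure set mR -> \bar R}).

Lemma cRe_realM (x : R) (y : R[i]) : complex.Re (x%:C * y) = x * complex.Re y.
Proof. by rewrite cReM /= mul0r subr0. Qed.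

(** A uniform bound from below for the denominators t + z, which also holds on
    the imaginary axis away from 0. *)
Definition away c z := forall t, 0 <= t -> c * (1 + t) <= cabs (t%:C + z).

Lemma awayP z : 0 <= complex.Re z -> z != 0 -> exists2 c, 0 < c & away c z.
Proof.
move=> z0 zn; have az := cabs_gt0 zn.
exists (Num.min 1 (cabs z) / 2); first by rewrite divr_gt0 // lt_min ltr01.
move=> t t0; set c := Num.min 1 (cabs z).
have c1 : c <= 1 by rewrite ge_min lexx.
have cz : c <= cabs z by rewrite ge_min lexx orbT.
have c0 : 0 <= c by rewrite le_min ler01 ltW.
have h1 : c * (1 + t) <= cabs z + t.
  by rewrite mulrDr mulr1; apply: lerD => //; rewrite ler_piMl.
have h2 : (cabs z + t) ^+ 2 <= (2 * cabs (t%:C + z)) ^+ 2.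
  rewrite [X in _ <= X]exprMn cabs_sq cReD cImD /= add0r.
  have E := cabs_sq z.
  have -> : (t + complex.Re z) ^+ 2 + complex.Im z ^+ 2 =
    t ^+ 2 + 2 * (t * complex.Re z) + cabs z ^+ 2 by rewrite E; ring.
  have := sqr_ge0 (cabs z - t); have := mulr_ge0 t0 z0; have := sqr_ge0 t; have := sqr_ge0 (cabs z).
  clear; set p := t * complex.Re z; set q := cabs z.
  rewrite !expr2 => *; lra.
(* as Re z >= 0, |t + z|^2 >= t^2 + |z|^2 *)
have h3 : cabs z + t <= 2 * cabs (t%:C + z).
  by rewrite -(@ler_pXn2r _ 2) // nnegrE ?mulr_ge0 ?addr_ge0 ?cabs_ge0.
by have := le_trans h1 h3; rewrite [_ / 2 * _]mulrAC ler_pdivrMr // [X in _ <= X]mulrC.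
Qed.

Lemma away_neq0 c z t : 0 < c -> away c z -> 0 <= t -> t%:C + z != 0.
Proof.
move=> c0 hc t0; apply/negP => /eqP E; have := hc t t0; rewrite E cabs0.
by rewrite leNgt mulr_gt0 // ltr_wpDr.
Qed.

Lemma away_cabsV c z t : 0 < c -> away c z -> 0 <= t ->
  cabs (t%:C + z)^-1 <= (c * (1 + t))^-1.
Proof.
move=> c0 hc t0; have t1 : 0 < 1 + t by rewrite ltr_wpDr.
by rewrite cabsV lef_pV2 ?posrE ?mulr_gt0 ?hc // cabs_gt0 // (away_neq0 c0 hc).
Qed.

Lemma away_near c z w : 0 < c -> away c z -> cabs (w - z) < c / 2 -> away (c / 2) w.
Proof.
move=> c0 hc h t t0; have := hc t t0.
have -> : t%:C + z = (t%:C + w) - (w - z) by rewrite opprB addrA addrAC addrK.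
move=> h1; have := le_trans h1 (cabsB _ _).
have ct : 0 <= c * t by rewrite mulr_ge0 // ltW.
rewrite mulrDr mulr1; lra.
Qed.

Definition cauchy_ker z (t : R) : R[i]^o := (t%:C + z)^-1.

Lemma bcont_cauchy_ker c z : 0 < c -> away c z -> bcont (cauchy_ker z).
Proof.
move=> c0 hc.
have bnd t : 0 <= t -> cabs (cauchy_ker z t) <= c^-1.
  move=> t0; apply: (le_trans (away_cabsV c0 hc t0)).
  by rewrite lef_pV2 ?posrE ?mulr_gt0 ?ltr_wpDr // ler_peMr ?(ltW c0) // lerDl.
split; last by exists c^-1.
move=> t t0 e e0; exists (e * c ^+ 2); first by rewrite mulr_gt0 // exprn_gt0.
move=> s s0 st; rewrite -[rnorm _]/(cabs _).
have -> : cauchy_ker z s - cauchy_ker z t = (t - s)%:C * (cauchy_ker z s * cauchy_ker z t).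
  have hs := away_neq0 c0 hc s0; have ht := away_neq0 c0 hc t0.
  rewrite /cauchy_ker -[LHS]/(_ - _ : R[i]) -[X in _ * X]/(_ * _ : R[i]) rmorphB /=.
  have -> : t%:C - s%:C = (t%:C + z) - (s%:C + z) by rewrite opprD addrACA subrr addr0.
  move: hs ht; move: (s%:C + z) (t%:C + z) => a b a0 b0.
  by rewrite mulrBl mulrCA divff // mulr1 mulrA divff // mul1r.
rewrite !cabsM cabs_real distrC.
apply: (@le_lt_trans _ _ (`|s - t| * (c^-1 * c^-1))).
  by apply: ler_wpM2l => //; apply: ler_pM; rewrite ?cabs_ge0 ?bnd.
by rewrite -expr2 exprVn ltr_pdivrMr // exprn_gt0.
Qed.

Lemma bcontM (phi psi : R -> R[i]^o) : bcont phi -> bcont psi -> bcont (fun t => phi t * psi t : R[i]^o).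
Proof.
move=> h1 h2; have [M1 M10 k1] := bcont_bound h1; have [M2 M20 k2] := bcont_bound h2.
split; last first.
  exists (M1 * M2) => t t0; rewrite -[rnorm _]/(cabs _) cabsM.
  by apply: ler_pM; rewrite ?cabs_ge0 //; [exact: k1|exact: k2].
move=> t t0 e e0.
have e1 : 0 < e / 2 / (M2 + 1) by rewrite !divr_gt0 // ltr_wpDl.
have e2 : 0 < e / 2 / (M1 + 1) by rewrite !divr_gt0 // ltr_wpDl.
case: h1 => hc1 _; case: h2 => hc2 _.
have [r1 r10 a1] := hc1 t t0 _ e1; have [r2 r20 a2] := hc2 t t0 _ e2.
exists (Num.min r1 r2); first by rewrite lt_min r10.
move=> s s0; rewrite lt_min => /andP[/(a1 s s0) b1 /(a2 s s0) b2].
have -> : phi s * psi s - phi t * psi t = (phi s - phi t) * psi s + phi t * (psi s - psi t).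
  by rewrite mulrBl mulrBr addrA subrK.
apply: (le_lt_trans (rnormD _ _)); rewrite -[rnorm _]/(cabs _) -[rnorm (phi t * _)]/(cabs _) !cabsM.
have c1 : cabs (phi s - phi t) * cabs (psi s) < e / 2.
  apply: (@le_lt_trans _ _ (cabs (phi s - phi t) * (M2 + 1))).
    by apply: ler_wpM2l; rewrite ?cabs_ge0 //; apply: (le_trans (k2 s s0)); rewrite lerDl.
  by rewrite -ltr_pdivlMr // ltr_wpDl.
have c2 : cabs (phi t) * cabs (psi s - psi t) < e / 2.
  rewrite mulrC; apply: (@le_lt_trans _ _ (cabs (psi s - psi t) * (M1 + 1))).
    by apply: ler_wpM2l; rewrite ?cabs_ge0 //; apply: (le_trans (k1 t t0)); rewrite lerDl.
  by rewrite -ltr_pdivlMr // ltr_wpDl.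
have -> : e = e / 2 + e / 2 by field.
exact: (ltrD c1 c2).
Qed.

(* the normalization makes the kernel bounded *)
Definition stk z (t : R) : R[i]^o := (1 + t)%:C * (t%:C + z)^-1.

Lemma bcont_stk c z : 0 < c -> away c z -> bcont (stk z).
Proof.
move=> c0 hc.
have := bcontD (bcont_cst (1 : R[i]^o))
  (bcontM (bcont_cst ((1 - z) : R[i]^o)) (bcont_cauchy_ker c0 hc)).
move=> [h [M hM]].
have E t : 0 <= t -> stk z t = 1 + (1 - z) * cauchy_ker z t.
  move=> t0; have n0 := away_neq0 c0 hc t0; rewrite /stk /cauchy_ker.
  have -> : (1 + t)%:C = (t%:C + z) + (1 - z) by rewrite rmorphD /=; ring.
  by rewrite mulrDl divff.
split; last by exists M => t t0; rewrite E //; exact: hM.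
move=> t t0 e e0; have [r r0 hr] := h t t0 e e0; exists r => // s s0 st.
by rewrite !E //; exact: hr.
Qed.

(** A Stieltjes function with measure (1 + tau) m (d tau). *)
Definition stt m (a : R) z : R[i] := a%:C + (bochner_integral m (Rplus R) (stk z) : R[i]).

Lemma stt_cdiff m a z : 0 <= complex.Re z -> z != 0 -> exists D, cdiff (stt m a) z D.
Proof.
move=> z0 zn; have [c c0 hc] := awayP z0 zn.
exists (bochner_integral m (Rplus R) (fun t => stk z t * (- cauchy_ker z t) : R[i]^o)).
have c2 : 0 < c / 2 by rewrite divr_gt0.
have key : cdiff (fun w => bochner_integral m (Rplus R) (stk w)) z
    (bochner_integral m (Rplus R) (fun t => stk z t * (- cauchy_ker z t) : R[i]^o)).
  apply: (bochner_cdiff m (r := c / 2) (C := 2 / c ^+ 3)) => //.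
  - by rewrite divr_ge0 // exprn_ge0 // ltW.
  - by apply: bcontM; [exact: bcont_stk hc|apply: bcontN; exact: bcont_cauchy_ker hc].
  - by move=> w /(away_near c0 hc) hw; exact: bcont_stk hw.
  - move=> w t /(away_near c0 hc) hw t0.
    have t1 : 0 < 1 + t by rewrite ltr_wpDr.
    have nz := away_neq0 c0 hc t0; have nw := away_neq0 c2 hw t0.
    have az := away_cabsV c0 hc t0; have aw := away_cabsV c2 hw t0.
    have -> : stk w t - stk z t - stk z t * (- cauchy_ker z t) * (w - z) =
      (1 + t)%:C * ((t%:C + z)^-1 * (t%:C + z)^-1 * (t%:C + w)^-1) * (w - z) ^+ 2.
      rewrite /stk /cauchy_ker -[LHS]/(_ - _ : R[i]) -[X in _ - X]/(_ * _ * _ : R[i]).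
      have -> : w - z = (t%:C + w) - (t%:C + z) by rewrite opprD addrACA subrr add0r.
      move: nz nw; move: (t%:C + z) (t%:C + w) => a' b' a0 b0; clear -a0 b0.
      by field; rewrite a0 b0.
    rewrite cabsM [cabs ((w - z) ^+ 2)]cabsX; apply: ler_wpM2r; first by rewrite exprn_ge0 ?cabs_ge0.
    rewrite cabsM cabs_real (ger0_norm (ltW t1)) cabsM [cabs (_ / _)]cabsM.
    apply: (@le_trans _ _ ((1 + t) * ((c * (1 + t))^-1 * (c * (1 + t))^-1 * (c / 2 * (1 + t))^-1))).
      apply: ler_wpM2l; first exact: ltW.
      by apply: ler_pM; rewrite ?mulr_ge0 ?cabs_ge0 //; apply: ler_pM; rewrite ?cabs_ge0.
    have -> : (1 + t) * ((c * (1 + t))^-1 * (c * (1 + t))^-1 * (c / 2 * (1 + t))^-1) =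
       2 / c ^+ 3 * (1 + t)^-1 ^+ 2.
      by move: t1 => /lt0r_neq0; move: (1 + t) => u u0; field; rewrite u0 lt0r_neq0.
    rewrite ler_piMr ?divr_ge0 ?exprn_ge0 ?(ltW c0) // exprn_ile1 ?invr_ge0 ?(ltW t1) //.
    by rewrite invf_le1 // lerDl.
move=> e e0; have [r r0 hr] := key e e0; exists r => // w /hr.
rewrite /stt; set p := bochner_integral _ _ _; set q := bochner_integral _ _ _.
by have -> : a%:C + p - (a%:C + q) = p - q by rewrite opprD addrACA subrr add0r.
Qed.

Lemma bochner_Re_ge0 m (phi : R -> R[i]^o) : bcont phi ->
  (forall t, 0 <= t -> 0 <= complex.Re (phi t)) ->
  0 <= complex.Re (bochner_integral m (Rplus R) phi : R[i]).
Proof.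
move=> hphi h; have c1 := rsum_cvg1 limC m hphi.
have c2 : complex.Re (rsum (mesh 1 n) (mesh_num n) m phi : R[i]) @[n --> \oo] -->
  complex.Re (bochner_integral m (Rplus R) phi : R[i]).
  move/cvg_cabsP: c1 => c1; apply/cvgrPdist_lt => e /c1; apply: filterS => n hn.
  by rewrite -cReB; apply: le_lt_trans hn; exact: Re_le_cabs.
rewrite -(cvg_lim (@Rhausdorff R) c2); apply: limr_ge; first by apply/cvg_ex; eexists; exact: c2.
apply: nearW => n; rewrite /rsum (raddf_sum (@complex.Re R)); apply: sumr_ge0 => k _.
have reZ (x : R) (y : R[i]) : complex.Re (x%:C *: (y : R[i]^o) : R[i]) = x * complex.Re y.
  exact: cRe_realM.
apply: (eq_ind_r (fun v => 0 <= v) _ (reZ _ _)); apply: mulr_ge0; first exact: fine_ge0.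
by apply: h; rewrite mulr_ge0 // ltW // mesh_gt0.
Qed.

Lemma norm_neq0_away (eta : R) : eta != 0 -> exists2 c, 0 < c & away c (`|eta|%:C).
Proof. by move=> e0; apply: awayP => //=; rewrite (inj_eq (@complexI R)) normr_eq0. Qed.

(** With g the sign of eta, Re ((1 + i g) / (t + i eta)) = (t + |eta|) / (t^2 +
    eta^2) is at least 1 / (t + |eta|). By integration Re ((1 + i g) F (i eta))
    is at least F (|eta|), and |1 + i g| <= 2. *)
Lemma stt_lower m a (eta v : R) : 0 <= a -> eta != 0 -> stt m a `|eta|%:C = v%:C ->
  v / 2 <= cabs (stt m a (eta%:C * 'i%C)).
Proof.
move=> a0 e0 hv; set z := eta%:C * 'i%C.
have Rz : complex.Re z = 0 by rewrite /z cReM /= mulr0 mul0r subr0.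
have Iz : complex.Im z = eta by rewrite /z cImM /= mulr1 mul0r addr0.
have zn : z != 0 by apply/negP => /eqP /(congr1 (@complex.Im R)); rewrite Iz /= => /eqP; rewrite (negbTE e0).
have [c c0 hc] : exists2 c, 0 < c & away c z by apply: awayP => //; rewrite Rz.
have [d d0 hd] := norm_neq0_away e0.
pose g : R := Num.sg eta.
pose u : R[i] := 1 +i* g.
have bz := bcont_stk c0 hc; have bx := bcont_stk d0 hd.
have pos : 0 <= complex.Re (u * stt m a z - stt m a `|eta|%:C).
  have bu : bcont (fun t => u * stk z t : R[i]^o) by exact: bcontM (bcont_cst (u : R[i]^o)) bz.
  have lin : @lin_bounded R (R[i]^o) (R[i]^o) (fun x => u * x) (cabs u).
    split; [by move=> x y; exact: mulrDr|by move=> k x; exact: mulrCA|].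
    by move=> x; rewrite -[X in X <= _]/(cabs _) cabsM.
  have -> : u * stt m a z - stt m a `|eta|%:C = (u * a%:C - a%:C) +
      (bochner_integral m (Rplus R) (fun t => u * stk z t - stk `|eta|%:C t : R[i]^o) : R[i]).
    rewrite (bochnerB limC) // -(bochner_lin limC limC m lin bz) /stt.
    set p := bochner_integral _ _ _; set q := bochner_integral _ _ _.
    by rewrite mulrDr opprD addrACA.
  rewrite cReD cReB cReM /= mulr0 subr0 mul1r subrr add0r.
  apply: bochner_Re_ge0; first exact: bcontB.
  move=> t t0; rewrite /stk -[_ - _]/(_ - _ : R[i]).
  have t1 : 0 <= 1 + t by rewrite addr_ge0.
  have -> : u * ((1 + t)%:C * (t%:C + z)^-1) - (1 + t)%:C * (t%:C + `|eta|%:C)^-1 =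
    (1 + t)%:C * (u * (t%:C + z)^-1 - (t + `|eta|)^-1%:C).
    have -> : ((t + `|eta|)^-1)%:C = (t%:C + `|eta|%:C)^-1 by rewrite fmorphV rmorphD.
    by rewrite [RHS]mulrBr mulrCA.
  rewrite cRe_realM; apply: mulr_ge0 => //.
  have q0 : 0 < t ^+ 2 + eta ^+ 2 by rewrite ltr_wpDl ?sqr_ge0 // exprn_even_gt0.
  have -> : (t%:C + z)^-1 = (t ^+ 2 + eta ^+ 2)^-1%:C * (t +i* - eta).
    move: Rz Iz (away_neq0 c0 hc t0); clear -q0; move: z => y Ry Iy n0.
    apply: (mulfI n0); rewrite divff //.
    apply: complexP; rewrite !(cReM, cImM, cReD, cImD) Ry Iy /=; field; exact: lt0r_neq0.
  rewrite mulrCA cReB cRe_realM cReM /= mul1r.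
  have -> : g * - eta = - `|eta| by rewrite mulrN -normrEsg.
  rewrite opprK subr_ge0.
  have te : 0 < t + `|eta| by rewrite ltr_wpDl // normr_gt0.
  rewrite mulrC ler_pdivlMr // mulrC ler_pdivrMr // -expr2 -(real_normK (num_real eta)).
  have : 0 <= t * `|eta| by rewrite mulr_ge0.
  rewrite !expr2 mulrDl !mulrDr (mulrC `|eta| t) => h; lra.
rewrite cReB hv /= subr_ge0 in pos.
have u2 : cabs u <= 2.
  apply: (le_trans (cabs_le_ReIm _)); rewrite /= normr1.
  have -> : (2 : R) = 1 + 1 by []. by rewrite lerD2l normr_sg e0.
rewrite ler_pdivrMr // mulrC; apply: (le_trans pos); apply: (le_trans (ler_norm _)).
apply: (le_trans (Re_le_cabs _)); rewrite cabsM ler_wpM2r ?cabs_ge0 //.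
Qed.

(** Both integrals are limits of those of the step functions of phi. *)
Lemma bochner_ge0 m (phi : R -> R) : bcont (fun t => (phi t)%:C : R[i]^o) ->
  (forall t, 0 <= t -> 0 <= phi t) -> exists2 r : R,
  (\int[m]_(t in Rplus R) (phi t)%:E = r%:E)%E &
  bochner_integral m (Rplus R) (fun t => (phi t)%:C : R[i]^o) = r%:C.
Proof.
pose phic t : R[i]^o := (phi t)%:C.
rewrite -/phic => hb p0; have mD : measurable (Rplus R : set mR) by exact: measurable_itv.
have [M M0 hM] := bcont_bound hb.
have mphi : measurable_fun (Rplus R : set mR) phi.
  have h := bcont_dist_measurable hb (0 : R[i]^o).
  apply: (eq_measurable_fun _ _ h) => t; rewrite inE /Rplus /= in_itv /= andbT => t0.
  by rewrite subr0 -[rnorm _]/(cabs _) cabs_real ger0_norm // p0.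
have I0 : (0 <= \int[m]_(t in Rplus R) (phi t)%:E)%E.
  by apply: integral_ge0 => t; rewrite /Rplus /= in_itv /= andbT => t0; rewrite lee_fin p0.
have Ifin : (\int[m]_(t in Rplus R) (phi t)%:E)%E \is a fin_num.
  rewrite ge0_fin_numE //; apply: (@le_lt_trans _ _ (\int[m]_(t in Rplus R) M%:E)%E).
    apply: ge0_le_integral => //.
    - by move=> t; rewrite /Rplus /= in_itv /= andbT => t0; rewrite lee_fin p0.
    - by apply/measurable_EFinP.
    - move=> t Dt; move: (Dt); rewrite /Rplus /= in_itv /= andbT => t0; rewrite lee_fin.
      have := hM t t0; rewrite -[rnorm _]/(cabs _) cabs_real ger0_norm //; exact: p0.
  have E : (\int[m]_(t in Rplus R) M%:E)%E = (M%:E * m (Rplus R))%E := integral_cst m mD M%:E.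
  by rewrite E -(fineK (fin_num_measure m _ mD)) -EFinM ltry.
exists (fine (\int[m]_(t in Rplus R) (phi t)%:E)%E); first by rewrite fineK.
set I := fine _.
apply/eqP; rewrite -subr_eq0; apply/eqP/cabs_eq0/eqP; rewrite eq_le cabs_ge0 andbT.
have hI := step_integral_cvg0 m (@ltr01 R) hb.
have hR := rsum_cvg1 limC m hb.
apply/ler_addgt0Pr => e e0; rewrite add0r.
have e2 : 0 < e / 2 by rewrite divr_gt0.
move/fine_cvgP: hI => [fin1 /cvgrPdist_lt/(_ _ e2) k1].
move/cvg_cabsP: hR => /(_ _ e2) k2.
near \oo => n.
have l2 : cabs (bochner_integral m (Rplus R) phic -
   rsum (mesh 1 n) (mesh_num n) m phic) < e / 2 by near: n.
have l1 : `|0 - (fine \o (fun n => \int[m]_(t in Rplus R) (rnorm (phic t -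
  stepfun (mesh 1 n) (mesh_num n) phic t))%:E)%E) n| < e / 2 by near: n.
have l3 : (\int[m]_(t in Rplus R) (rnorm (phic t -
  stepfun (mesh 1 n) (mesh_num n) phic t))%:E)%E \is a fin_num by near: n.
set J := (\int[m]_(t in _) _)%E in l3; rewrite /= -/J sub0r normrN in l1.
suff h : cabs (rsum (mesh 1 n) (mesh_num n) m phic - I%:C) <= fine J.
  rewrite -[bochner_integral _ _ _](subrK (rsum (mesh 1 n) (mesh_num n) m phic)).
  rewrite -addrA; apply: (le_trans (cabsD _ _)).
  have h' := le_trans h (ler_norm _).
  have -> : e = e / 2 + e / 2 by field.
  apply: lerD; first exact: ltW.
  exact: le_trans h' (ltW l1).
have d0 : 0 < mesh (1 : R) n by exact: mesh_gt0.
move: l3; rewrite /J {l1 l2 J}; set d := mesh 1 n in d0 *; set N := mesh_num n => l3.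
pose psi k := if (k < N)%N then phi (k%:R * d) else 0.
have kd k : 0 <= k%:R * d by rewrite mulr_ge0 // ltW.
have psi0 k : 0 <= psi k by rewrite /psi; case: ifP => // _; exact: p0.
have ui : uniq (iota 0 N.+1) by exact: iota_uniq.
have qi t : stepidx d N t \in iota 0 N.+1.
  by rewrite mem_iota /= add0n ltnS stepidx_le.
have := integral_fibers m mD ui qi (fun k => stepidx_measurable N k d0) psi0.
set S := \sum_(w <- _) _ => ES.
have SE : rsum d N m phic = S%:C.
  rewrite /S -[iota 0 N.+1]/(index_iota 0 N.+1) big_nat_recr //= /psi ltnn mulr0 addr0.
  rewrite big_mkord rmorph_sum; apply: eq_bigr => k _; rewrite ltn_ord -[_ *: _]/(_ * _ : R[i]) rmorphM /=.
  congr (_%:C * _); rewrite /fiber_mass stepidx_fiber //.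
  congr (fine (m _)); apply/esym/setIidr => t; rewrite /Rplus /= !in_itv /= andbT => /andP[h _].
  exact: le_trans (kd _) h.
have stE t : 0 <= t -> rnorm (phic t - stepfun d N phic t) = `|phi t - psi (stepidx d N t)|.
  move=> t0; have -> : stepfun d N phic t = (psi (stepidx d N t))%:C.
    by rewrite /stepfun /psi; case: ifP.
  by rewrite -[rnorm _]/(cabs _) -rmorphB cabs_real.
have mpsi : measurable_fun (Rplus R : set mR) (fun t => psi (stepidx d N t)).
  have -> : (fun t => psi (stepidx d N t)) = (fun t => rnorm (stepfun d N phic t - 0)).
    apply: funext => t; rewrite subr0 /= /stepfun /psi; case: ifP => _; last by rewrite rnorm0.
    by rewrite -[RHS]/(cabs _) cabs_real ger0_norm // p0.
  exact: (@simple_dist_measurable R (R[i]^o) (Rplus R) mD (stepfun d N phic)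
    (fun v => stepfun_measurable _ _ v d0) 0).
rewrite SE -rmorphB cabs_real.
have JE : (\int[m]_(t in Rplus R) (rnorm (phic t -
  stepfun d N phic t))%:E)%E = (\int[m]_(t in Rplus R) `|phi t - psi (stepidx d N t)|%:E)%E.
  apply: eq_integral => t; rewrite inE /Rplus /= in_itv /= andbT => t0; by rewrite stE.
rewrite JE in l3 *.
have iphi : m.-integrable (Rplus R : set mR) (fun t => (phi t)%:E).
  apply/integrableP; split; first by apply/measurable_EFinP.
  have -> : (\int[m]_(t in Rplus R) `|(phi t)%:E| = \int[m]_(t in Rplus R) (phi t)%:E)%E.
    apply: eq_integral => t; rewrite inE /Rplus /= in_itv /= andbT => t0.
    by rewrite /= ger0_norm // p0.
  by rewrite -ge0_fin_numE.
have ipsi : m.-integrable (Rplus R : set mR) (fun t => (psi (stepidx d N t))%:E).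
  apply/integrableP; split; first by apply/measurable_EFinP.
  have -> : (\int[m]_(t in Rplus R) `|(psi (stepidx d N t))%:E| =
      \int[m]_(t in Rplus R) (psi (stepidx d N t))%:E)%E.
    by apply: eq_integral => t _; rewrite /= ger0_norm.
  by rewrite ES ltry.
have := le_abse_integral m mD (measurable_int m (integrableB mD ipsi iphi)).
rewrite integralB_EFin // ES -(fineK Ifin) -/I -EFinB /= => h.
rewrite -lee_fin fineK //; apply: (le_trans h).
rewrite le_eqVlt; apply/orP; left; apply/eqP; apply: eq_integral => t _.
by rewrite /= distrC.
Unshelve. all: by end_near. Qed.

End StieltjesTransform.

(** * Finite measures with prescribed Laplace transforms *)

Section Density.
Variable R : realType.
Local Notation mR := (measurableTypeR R).
Variables (mu : {measure set mR -> \bar R}) (w : mR -> R).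
Hypotheses (w0 : forall t, 0 <= w t) (mw : measurable_fun setT w).
Local Open Scope ereal_scope.

Definition dens (A : set mR) : \bar R := \int[mu]_(t in A) (w t)%:E.

Let dens0 : dens set0 = 0. Proof. exact: integral_set0. Qed.
Let dens_ge0 A : 0 <= dens A.
Proof. by apply: integral_ge0 => t _; rewrite lee_fin. Qed.
Let dens_sigma : semi_sigma_additive dens.
Proof.
apply: semi_sigma_additive_nng_induced; last by move=> t; rewrite lee_fin.
by apply/measurable_EFinP.
Qed.
HB.instance Definition _ := isMeasure.Build _ _ _ dens dens0 dens_ge0 dens_sigma.

Definition dens_measure : {measure set mR -> \bar R} := dens.

Import HBNNSimple.

Lemma ge0_integral_dens (f : mR -> \bar R) : measurable_fun setT f -> (forall t, 0 <= f t) ->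
  \int[dens_measure]_t f t = \int[mu]_t (f t * (w t)%:E).
Proof.
move=> mf f0; have mE : measurable (setT : set mR) by [].
have mwE : measurable_fun (setT : set mR) (EFin \o w) by apply/measurable_EFinP.
have mwE' : measurable_fun (setT : set mR) (fun t => (w t)%:E) by exact: mwE.
pose h := nnsfun_approx mE mf.
have -> : \int[dens_measure]_t f t = lim (\int[dens_measure]_t (EFin \o h n) t @[n --> \oo]).
  have fE x : f x = lim ((EFin \o h n) x @[n --> \oo]).
    by apply/esym/cvg_lim => //; exact: cvg_nnsfun_approx.
  under eq_integral => x _ do rewrite fE.
  apply: monotone_convergence => //.
  - by move=> n; apply/measurable_EFinP; exact/measurable_funP.
  - by move=> n x Ex //=; rewrite lee_fin.
  - by move=> x Ex a b ab; rewrite lee_fin; exact/lefP/nd_nnsfun_approx.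
have -> : \int[mu]_t (f t * (w t)%:E) = lim (\int[mu]_t ((h n t)%:E * (w t)%:E) @[n --> \oo]).
  have fg x : f x * (w x)%:E = lim ((h n x)%:E * (w x)%:E @[n --> \oo]).
    by apply/esym/cvg_lim => //; apply: cvgeZr => //; exact: cvg_nnsfun_approx.
  under eq_integral => x _ do rewrite fg.
  apply: monotone_convergence => [//| | |].
  - by move=> n; apply/emeasurable_funM => //; apply/measurable_EFinP; exact/measurable_funP.
  - by move=> n x Ex /=; rewrite mule_ge0 ?lee_fin.
  - by move=> x Ex a b ab/=; rewrite lee_wpmul2r ?lee_fin//; exact/lefP/nd_nnsfun_approx.
suff E n : \int[dens_measure]_t (h n t)%:E = \int[mu]_t ((h n t)%:E * (w t)%:E).
  by under [in RHS]eq_fun do rewrite -E.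
transitivity (\int[dens_measure]_t (\sum_(y \in range (h n)) (y * \1_(h n @^-1` [set y]) t)%:E)).
  by apply: eq_integral => t tE; rewrite /= fimfunE -fsumEFin.
have indich r : measurable_fun (setT : set mR) (fun x => (r * \1_(h n @^-1` [set r]) x)%:E).
  by apply/measurable_EFinP; exact: measurable_funM.
rewrite ge0_integral_fsum//; last by move=> m y Ey; exact: nnfun_muleindic_ge0.
transitivity (\int[mu]_x (\sum_(y \in range (h n))
    (y * \1_(h n @^-1` [set y]) x)%:E * (w x)%:E)); last first.
  under [RHS]eq_integral => x xE.
    rewrite fimfunE -fsumEFin // ge0_mule_fsuml => [|y]; last exact: nnfun_muleindic_ge0.
    over.
  by [].
rewrite ge0_integral_fsum//; last 2 first.
  - by move=> y; apply: emeasurable_funM.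
  - by move=> m y Ey; apply: mule_ge0; [exact: nnfun_muleindic_ge0|rewrite lee_fin].
apply: eq_fsbigr => r rhn.
under eq_integral do rewrite EFinM.
rewrite integralZl_indic_nnsfun => //.
under [RHS]eq_integral do rewrite EFinM -muleA.
rewrite ge0_integralZl//.
- congr (_ * _); under [RHS]eq_integral do rewrite muleC.
  rewrite [RHS](eq_integral ((EFin \o w) \_ (h n @^-1` [set r]))); last first.
    by move=> x xE; rewrite epatch_indic.
  by rewrite -integral_mkcondr integral_indic// setIT setTI.
- by apply: emeasurable_funM => //; exact/measurable_EFinP.
- by move=> t Et; rewrite mule_ge0 ?lee_fin.
- by move: rhn; rewrite inE => -[t _ <-]; rewrite lee_fin.
Qed.

End Density.

Section FiniteMeasures.
Variable R : realType.
Local Notation mR := (measurableTypeR R).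
Implicit Types (m : {finite_measure set mR -> \bar R}).

Section Fmeas.
Variables (mu : {measure set mR -> \bar R}) (h : (mu setT < +oo)%E).
Definition fmeas : set mR -> \bar R := mu.
HB.instance Definition _ := Measure.on fmeas.
Let fmeas_fin : fin_num_fun fmeas. Proof. exact: lty_fin_num_fun. Qed.
HB.instance Definition _ := @Measure_isFinite.Build _ mR R fmeas fmeas_fin.
Definition fmeas_measure : {finite_measure set mR -> \bar R} := fmeas.
End Fmeas.

(** The image under h of the product of m1 and m2, integrated by means of
    Tonelli's theorem. *)
Lemma push2 m1 m2 (h : mR * mR -> mR) : measurable_fun setT h ->
  exists m, forall g : mR -> \bar R, measurable_fun setT g -> (forall t, (0 <= g t)%E) ->
    (\int[m]_t g t = \int[m1]_s \int[m2]_t g (h (s, t)))%E.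
Proof.
move=> mh.
pose P : {measure set mR -> \bar R} :=
  @measure_function_pushforward__canonical__measure_function_Measure _ _ _ _ _ (m1 \x m2)%E h mh.
have PT : (P setT < +oo)%E.
  rewrite /P /= /pushforward preimage_setT -setXTT product_measure1E //.
  by rewrite lte_mul_pinfty// ?fin_num_measure// ltey_eq fin_num_measure.
exists (fmeas_measure PT) => g mg g0.
have -> : (\int[fmeas_measure PT]_t g t = \int[pushforward (m1 \x m2)%E h]_t g t)%E by [].
rewrite ge0_integral_pushforward //.
rewrite preimage_setT (@fubini_tonelli1 _ _ _ _ _ m1 m2 (g \o h)) //.
  exact: measurableT_comp.
by move=> p; exact: g0.
Qed.

Section MeasureAdd.
Variables (m1 m2 : {finite_measure set mR -> \bar R}).
Let madd_fin : (measure_add m1 m2 setT < +oo)%E.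
Proof. by rewrite measure_addE lte_add_pinfty // ltey_eq fin_num_measure. Qed.
Definition madd := fmeas_measure madd_fin.

Lemma bochner_madd (V : normedModType R[i]) (limV : has_limits V) (phi : R -> V) : bcont phi ->
  bochner_integral madd (Rplus R) phi =
  bochner_integral m1 (Rplus R) phi + bochner_integral m2 (Rplus R) phi.
Proof.
move=> hphi.
have c : rsum (mesh 1 n) (mesh_num n) m1 phi + rsum (mesh 1 n) (mesh_num n) m2 phi @[n --> \oo] -->
    bochner_integral m1 (Rplus R) phi + bochner_integral m2 (Rplus R) phi.
  exact: cvgD (rsum_cvg1 limV m1 hphi) (rsum_cvg1 limV m2 hphi).
apply: (cvg_eqP (rsum_cvg1 limV madd hphi) c) => n.
rewrite /rsum -big_split; apply: eq_bigr => k _ /=; rewrite -scalerDl -rmorphD /=.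
have mI : measurable (`[k%:R * mesh 1 n, k.+1%:R * mesh 1 n[%classic : set mR) by exact: measurable_itv.
move: mI; set I : set mR := `[_, _[%classic => mI; congr (_%:C *: _).
by rewrite -[msum _ _ _]/(measure_add m1 m2 I) measure_addE fineD // fin_num_measure.
Qed.

End MeasureAdd.

(** The extension by 0 lets a measure on the whole line stand for its
    restriction to [0, +oo). *)
Definition wt (x s : R) : R := if 0 <= s then expR (- (s * x)) else 0.

Lemma wt_ge0 x s : 0 <= wt x s.
Proof. by rewrite /wt; case: ifP => // _; exact: expR_ge0. Qed.

Lemma measurable_ge0 : measurable_fun setT (fun s : mR => 0 <= s).
Proof. exact: measurable_fun_ler. Qed.

Lemma measurable_wt x : measurable_fun setT (wt x : mR -> mR).
Proof.
apply: measurable_fun_if => //; first exact: measurable_ge0.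
apply: measurable_funTS; apply: measurableT_comp; first exact: measurable_expR.
by apply: measurableT_comp => //; exact: measurable_funM.
Qed.

Lemma measurable_EFin_wt x : measurable_fun setT (fun s : mR => (wt x s)%:E).
Proof. by apply/measurable_EFinP; exact: measurable_wt. Qed.

Definition lapr m x : R := fine (\int[m]_s (wt x s)%:E)%E.

Lemma integral_wt m x : (\int[m]_s (wt x s)%:E = \int[m]_(s in Rplus R) (expR (- (s * x)))%:E)%E.
Proof.
rewrite [RHS]integral_mkcond; apply: eq_integral => s _; rewrite patchE /wt.
by rewrite (_ : (s \in Rplus R) = (0 <= s)) ?in_setE; [case: ifP|apply/idP/idP; rewrite ?inE /Rplus /= in_itv /= andbT].
Qed.

Lemma cexp_real (t x : R) : cexp (- (t%:C * x%:C)) = (expR (- (t * x)))%:C.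
Proof. by rewrite -rmorphM -rmorphN /cexp /= cos0 sin0 -[1 +i* 0]/(1 : R[i]) mulr1. Qed.

(** On the positive real axis the Laplace transform is a Lebesgue integral of a
    nonnegative function, to which Tonelli's theorem applies. *)
Lemma laprP m x : 0 <= x ->
  (\int[m]_s (wt x s)%:E = (lapr m x)%:E)%E /\ lap m x%:C = (lapr m x)%:C.
Proof.
move=> x0; have hb : bcont (fun t => (expR (- (t * x)))%:C : R[i]^o).
  have := @bcont_cexp R x%:C x0; by under [X in bcont X]eq_fun do rewrite cexp_real.
have [r E1 E2] := bochner_ge0 m hb (fun t _ => expR_ge0 _).
have Er : lapr m x = r by rewrite /lapr integral_wt E1.
rewrite Er integral_wt; split; first exact: E1.
have E : (fun s => cexp (- (s%:C * x%:C)) : R[i]^o) = (fun t => (expR (- (t * x)))%:C).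
  by apply: funext => t; exact: cexp_real.
by rewrite /lap E; exact: E2.
Qed.

Lemma lapr_ge0 m x : 0 <= lapr m x.
Proof. by apply: fine_ge0; apply: integral_ge0 => s _; rewrite lee_fin wt_ge0. Qed.

Lemma lapr_add m1 m2 x : 0 <= x -> lapr (madd m1 m2) x = lapr m1 x + lapr m2 x.
Proof.
move=> x0; rewrite {1}/lapr.
have -> : (\int[madd m1 m2]_s (wt x s)%:E = \int[measure_add m1 m2]_s (wt x s)%:E)%E by [].
rewrite ge0_integral_measure_add //; last 2 first.
- by move=> s _; rewrite lee_fin wt_ge0.
- exact: measurable_EFin_wt.
by rewrite (proj1 (laprP m1 x0)) (proj1 (laprP m2 x0)).
Qed.

Lemma lapr_cst (c : R) : 0 <= c -> exists m, forall x, 0 <= x -> lapr m x = c.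
Proof.
move=> c0; exists (mscale (NngNum c0) \d_(0 : mR)) => x x0; rewrite /lapr.
rewrite ge0_integral_mscale //; last 2 first.
- exact: measurable_EFin_wt.
- by move=> s _; rewrite lee_fin wt_ge0.
rewrite integral_dirac //; last exact: measurable_EFin_wt.
by rewrite diracT mul1e /wt lexx mul0r oppr0 expR0 mule1.
Qed.

(** Convolution is the image of the product measure by addition; outside the
    quadrant the map takes a value where the Laplace kernel vanishes. *)
Lemma lapr_conv m1 m2 : exists m, forall x, 0 <= x -> lapr m x = lapr m1 x * lapr m2 x.
Proof.
pose h (p : mR * mR) : mR := if 0 <= p.1 then if 0 <= p.2 then p.1 + p.2 else -1 else -1.
have mh : measurable_fun setT h.
  apply: measurable_fun_if => //.
    by apply: (measurableT_comp measurable_ge0); exact: measurable_fst.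
  apply: measurable_funTS; apply: measurable_fun_if => //.
    by apply: (measurableT_comp measurable_ge0); exact: measurable_snd.
  by apply: measurable_funTS; exact: measurable_funD.
have [m hm] := push2 m1 m2 mh; exists m => x x0.
have wh s t : wt x (h (s, t)) = wt x s * wt x t.
  rewrite /h /wt /=; case: (leP 0 s) => s0; last by rewrite mul0r ler0N1.
  case: (leP 0 t) => t0; last by rewrite mulr0 ler0N1.
  by rewrite addr_ge0 // mulrDl opprD expRD.
rewrite {1}/lapr hm; last 2 first.
- exact: measurable_EFin_wt.
- by move=> t; rewrite lee_fin wt_ge0.
have I2 s : (\int[m2]_t (wt x (h (s, t)))%:E = (lapr m2 x)%:E * (wt x s)%:E)%E.
  under eq_integral do rewrite wh EFinM.
  rewrite ge0_integralZl_EFin //.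
  - by rewrite (proj1 (laprP m2 x0)) muleC.
  - by move=> t _; rewrite lee_fin wt_ge0.
  - exact: measurable_EFin_wt.
  - exact: wt_ge0.
under eq_integral do rewrite I2.
rewrite ge0_integralZl_EFin //.
- by rewrite (proj1 (laprP m1 x0)) -EFinM mulrC.
- by move=> t _; rewrite lee_fin wt_ge0.
- exact: measurable_EFin_wt.
- exact: lapr_ge0.
Qed.

Lemma lapr_exp_dist (l : R) (l0 : 0 < l) x : 0 <= x -> lapr (exp_dist l0) x = l / (l + x).
Proof.
move=> x0; apply: (@complexI R); rewrite -(proj2 (laprP (exp_dist l0) x0)).
by rewrite lap_exp_dist // rmorphM fmorphV rmorphD.
Qed.

(** tau / (tau + x) is the Laplace transform of an exponential variable of
    rate tau, and E / tau has this law when E has rate 1. *)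
Lemma lapr_mix m : exists m', forall x, 0 < x ->
  ((lapr m' x)%:E = \int[m]_(t in Rplus R) (t / (t + x))%:E)%E.
Proof.
pose h (p : mR * mR) : mR := if 0 < p.1 then if 0 <= p.2 then p.2 * expR (- ln p.1) else -1 else -1.
have mh : measurable_fun setT h.
  apply: measurable_fun_if => //.
    apply: (measurableT_comp (f := fun s : mR => 0 < s)); last exact: measurable_fst.
    exact: measurable_fun_ltr.
  apply: measurable_funTS; apply: measurable_fun_if => //.
    by apply: (measurableT_comp measurable_ge0); exact: measurable_snd.
  apply: measurable_funTS; apply: measurable_funM => //.
  apply: measurableT_comp; first exact: measurable_expR.
  apply: measurableT_comp => //.
  by apply: (measurableT_comp (f := @ln R)); [exact: measurable_ln|exact: measurable_fst].
have [m' hm] := push2 m (exp_dist (@ltr01 R)) mh; exists m' => x x0.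
rewrite -(proj1 (laprP m' (ltW x0))) hm; last 2 first.
- exact: measurable_EFin_wt.
- by move=> t; rewrite lee_fin wt_ge0.
rewrite [RHS]integral_mkcond; apply: eq_integral => s _; rewrite patchE.
have [s0|s0] := ltP 0 s; last first.
  have -> : (\int[exp_dist ltr01]_t (wt x (h (s, t)))%:E = \int[exp_dist (@ltr01 R)]_t 0)%E.
    by apply: eq_integral => t _; rewrite /h /= ltNge s0 /= /wt ler0N1.
  rewrite integral0; case: ifP => //; rewrite inE /Rplus /= in_itv /= andbT => s1.
  have -> : s = 0 by apply/eqP; rewrite eq_le s0 s1.
  by rewrite mul0r.
rewrite ifT; last by rewrite inE /Rplus /= in_itv /= andbT ltW.
have -> : (\int[exp_dist ltr01]_t (wt x (h (s, t)))%:E = \int[exp_dist (@ltr01 R)]_t (wt (x / s) t)%:E)%E.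
  apply: eq_integral => t _; rewrite /h /= s0 /wt; case: (leP 0 t) => t0; last by rewrite ler0N1.
  by rewrite expRN lnK ?posrE // divr_ge0 ?(ltW s0) // mulrA mulrAC.
have xs : 0 <= x / s by rewrite divr_ge0 ?ltW.
rewrite (proj1 (laprP _ xs)) lapr_exp_dist //; congr (_%:E).
have h1 : s + x != 0 by rewrite lt0r_neq0 // addr_gt0.
have h2 : s != 0 by rewrite lt0r_neq0.
have h3 : 1 + x / s != 0 by rewrite lt0r_neq0 // ltr_wpDr.
by field; rewrite h1 h2.
Qed.

End FiniteMeasures.

Section LaplaceAlgebra.
Variable R : realType.
Local Notation mR := (measurableTypeR R).
Implicit Types (m : {finite_measure set mR -> \bar R}) (g h : R -> R).

Definition is_lap g := exists m1 m2, forall x, 0 < x -> lapr m1 x - lapr m2 x = g x.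

Lemma is_lap_eq g h : (forall x, 0 < x -> g x = h x) -> is_lap g -> is_lap h.
Proof. by move=> gh [m1 [m2 E]]; exists m1, m2 => x x0; rewrite E // gh. Qed.

Lemma is_lapD g h : is_lap g -> is_lap h -> is_lap (fun x => g x + h x).
Proof.
move=> [m1 [m2 E]] [k1 [k2 E']].
exists (madd m1 k1), (madd m2 k2) => x x0; have x0' := ltW x0.
rewrite !lapr_add // -E // -E' //; ring.
Qed.

Lemma is_lapN g : is_lap g -> is_lap (fun x => - g x).
Proof. by move=> [m1 [m2 E]]; exists m2, m1 => x x0; rewrite -E // opprB. Qed.

Lemma is_lapM g h : is_lap g -> is_lap h -> is_lap (fun x => g x * h x).
Proof.
move=> [m1 [m2 E]] [k1 [k2 E']].
have [p11 h11] := lapr_conv m1 k1; have [p22 h22] := lapr_conv m2 k2.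
have [p12 h12] := lapr_conv m1 k2; have [p21 h21] := lapr_conv m2 k1.
exists (madd p11 p22), (madd p12 p21) => x x0; have x0' := ltW x0.
rewrite !lapr_add // h11 // h22 // h12 // h21 // -E // -E' //; ring.
Qed.

Lemma is_lap_of m : is_lap (lapr m).
Proof. by have [z hz] := @lapr_cst R 0 (lexx 0); exists m, z => x x0; rewrite hz ?(ltW x0) // subr0. Qed.

Lemma is_lap_cst (c : R) : 0 <= c -> is_lap (fun=> c).
Proof.
move=> /lapr_cst[m hm]; apply: is_lap_eq (is_lap_of m) => x x0; exact: hm (ltW x0).
Qed.

Lemma is_lap_exp_dist (l : R) : 0 < l -> is_lap (fun x => l / (l + x)).
Proof.
move=> l0; apply: is_lap_eq (is_lap_of (exp_dist l0)) => x x0; exact: lapr_exp_dist (ltW x0).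
Qed.

End LaplaceAlgebra.

Section StieltjesMeasure.
Variable R : realType.
Local Notation mR := (measurableTypeR R).
Implicit Types (m : {finite_measure set mR -> \bar R}).

Lemma integral_Rplus (mu : {measure set mR -> \bar R}) (g : mR -> R) :
  (\int[mu]_(t in Rplus R) (g t)%:E = \int[mu]_t (if 0 <= t then g t else 0)%:E)%E.
Proof.
rewrite integral_mkcond; apply: eq_integral => s _; rewrite patchE.
rewrite (_ : (s \in Rplus R) = (0 <= s)); first by case: ifP.
by apply/idP/idP; rewrite ?inE /Rplus /= in_itv /= andbT.
Qed.

Lemma measurable_inv_affine (x : R) : 0 < x ->
  measurable_fun setT (fun t : mR => if 0 <= t then (x + t)^-1 else 0).
Proof.
move=> x0.
have -> : (fun t : mR => if 0 <= t then (x + t)^-1 else 0) =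
    (fun t => if 0 <= t then expR (- ln (x + t)) else 0).
  apply: funext => t; case: ifP => // t0.
  by rewrite expRN lnK // posrE ltr_wpDr.
apply: measurable_fun_if => //; first exact: measurable_ge0.
apply: measurable_funTS; apply: measurableT_comp; first exact: measurable_expR.
apply: measurableT_comp => //; apply: measurableT_comp; first exact: measurable_ln.
exact: measurable_funD.
Qed.

(** The weight 1 / (1 + tau) is absorbed into the measure, which becomes finite. *)
Lemma finite_stieltjes_measure (mu : {measure set mR -> \bar R}) :
  (\int[mu]_(tau in Rplus R) ((1 + tau)^-1)%:E < +oo)%E ->
  exists k : {finite_measure set mR -> \bar R}, forall x : R, 0 < x ->
    (\int[mu]_(tau in Rplus R) ((x + tau)^-1)%:E =
     \int[k]_(tau in Rplus R) ((1 + tau) / (tau + x))%:E)%E.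
Proof.
move=> hfin; pose w (t : mR) : R := if 0 <= t then (1 + t)^-1 else 0.
have w0 t : 0 <= w t.
  by rewrite /w; case: ifP => // t0; rewrite invr_ge0 addr_ge0.
have mw : measurable_fun setT w by exact: measurable_inv_affine.
have kfin : (dens_measure mu w0 mw setT < +oo)%E.
  have -> : (dens_measure mu w0 mw setT = \int[mu]_t (w t)%:E)%E by [].
  by rewrite -integral_Rplus.
exists (fmeas_measure kfin) => x x0.
have -> : (\int[fmeas_measure kfin]_(tau in Rplus R) ((1 + tau) / (tau + x))%:E =
  \int[dens_measure mu w0 mw]_(tau in Rplus R) ((1 + tau) / (tau + x))%:E)%E by [].
rewrite !integral_Rplus ge0_integral_dens; last 2 first.
- apply/measurable_EFinP.
  have -> : (fun t : mR => if 0 <= t then (1 + t) / (t + x) else 0) =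
     (fun t : mR => (1 + t) * (if 0 <= t then (x + t)^-1 else 0)).
    by apply: funext => t; case: ifP => _; rewrite ?mulr0 // (addrC t).
  apply: measurable_funM; last exact: measurable_inv_affine.
  exact: measurable_funD.
- move=> t; rewrite lee_fin; case: ifP => // t0.
  by rewrite divr_ge0 // addr_ge0 // ltW.
apply: eq_integral => t _; rewrite -EFinM /w; congr (_%:E); case: ifP => t0; last by rewrite mulr0.
have h1 : 1 + t != 0 by rewrite lt0r_neq0 // ltr_wpDr.
by rewrite mulrAC divff // mul1r addrC.
Qed.

(** The factor x / (l + x) turns f into the Laplace transform of a signed measure:
    with P = tau / (x + tau) and Q = l / (l + x), the kernel of f becomes
    x / (l + x) * (1 + tau) / (x + tau) = (1 - P) Q / l + P (1 - Q),
    and P integrates to a Laplace transform by lapr_mix. *)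
Lemma stieltjes_repr (f : R -> R) : stieltjes f ->
  exists (a : R) (k : {finite_measure set mR -> \bar R}), [/\ 0 <= a,
    forall x, 0 < x -> 0 <= f x /\ stt k a x%:C = (f x)%:C
  & forall l, 0 < l -> is_lap (fun x => x / (l + x) * f x)].
Proof.
move=> [a [mu [a0 hfin hf]]].
have [k hk] := finite_stieltjes_measure hfin; exists a, k.
have away_x (x : R) : 0 < x -> exists2 c, 0 < c & away c x%:C.
  by move=> x0; apply: awayP => //=; [exact: ltW|rewrite (inj_eq (@complexI R)) lt0r_neq0].
have inv_real (x t : R) : (t%:C + x%:C)^-1 = ((t + x)^-1)%:C by rewrite fmorphV rmorphD.
have tx (x t : R) : 0 < x -> 0 <= t -> 0 < t + x by move=> x0 t0; rewrite ltr_wpDl.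
have st x : 0 < x -> exists2 r : R,
    (\int[k]_(t in Rplus R) ((1 + t) / (t + x))%:E = r%:E)%E & f x = a + r /\ stt k a x%:C = (f x)%:C.
  move=> x0; have [c c0 hc] := away_x x x0.
  have hb : bcont (fun t => ((1 + t) / (t + x))%:C : R[i]^o).
    have := bcont_stk c0 hc; rewrite /stk.
    by under [X in bcont X]eq_fun do rewrite inv_real -rmorphM.
  have [|r E1 E2] := bochner_ge0 k hb.
    by move=> t t0; rewrite divr_ge0 ?addr_ge0 // ltW.
  exists r => //; have fE : f x = a + r by apply: EFin_inj; rewrite hf // hk // E1.
  split=> //; rewrite fE rmorphD /stt.
  have -> : stk x%:C = (fun t => ((1 + t) / (t + x))%:C : R[i]^o).
    by apply: funext => t; rewrite /stk inv_real -rmorphM.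
  by congr (_ + _); exact: E2.
split=> //.
  move=> x x0; have [r E1 [E2 E3]] := st x x0; split=> //.
  rewrite E2 addr_ge0 // -lee_fin -E1; apply: integral_ge0 => t.
  by rewrite /Rplus /= in_itv /= andbT => t0; rewrite lee_fin divr_ge0 ?addr_ge0 // ltW.
move=> l l0; have [m hm] := lapr_mix k.
pose K := fine (k (Rplus R)).
have K0 : 0 <= K by exact: fine_ge0.
have l1 : 0 <= l^-1 by rewrite invr_ge0 ltW.
have hQ := is_lap_exp_dist l0.
have hQl := is_lapM hQ (is_lap_cst l1).
have h1Q := is_lapD (is_lap_cst ler01) (is_lapN hQ).
have hp := is_lap_of m.
have H := is_lapD (is_lapM (is_lap_cst a0) h1Q) (is_lapD (is_lapM (is_lap_cst K0) hQl)
   (is_lapM hp (is_lapD h1Q (is_lapN hQl)))).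
apply: is_lap_eq H => x x0 /=.
have [r E1 [E2 _]] := st x x0.
have mD : measurable (Rplus R : set mR) by exact: measurable_itv.
have mi : measurable_fun (Rplus R : set mR) (fun t : mR => (t + x)^-1).
  have := measurable_funTS (D := Rplus R) (measurable_inv_affine x0).
  apply: eq_measurable_fun => t; rewrite inE /Rplus /= in_itv /= andbT => ->.
  by rewrite addrC.
have mq (c : R) : measurable_fun (Rplus R : set mR) (fun t : mR => ((c + t) / (t + x))%:E).
  apply/measurable_EFinP; apply: measurable_funM => //.
  by apply: measurable_funTS; exact: measurable_funD.
(* x (1 + t) / (t + x) + t / (t + x) = 1 + x t / (t + x), integrated *)
have key : x * r + lapr m x = K + x * lapr m x.
  apply: EFin_inj; rewrite !EFinD !EFinM hm // -E1.
  have -> : K%:E = (\int[k]_(t in Rplus R) 1%:E)%E.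
    have -> : (\int[k]_(t in Rplus R) 1%:E = 1%:E * k (Rplus R))%E := integral_cst k mD 1%:E.
    by rewrite mul1e /K fineK // fin_num_measure.
  have mq0 : measurable_fun (Rplus R : set mR) (fun t : mR => (t / (t + x))%:E).
    by have := mq 0; under eq_fun do rewrite add0r.
  have S0 t : Rplus R t -> (0 <= ((1 + t) / (t + x))%:E)%E.
    by rewrite /Rplus /= in_itv /= andbT => t0; rewrite lee_fin divr_ge0 ?addr_ge0 // ltW.
  have P0 t : Rplus R t -> (0 <= (t / (t + x))%:E)%E.
    by rewrite /Rplus /= in_itv /= andbT => t0; rewrite lee_fin divr_ge0 // addr_ge0 // ltW.
  have x0E : (0 <= x%:E)%E by rewrite lee_fin ltW.
  have Z1 : (x%:E * \int[k]_(t in Rplus R) ((1 + t) / (t + x))%:E =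
      \int[k]_(t in Rplus R) (x%:E * ((1 + t) / (t + x))%:E))%E.
    by rewrite ge0_integralZl_EFin // ltW.
  have Z2 : (x%:E * \int[k]_(t in Rplus R) (t / (t + x))%:E =
      \int[k]_(t in Rplus R) (x%:E * (t / (t + x))%:E))%E.
    by rewrite ge0_integralZl_EFin // ltW.
  have I1 : (\int[k]_(t in Rplus R) (x%:E * ((1 + t) / (t + x))%:E) +
      \int[k]_(t in Rplus R) (t / (t + x))%:E =
      \int[k]_(t in Rplus R) (x%:E * ((1 + t) / (t + x))%:E + (t / (t + x))%:E))%E.
    rewrite ge0_integralD // => [t Dt|]; first exact: mule_ge0 x0E (S0 t Dt).
    exact: measurable_funeM.
  have I2 : (\int[k]_(t in Rplus R) 1%:E + \int[k]_(t in Rplus R) (x%:E * (t / (t + x))%:E) =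
      \int[k]_(t in Rplus R) (1%:E + x%:E * (t / (t + x))%:E))%E.
    rewrite ge0_integralD // => [t Dt|]; first exact: mule_ge0 x0E (P0 t Dt).
    exact: measurable_funeM.
  rewrite Z1 Z2 I1 I2; apply: eq_integral => t; rewrite inE /Rplus /= in_itv /= andbT => t0.
  rewrite -!EFinM -!EFinD; congr (_%:E); field; exact: lt0r_neq0 (tx x t x0 t0).
rewrite E2; have xl : l + x != 0 by rewrite lt0r_neq0 // addr_gt0.
have ln0 : l != 0 by exact: lt0r_neq0.
have -> : r = (K + x * lapr m x - lapr m x) / x.
  by rewrite -key addrK mulrAC divff ?mul1r // lt0r_neq0.
by field; rewrite xl ln0 lt0r_neq0.
Qed.

End StieltjesMeasure.

(** * The regularizer and the regularized function *)

Section Regularizer.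
Variable R : realType.
Local Notation mR := (measurableTypeR R).
Local Notation limC := (@complex_has_limits R).
Implicit Types (m : {finite_measure set mR -> \bar R}) (z : R[i]).

Definition delta0 : {finite_measure set mR -> \bar R} := \d_(0 : mR).

Lemma bochner_delta0 (V : normedModType R[i]) (limV : has_limits V) (phi : R -> V) : bcont phi ->
  bochner_integral delta0 (Rplus R) phi = phi 0.
Proof.
move=> hphi; apply: (cvg_eqP (rsum_cvg1 limV delta0 hphi) (cvg_cst (phi 0))) => n.
have d0 : 0 < mesh (1 : R) n by exact: mesh_gt0.
rewrite /rsum /mesh_num mulSn addSn big_ord_recl big1 ?addr0 /=.
  rewrite mul0r mul1r /delta0 /= indicE mem_set ?scale1r //=.
  by rewrite in_itv /= lexx.
move=> k _; rewrite /delta0 /= indicE memNset ?scale0r //= in_itv /= => /andP[h _].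
by move: h; rewrite leNgt mulr_gt0 // ltr0n.
Qed.

(** The Laplace transform of reg_pos - reg_neg is 1 + 1 / (1 + z) - 4 / (2 + z)
    = z^2 / ((1 + z) (2 + z)). *)
Definition reg_pos := madd delta0 (exp_dist (@ltr01 R)).
Definition reg_neg := madd (exp_dist (ltr0n R 2)) (exp_dist (ltr0n R 2)).
Definition regf z : R[i] := z / (1 + z) * (z / (2 + z)).

Lemma lap_madd m1 m2 z : 0 <= complex.Re z -> lap (madd m1 m2) z = lap m1 z + lap m2 z.
Proof. by move=> z0; have E := bochner_madd m1 m2 limC (bcont_cexp z0); exact: E. Qed.

Lemma lap_reg z : 0 <= complex.Re z -> lap reg_pos z - lap reg_neg z = regf z.
Proof.
move=> z0; rewrite !lap_madd // !lap_exp_dist //.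
have -> : lap delta0 z = 1.
  rewrite /lap bochner_delta0; [by rewrite mul0r oppr0 cexp0|exact: limC|exact: bcont_cexp].
have n1 := Re_ge0_addl_neq0 (@ltr01 R) z0; have n2 := Re_ge0_addl_neq0 (ltr0n R 2) z0.
have E2 : (2%:R : R)%:C = 2 by rewrite rmorph_nat.
rewrite E2 /= in n2 *; rewrite /regf; move: n1 n2; rewrite (rmorph1 (@real_complex R)) => n1 n2.
by field; rewrite n1 n2.
Qed.

(** The product of the representations of f1 and f2 given by stieltjes_repr with
    l = 1 and l = 2 represents regf f on the positive real axis; then
    identity_closed applies. It also identifies F with the product of the two
    Stieltjes transforms at i eta, where stt_lower bounds each of them. *)
Lemma regularized (f : R -> R) (F : R[i] -> R[i]) :
  stieltjes_prod2 f -> analytic_extension f F ->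
  exists m1 m2, (forall z, 0 < complex.Re z -> lap m1 z - lap m2 z = regf z * F z) /\
    forall eta : R, eta != 0 ->
      lap m1 (eta%:C * 'i%C) - lap m2 (eta%:C * 'i%C) = regf (eta%:C * 'i%C) * F (eta%:C * 'i%C) /\
      0 <= f `|eta| <= 4 * cabs (F (eta%:C * 'i%C)).
Proof.
move=> [f1 [f2 [hf1 hf2 hf]]] [hF1 hF2].
have [a1 [k1 [a10 hs1 hl1]]] := stieltjes_repr hf1.
have [a2 [k2 [a20 hs2 hl2]]] := stieltjes_repr hf2.
have dF z : slit_plane R z -> exists D, cdiff F z D by move=> /hF1 /derivable_cdiff.
have slit_pos z : 0 < complex.Re z -> slit_plane R z by move=> z0 [_]; rewrite leNgt z0.
have dS m a z : 0 < complex.Re z -> exists D, cdiff (stt m a) z D.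
  move=> z0; apply: stt_cdiff; first exact: ltW.
  by apply/negP => /eqP E; move: z0; rewrite E ltxx.
have [m1 [m2 hm]] := is_lapM (hl1 1 ltr01) (hl2 2 (ltr0n R 2)).
have dL p q z : 0 < complex.Re z -> exists D, cdiff (fun z => lap p z - lap q z) z D.
  move=> z0; have [D hD] := lap_cdiff p z0; have [D' hD'] := lap_cdiff q z0.
  by exists (D - D'); exact: cdiffB.
have dM (g h : R[i] -> R[i]) : (forall z, 0 < complex.Re z -> exists D, cdiff g z D) ->
    (forall z, 0 < complex.Re z -> exists D, cdiff h z D) ->
    forall z, 0 < complex.Re z -> exists D, cdiff (fun z => g z * h z) z D.
  move=> hg hh z z0; have [D hD] := hg z z0; have [D' hD'] := hh z z0.
  by eexists; exact: cdiffM hD hD'.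
have cL p q z : 0 <= complex.Re z ->
    lap p (z + x%:C) - lap q (z + x%:C) @[x --> (0 : R)^'+] --> (lap p z - lap q z : R[i]^o).
  move=> z0; apply: (@vcvgB R (R[i]^o) _ _ _ (fun x : R => lap p (z + x%:C)) (fun x : R => lap q (z + x%:C)));
      exact: lap_right_cts.
have cF z : slit_plane R z -> F (z + x%:C) @[x --> (0 : R)^'+] --> (F z : R[i]^o).
  by move=> /dF[D hD]; apply: (cdiff_cvg _ hD); exact: cvg_right_shift.
have key z : 0 <= complex.Re z -> slit_plane R z -> lap m1 z - lap m2 z = regf z * F z.
  move=> z0 zs; rewrite -lap_reg //; have z0' := z0.
  apply: (identity_closed (G := fun z => lap m1 z - lap m2 z)
    (H := fun z => (lap reg_pos z - lap reg_neg z) * F z)) z0 _ _.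
  - exact: dL.
  - by apply: dM; [exact: dL|move=> w /slit_pos; exact: dF].
  - move=> x x0; have x0' := ltW x0.
    rewrite (proj2 (laprP m1 x0')) (proj2 (laprP m2 x0')) -rmorphB /= hm //.
    rewrite lap_reg //= hF2 // hf // /regf.
    have E2 : (2%:R : R)%:C = 2 by rewrite rmorph_nat.
    have -> : 1 + x%:C = (1 + x)%:C by rewrite rmorphD rmorph1.
    have -> : 2 + x%:C = (2 + x)%:C by rewrite rmorphD /= E2.
    by rewrite -!fmorphV -!rmorphM /= mulrACA.
  - exact: cL.
  - by apply: ccvgM; [exact: cL|exact: cF].
exists m1, m2; split; first by move=> z z0; apply: key; [exact: ltW|exact: slit_pos].
move=> eta e0; set z := eta%:C * 'i%C.
have Rz : complex.Re z = 0 by rewrite /z cReM /= mulr0 mul0r subr0.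
have Iz : complex.Im z = eta by rewrite /z cImM /= mulr1 mul0r addr0.
have z0 : 0 <= complex.Re z by rewrite Rz.
have zn : z != 0 by apply/negP => /eqP /(congr1 (@complex.Im R)); rewrite Iz /= => /eqP; rewrite (negbTE e0).
have zs : slit_plane R z by move=> [+ _]; rewrite Iz => /eqP; rewrite (negbTE e0).
split; first exact: key.
have cS m a : stt m a (z + x%:C) @[x --> (0 : R)^'+] --> (stt m a z : R[i]^o).
  by have [D hD] := stt_cdiff m a z0 zn; apply: (cdiff_cvg _ hD); exact: cvg_right_shift.
have -> : F z = stt k1 a1 z * stt k2 a2 z.
  have z0' := z0.
  apply: (identity_closed (G := F) (H := fun z => stt k1 a1 z * stt k2 a2 z)) z0 _ _.
  - by move=> w /slit_pos; exact: dF.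
  - by apply: dM; exact: dS.
  - by move=> x x0; rewrite hF2 // hf // rmorphM (proj2 (hs1 x x0)) (proj2 (hs2 x x0)).
  - exact: cF.
  - by apply: ccvgM; exact: cS.
have ae : 0 < `|eta| by rewrite normr_gt0.
have [p1 q1] := hs1 _ ae; have [p2 q2] := hs2 _ ae.
have b1 := stt_lower a10 e0 q1; have b2 := stt_lower a20 e0 q2.
rewrite hf // mulr_ge0 //= cabsM.
have -> : f1 `|eta| * f2 `|eta| = 4 * (f1 `|eta| / 2 * (f2 `|eta| / 2)) by field.
apply: ler_wpM2l; first exact: ler0n.
exact: (ler_pM (divr_ge0 p1 (ler0n R 2)) (divr_ge0 p2 (ler0n R 2)) b1 b2).
Qed.

End Regularizer.

(** * The semigroup, its generator and its functional calculus *)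

Section Bridge.
Variables (R : realType) (X : completeNormedModType R[i]).
Local Notation limX := (@complete_has_limits R X).
Local Notation mR := (measurableTypeR R).
Implicit Types (T : R -> X -> X) (A : set (X * X)) (M : R).

Lemma right_nearP (P : set R) : (\forall t \near (0 : R)^'+, P t) <->
  exists2 r : R, 0 < r & forall t, 0 < t -> t < r -> P t.
Proof.
split=> [[r /= r0 hr]|[r r0 hr]].
  exists r => // t t0 tr; apply: hr => //=; by rewrite sub0r normrN gtr0_norm.
exists r => // t /= tr t0; apply: hr => //; apply: le_lt_trans tr.
by rewrite sub0r normrN ler_norm.
Qed.

Lemma bounded_operator_lin (S : X -> X) : bounded_operator S ->
  (forall x y, S (x + y) = S x + S y) /\ (forall (c : R[i]) x, S (c *: x) = c *: S x).
Proof.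
move=> [hl _]; have hD x y : S (x + y) = S x + S y.
  by have := hl 1 x y; rewrite !scale1r.
split=> // c x; have S0 : S 0 = 0 by apply: (addrI (S 0)); rewrite -hD !addr0.
by have := hl c x 0; rewrite !addr0 S0 addr0.
Qed.

Lemma c0_semigroup_sg T : c0_semigroup T -> bounded_semigroup T -> exists2 M, 0 <= M & sg T M.
Proof.
move=> [h1 h2 h3 h4] [M hM].
have hT : sg T M.
  split.
  - move=> t t0; have [hD hZ] := bounded_operator_lin (h1 t t0).
    by split=> // x; exact: hM.
  - by move=> x; rewrite h2.
  - by move=> s t x s0 t0; rewrite h3.
  - move=> x e e0; have /cvg_rnormP/(_ e e0)/right_nearP[r r0 hr] := h4 x.
    exists r => // t; rewrite le_eqVlt => /predU1P[<- _|t0 tr]; first by rewrite h2 subrr rnorm0.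
    by rewrite rnorm_distC; exact: hr.
by have [K K0 hK] := sg_pos hT; exists K; [exact: ltW|].
Qed.

Lemma generatorP T (x y : X) : generator T (x, y) <-> gen T x y.
Proof.
split=> [/cvg_rnormP h e e0|h].
  have /right_nearP[r r0 hr] := h e e0; exists r => // t t0 tr.
  by rewrite rnorm_distC; exact: hr.
apply/cvg_rnormP => e e0; apply/right_nearP; have [r r0 hr] := h e e0.
by exists r => // t t0 tr; rewrite rnorm_distC; exact: hr.
Qed.

Lemma op_graphP T A (x y : X) : generator T = op_opp A -> (A (x, y) <-> gen T x (- y)).
Proof.
move=> hA; rewrite -generatorP hA /op_opp /op_scale /=; split=> [h|[z h]].
  by exists y => //; rewrite scaleN1r.
by rewrite scaleN1r => /oppr_inj ->.
Qed.

Lemma dense_range T A : generator T = op_opp A -> closure (op_ran A) = setT ->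
  forall (z : X) (e : R), 0 < e -> exists v w, gen T v w /\ rnorm (z - w) < e.
Proof.
move=> hA hran z e e0.
have : closure (op_ran A) (- z) by rewrite hran.
move=> /(_ [set x | rnorm (- z - x) < e])[|y [[x hx] /= hy]].
  by apply/nbhs_rnormP; exists e.
exists x, (- y); split; first exact: (proj1 (op_graphP x y hA)).
by rewrite -rnormN opprB addrC.
Qed.

(** A point i eta of the spectrum is an approximate eigenvalue: otherwise, by
    gen_onto, i eta - A would be invertible. *)
Lemma approx_eigenvector T M A (lam : R[i]) (d : R) : sg T M -> 0 <= M ->
  generator T = op_opp A -> spectrum A lam -> complex.Re lam = 0 -> 0 < d ->
  exists u w, [/\ rnorm u = 1, gen (twist T (complex.Im lam)) u w & rnorm w < d].
Proof.
move=> hT M0 hA hs Rl d0; set eta := complex.Im lam.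
have lamE : lam = eta%:C * 'i%C by rewrite {1}(complexRI lam) Rl rmorph0 add0r mulrC.
have hW := sg_twist eta hT.
apply: contrapT => hno; apply: hs.
have lb u w : gen (twist T eta) u w -> d * rnorm u <= rnorm w.
  move=> g; have [u0|un] := eqVneq (rnorm u) 0; first by rewrite u0 mulr0 rnorm_ge0.
  have u0 : 0 < rnorm u by rewrite lt_neqAle eq_sym un rnorm_ge0.
  rewrite leNgt; apply/negP => h; apply: hno.
  pose c : R[i] := (rnorm u)^-1%:C.
  have cn : cabs c = (rnorm u)^-1 by rewrite cabs_real ger0_norm // invr_ge0 ltW.
  have Sc : @lin_bounded R X X (fun x => c *: x) (cabs c).
    by split=> [x y|k x|x]; [exact: scalerDr|rewrite !scalerA mulrC|rewrite rnormZ].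
  exists (c *: u), (c *: w); split.
  - by rewrite rnormZ cn mulVf.
  - apply: (gen_lin hW Sc _ g) => t x t0.
    by have [h1 _ _ _] := hW; have [_ k _] := h1 t t0; rewrite k.
  - by rewrite rnormZ cn mulrC ltr_pdivrMr.
have ex y : exists v, gen (twist T eta) v y := gen_onto limX hW M0 d0 lb y.
pose S y := xget 0 [set v | gen (twist T eta) v y].
have hS y : gen (twist T eta) (S y) y.
  by rewrite /S; case: xgetP => [v -> //|no]; case: (ex y) => v /no.
have uniq_gen u v y : gen (twist T eta) u y -> gen (twist T eta) v y -> u = v.
  move=> g1 g2; apply/eqP; rewrite -subr_eq0; apply/eqP/rnorm_eq0/eqP.
  rewrite eq_le rnorm_ge0 andbT -(pmulr_rle0 _ d0).
  have := lb _ _ (gen_comb (-1) hW g1 g2); rewrite !scaleN1r subrr rnorm0; exact.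
have g0 : gen (twist T eta) 0 0.
  move=> e e0; exists 1 => // h h0 _; have [h1 _ _ _] := hW.
  by rewrite (lin_bounded0 (h1 h (ltW h0))) subrr scaler0 subrr rnorm0.
have SL : lin_bounded S d^-1.
  split.
  - move=> x y; apply: (uniq_gen _ _ (x + y)) => //.
    by have := gen_comb 1 hW (hS x) (hS y); rewrite !scale1r.
  - move=> c x; apply: (uniq_gen _ _ (c *: x)) => //.
    by have := gen_comb c hW g0 (hS x); rewrite !add0r.
  - by move=> x; rewrite mulrC ler_pdivlMr // mulrC; exact: lb.
exists S.
  split; first by move=> c x y; case: SL => -> -> _.
  move=> x; exact: (lin_bounded_cvg SL (@cvg_id _ (nbhs x))).
rewrite /op_sub -hA; apply/seteqP; split=> [[x y]|[x y] E]; last first.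
  have {E}-> : y = S x by exact: E.
  exists (lam *: S x), (x - lam *: S x); split=> /=.
  - by exists (S x).
  - by apply/generatorP; rewrite lamE; apply/(gen_twistE _ _ _ hT).
  - by rewrite addrC subrK.
move=> [y1 [y2 [[v Ev E1] /generatorP g E]]].
have {}Ev : v = y by exact: Ev.
have {}E1 : y1 = lam *: v by exact: E1.
have {}E : x = y1 + y2 by exact: E.
apply: (uniq_gen _ _ x) => //; apply/(gen_twistE _ _ _ hT).
by rewrite E E1 Ev lamE [_ + y2]addrC addrK.
Qed.

Section Calculus.
Variables (T : R -> X -> X) (M : R).
Hypotheses (hT : sg T M) (M0 : 0 <= M).
Implicit Types (m : {finite_measure set mR -> \bar R}).

Lemma hp_opE m1 m2 x : hp_op T (cm_diff m1 m2) x = sint m1 m2 (fun s => T s x).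
Proof. exact: cm_integral_diff limX _ _ _ (sg_bcont x hT). Qed.

Lemma hp_op_lin m1 m2 : exists2 K, 0 < K & lin_bounded (hp_op T (cm_diff m1 m2)) K.
Proof.
apply: (@lin_bounded_pos _ _ _ _ (M * fine (m1 (Rplus R)) + M * fine (m2 (Rplus R)))).
have [a1 a2 a3] := bochner_orbit_lin limX m1 hT.
have [b1 b2 b3] := bochner_orbit_lin limX m2 hT.
split=> [x y|c x|x]; rewrite !hp_opE /sint.
- by rewrite a1 b1 opprD addrACA.
- by rewrite a2 b2 scalerBr.
- by apply: (le_trans (rnormB _ _)); rewrite mulrDl; apply: lerD.
Qed.

Lemma hp_op_comm m1 m2 (S : X -> X) K x : lin_bounded S K ->
  (forall t z, 0 <= t -> S (T t z) = T t (S z)) ->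
  S (hp_op T (cm_diff m1 m2) x) = hp_op T (cm_diff m1 m2) (S x).
Proof.
move=> hS hc; rewrite !hp_opE (sint_lin limX limX _ _ hS (sg_bcont x hT)).
have cB (p : {finite_measure set mR -> \bar R}) :
  bochner_integral p (Rplus R) (fun s => S (T s x)) = bochner_integral p (Rplus R) (fun s => T s (S x)).
  apply: (cvg_eqP (rsum_cvg1 limX p (bcont_lin hS (sg_bcont x hT)))
    (rsum_cvg1 limX p (sg_bcont (S x) hT))) => n.
  rewrite /rsum; apply: eq_bigr => k _; rewrite hc // mulr_ge0 // ltW // mesh_gt0 //.
by rewrite /sint !cB.
Qed.

Lemma hp_op_sg m1 m2 t z : 0 <= t ->
  hp_op T (cm_diff m1 m2) (T t z) = T t (hp_op T (cm_diff m1 m2) z).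
Proof.
move=> t0; have [h1 _ h3 _] := hT; apply/esym/(hp_op_comm _ _ _ (h1 t t0)) => s x s0.
by rewrite -!h3 // addrC.
Qed.

Lemma hp_op_comm2 m1 m2 k1 k2 x :
  hp_op T (cm_diff k1 k2) (hp_op T (cm_diff m1 m2) x) =
  hp_op T (cm_diff m1 m2) (hp_op T (cm_diff k1 k2) x).
Proof.
have [K _ hK] := hp_op_lin k1 k2; apply: (hp_op_comm _ _ _ hK) => t z t0; exact: hp_op_sg.
Qed.

Lemma regularizer_inj : (forall z (e : R), 0 < e -> exists v w, gen T v w /\ rnorm (z - w) < e) ->
  injective (hp_op T (cm_diff (reg_pos R) (reg_neg R))).
Proof.
move=> hd x y E; have [K _ hK] := hp_op_lin (reg_pos R) (reg_neg R).
apply/eqP; rewrite -subr_eq0; apply/eqP.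
apply: (@regularizer_injective R X limX T M (@ltr01 R) (ltr0n R 2) _ hT M0 hd).
have : hp_op T (cm_diff (reg_pos R) (reg_neg R)) (x - y) = 0.
  by rewrite (lin_boundedB _ _ hK) E subrr.
have hb := sg_bcont (x - y) hT; have [_ h2 _ _] := hT.
rewrite hp_opE /sint (bochner_madd _ _ limX hb) (bochner_madd _ _ limX hb) (bochner_delta0 limX hb) h2.
have two (v : X) : 2 *: v = v + v by rewrite scaler_nat mulr2n.
by rewrite two.
Qed.

(** By sg_increment, T s u is within s M |w| of exp (- i s eta) u, and
    integrating the latter gives the Laplace transform at i eta. The total error
    is small uniformly in u by sint_small, even if the measures have no first
    moment. *)
Lemma hp_op_approx m1 m2 (eta e : R) : 0 < e -> exists2 d : R, 0 < d &
  forall u w, rnorm u = 1 -> gen (twist T eta) u w -> rnorm w <= d ->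
    rnorm (hp_op T (cm_diff m1 m2) u -
      (lap m1 (eta%:C * 'i%C) - lap m2 (eta%:C * 'i%C)) *: u) <= e.
Proof.
move=> e0; set z := eta%:C * 'i%C.
have z0 : 0 <= complex.Re z by rewrite /z cReM /= mulr0 mul0r subr0.
have C0 : 0 <= M + 1 by rewrite addr_ge0.
have [d d0 hd] := sint_small limX m1 m2 C0 e0.
exists (d / (M + 1)); first by rewrite divr_gt0 // ltr_wpDl.
move=> u w u1 g wd; have hW := sg_twist eta hT.
have Tu s : T s u = cexp (- (s%:C * z)) *: twist T eta s u.
  rewrite /twist scalerA -cexpD; have -> : (s * eta)%:C * 'i%C = s%:C * z by rewrite rmorphM /= mulrA.
  by rewrite addNr cexp0 scale1r.
have hu := sg_bcont u hT; have hc := bcont_cexp z0.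
have lu : @lin_bounded R (R[i]^o) X (fun c => c *: u) 1.
  split=> [a b|a b|a]; [exact: scalerDl|by rewrite scalerA|by rewrite rnormZ u1 mulr1 mul1r].
have hcu := bcont_lin lu hc.
have -> : (lap m1 z - lap m2 z) *: u = sint m1 m2 (fun s => cexp (- (s%:C * z)) *: u).
  exact: (sint_lin (@complex_has_limits R) limX m1 m2 lu hc).
rewrite hp_opE -(sintB limX m1 m2 hu hcu); apply: hd; first exact: bcontB.
  move=> t t0; apply: (le_trans (rnormB _ _)); apply: lerD.
    by have [h1 _ _ _] := hT; have [_ _ k] := h1 t t0; have := k u; rewrite u1 mulr1.
  by rewrite rnormZ u1 mulr1; exact: cabs_cexp_le1.
move=> t t0; rewrite Tu -scalerBr rnormZ.
apply: (@le_trans _ _ (1 * (t * (M * rnorm w)))).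
  apply: ler_pM; rewrite ?cabs_ge0 ?rnorm_ge0 //; first exact: cabs_cexp_le1.
  exact: sg_increment hW M0 g t0.
rewrite mul1r mulrC ler_wpM2r //.
apply: (@le_trans _ _ ((M + 1) * rnorm w)); first by rewrite ler_wpM2r ?rnorm_ge0 // lerDl.
by rewrite mulrC -ler_pdivlMr // ltr_wpDl.
Qed.

(** If z = u + t A u, then u = (1 + t A)^-1 z. *)
Lemma euler_error1 A (u w : X) (t : R) : A (u, - w) ->
  euler_error T A 1 t (u - t%:C *: w, u - T t (u - t%:C *: w)).
Proof.
move=> h; set z := u - t%:C *: w.
exists u, (- T t z); split=> //; last by exists (T t z); rewrite //= scaleN1r.
exists z => //; exists u, (- (t%:C *: w)); split=> //.
by exists (- w) => //; rewrite divr1 scalerN.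
Qed.

(** The Euler error at e z, for z = u + t A u, is e (u - T t z), because the
    regularizer e = e(A) commutes with the semigroup; and f(A) maps e v to (e
    f)(A) v. *)
Lemma calculus_pair A F m1 m2 n1 n2 (u w : X) (t : R) : generator T = op_opp A -> 0 <= t ->
  holomorphic_on (Cplus R) F -> regularizes T F (cm_diff m1 m2) (cm_diff n1 n2) -> gen T u w ->
  op_comp (hp_calculus T F) (euler_error T A 1 t)
    (hp_op T (cm_diff m1 m2) (u - t%:C *: w),
     hp_op T (cm_diff n1 n2) (u - T t (u - t%:C *: w))).
Proof.
move=> hA t0 hF hreg g.
have [K _ hK] := hp_op_lin m1 m2; have := hp_op_comm2 m1 m2 n1 n2.
have hc s x : 0 <= s -> hp_op T (cm_diff m1 m2) (T s x) = T s (hp_op T (cm_diff m1 m2) x).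
  exact: hp_op_sg.
have [N EN] : exists N, N = hp_op T (cm_diff n1 n2) by eexists.
have [H EH] : exists H, H = hp_op T (cm_diff m1 m2) by eexists.
rewrite -EN -EH in hK hc * => comm.
have hA' : A (H u, - H w).
  apply/(op_graphP _ _ hA); rewrite opprK.
  by apply: (gen_lin hT hK _ g) => s x s0; exact: hc.
have E x y (c : R[i]) : H (x - c *: y) = H x - c *: H y.
  by rewrite (lin_boundedB x (c *: y) hK); have [_ -> _] := hK.
have := euler_error1 t hA'; rewrite -E -hc // -(lin_boundedB _ _ hK).
move: (u - t%:C *: w) => z err.
exists (H (u - T t z)); first exact: err.
split; first exact: hF.
exists (cm_diff m1 m2), (cm_diff n1 n2); split; first exact: hreg.
rewrite -EN -EH; exists (N (H (u - T t z))); first exact: erefl.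
exact: comm.
Qed.

End Calculus.
End Bridge.

(** * The lower bound *)

Section LowerBound.
Variables (R : realType).
Local Notation mR := (measurableTypeR R).

(** y + t <= (1 + y / x) (x + t) for all t >= 0. *)
Lemma stieltjes_quasi_mono (f : R -> R) x y : stieltjes f -> 0 < x -> 0 < y ->
  f x <= (1 + y / x) * f y.
Proof.
move=> [a [mu [a0 _ hf]]] x0 y0; have yx : 0 <= y / x by rewrite divr_ge0 ?ltW.
have c0 : 0 <= 1 + y / x by rewrite addr_ge0.
have mi (z : R) : 0 < z -> measurable_fun (Rplus R : set mR) (fun t => (z + t)^-1).
  move=> z0; have := measurable_funTS (D := Rplus R) (measurable_inv_affine z0).
  by apply: eq_measurable_fun => t; rewrite inE /Rplus /= in_itv /= andbT => ->.
have pos (z : R) t : 0 < z -> (Rplus R) t -> 0 < z + t.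
  by move=> z0; rewrite /Rplus /= in_itv /= andbT => t0; rewrite ltr_wpDr.
have mD : measurable (Rplus R : set mR) by exact: measurable_itv.
have nn (z : R) : 0 < z -> forall t, Rplus R t -> (0 <= ((z + t)^-1)%:E)%E.
  by move=> z0 t Dt; rewrite lee_fin invr_ge0 ltW // pos.
have me (z : R) : 0 < z -> measurable_fun (Rplus R : set mR) (fun t => ((z + t)^-1)%:E).
  by move=> z0; apply/measurable_EFinP; exact: mi.
rewrite -lee_fin EFinM !hf // ge0_muleDr ?lee_fin ?integral_ge0 //; last exact: nn.
apply: leeD.
  by rewrite -EFinM lee_fin ler_peMl // lerDl.
have -> : ((1 + y / x)%:E * \int[mu]_(t in Rplus R) ((y + t)^-1)%:E =
    \int[mu]_(t in Rplus R) ((1 + y / x)%:E * ((y + t)^-1)%:E))%E.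
  by rewrite ge0_integralZl_EFin //; [exact: nn|exact: me].
apply: ge0_le_integral => //.
- exact: nn.
- exact: me.
- by apply: measurable_funeM; exact: me.
- move=> t Dt; have xt := pos _ _ x0 Dt; have yt := pos _ _ y0 Dt.
  rewrite -EFinM lee_fin ler_pdivlMr // mulrC ler_pdivrMr // mulrDl mul1r.
  move: Dt; rewrite /Rplus /= in_itv /= andbT => t0.
  rewrite mulrDr -mulrA mulVf ?lt0r_neq0 // mulr1.
  have := mulr_ge0 yx t0; lra.
Qed.

Lemma stieltjes_ge0 (f : R -> R) x : stieltjes f -> 0 < x -> 0 <= f x.
Proof.
move=> [a [mu [a0 _ hf]]] x0; rewrite -lee_fin hf // adde_ge0 ?lee_fin //.
apply: integral_ge0 => t; rewrite /Rplus /= in_itv /= andbT => t0.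
by rewrite lee_fin invr_ge0 addr_ge0 // ltW.
Qed.

Lemma stieltjes_prod2_gt0 (f : R -> R) x y : stieltjes_prod2 f -> 0 < x -> f x != 0 ->
  0 < y -> 0 < f y.
Proof.
move=> [f1 [f2 [h1 h2 hf]]] x0 fx y0.
have pos g : stieltjes g -> g x != 0 -> 0 < g y.
  move=> hg gx; have g0 : 0 < g x by rewrite lt_neqAle eq_sym gx stieltjes_ge0.
  have := lt_le_trans g0 (stieltjes_quasi_mono hg x0 y0).
  by rewrite pmulr_rgt0 // ltr_pwDl // divr_ge0 ?ltW.
move: fx; rewrite hf // mulf_eq0 negb_or => /andP[k1 k2].
by rewrite hf // mulr_gt0 ?pos.
Qed.

Lemma le_add_err (X : normedModType R[i]) (x v : X) (B e : R) :
  rnorm (x - v) <= e -> rnorm v <= B -> rnorm x <= B + e.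
Proof.
move=> h1 h2; have -> : x = v + (x - v) by rewrite addrC subrK.
by apply: (le_trans (rnormD _ _)); apply: lerD.
Qed.

Section Errors.
Variables (X : normedModType R[i]) (u w Tu Tw : X) (a c mu : R[i]) (t d e K M : R).
Hypotheses (t0 : 0 <= t) (K0 : 0 <= K) (a2 : cabs a <= 2) (wd : rnorm w <= d).

Lemma euler_input_error (H : X -> X) : lin_bounded H K -> rnorm (H u - mu *: u) <= e ->
  rnorm (H (a *: u - t%:C *: w) - (a * mu) *: u) <= 2 * e + t * (K * d).
Proof.
move=> hH he; have [hD hZ hb] := hH.
have -> : H (a *: u - t%:C *: w) - (a * mu) *: u = a *: (H u - mu *: u) - t%:C *: H w.
  by rewrite (lin_boundedB _ _ hH) !hZ scalerBr scalerA addrAC.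
apply: (le_trans (rnormB _ _)); rewrite !rnormZ cabs_real (ger0_norm t0).
apply: lerD; first by apply: ler_pM; rewrite ?cabs_ge0 ?rnorm_ge0.
by apply: ler_wpM2l => //; apply: (le_trans (hb w)); exact: ler_wpM2l.
Qed.

Lemma euler_output_error (N : X -> X) : lin_bounded N K -> rnorm (N u - mu *: u) <= e ->
  rnorm (Tu - c *: u) <= t * (M * d) -> rnorm Tw <= M * d -> cabs c <= 1 ->
  rnorm (N (u - (a *: Tu - t%:C *: Tw)) - ((1 - a * c) * mu) *: u) <=
    3 * e + K * (3 * (t * (M * d))).
Proof.
move=> hN he hTu hTw c1; have [hD hZ hb] := hN.
pose r := t%:C *: Tw - a *: (Tu - c *: u).
have E : u - (a *: Tu - t%:C *: Tw) = (1 - a * c) *: u + r.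
  rewrite /r scalerBl scale1r scalerBr scalerA.
  move: (a *: Tu) (t%:C *: Tw) ((a * c) *: u) => p q s.
  by rewrite !opprB (addrCA q) subrKA.
have -> : N (u - (a *: Tu - t%:C *: Tw)) - ((1 - a * c) * mu) *: u =
   (1 - a * c) *: (N u - mu *: u) + N r.
  by rewrite E hD hZ scalerBr scalerA addrAC.
have k3 : cabs (1 - a * c) <= 3.
  apply: (le_trans (cabsB _ _)); rewrite cabs1 cabsM.
  have : cabs a * cabs c <= 2 * 1 by apply: ler_pM; rewrite ?cabs_ge0.
  have -> : (3 : R) = 1 + 2 * 1 by rewrite mulr1.
  by move=> h; apply: lerD.
apply: (le_trans (rnormD _ _)); apply: lerD.
  by rewrite rnormZ; apply: ler_pM; rewrite ?cabs_ge0 ?rnorm_ge0.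
apply: (le_trans (hb r)); apply: ler_wpM2l => //.
apply: (le_trans (rnormB _ _)); rewrite !rnormZ cabs_real (ger0_norm t0).
have -> : 3 * (t * (M * d)) = t * (M * d) + 2 * (t * (M * d)) by ring.
apply: lerD; first exact: ler_wpM2l.
by apply: ler_pM; rewrite ?cabs_ge0 ?rnorm_ge0.
Qed.

End Errors.

Lemma cabs_sqrt2_bound (a : R[i]) : cabs a ^+ 2 = 2 -> 5 / 4 <= cabs a <= 2.
Proof.
move=> h; have a0 := cabs_ge0 a; rewrite -(@ler_pXn2r _ 2) ?nnegrE // h.
by rewrite -[X in _ && X](@ler_pXn2r _ 2) ?nnegrE // h; apply/andP; split; lra.
Qed.

Lemma cabs_one_sub_lb (w : R[i]) : 5 / 4 <= cabs w -> 1 / 4 <= cabs (1 - w).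
Proof.
move=> h; have := cabsB 1 (1 - w); rewrite cabs1 opprB addrC subrK => k; lra.
Qed.

Lemma sixth_half (p q : R) : 0 <= p -> q <= p / 2 ->
  2 * (p / 6) + q <= p /\ 3 * (p / 6) + q <= p.
Proof. by move=> *; split; lra. Qed.

Variable X : completeNormedModType R[i].

(** On an approximate eigenvector u, the pair of calculus_pair is close to
    (a e u, (1 - a c) e f u), where a = 1 + i t eta, c = exp (- i t eta), and e and
    f stand for their values at i eta. As |t eta| = 1, |a c| = |a| is the square
    root of 2, so that |1 - a c| >= 1 / 4. With |f (i eta)| >= f (|eta|) / 4 the
    quotient of the two norms is at least f (|eta|) / 32, and the errors are
    allowed to spoil this to f (|eta|) / 96. *)
Lemma calculus_norm_lower (T : R -> X -> X) M (A : set (X * X)) (f : R -> R) (F : R[i] -> R[i])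
    (lam : R[i]) : sg T M -> 0 <= M -> generator T = op_opp A ->
  (forall z (e : R), 0 < e -> exists v w, gen T v w /\ rnorm (z - w) < e) ->
  stieltjes_prod2 f -> analytic_extension f F -> spectrum A lam -> complex.Re lam = 0 ->
  complex.Im lam != 0 -> 0 < f `|complex.Im lam| ->
  ((f `|complex.Im lam| / 96)%:E <=
    op_norm (op_comp (hp_calculus T F) (euler_error T A 1 (`|complex.Im lam|^-1))))%E.
Proof.
move=> hT M0 hA hd hf hF hs Rl; set eta := complex.Im lam => e0 fe0.
have [n1 [n2 [hn hv]]] := regularized hf hF.
have hhol : holomorphic_on (Cplus R) F.
  by move=> z z0; have [h _] := hF; apply: h => -[_]; rewrite leNgt z0.
have hreg : regularizes T F (cm_diff (reg_pos R) (reg_neg R)) (cm_diff n1 n2).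
  split; first exact: regularizer_inj hT M0 hd.
  move=> z z0; have z0' : 0 <= complex.Re z by exact: ltW.
  have L1 := etrans (laplace_diff (reg_pos R) (reg_neg R) z0') (lap_reg z0').
  exact: etrans (laplace_diff n1 n2 z0') (etrans (hn z z0) (congr1 (fun v => v * F z) (esym L1))).
have [hval /andP[_ fF]] := hv eta e0.
set z := eta%:C * 'i%C in hval fF.
have Rz : complex.Re z = 0 by rewrite /z cReM /= mulr0 mul0r subr0.
have Iz : complex.Im z = eta by rewrite /z cImM /= mulr1 mul0r addr0.
have z0 : 0 <= complex.Re z by rewrite Rz.
have hmu := lap_reg z0.
set mu := regf z in hmu hval; set nu := mu * F z in hval.
have zn : z != 0.
  by apply/negP => /eqP /(congr1 (@complex.Im R)); rewrite Iz /= => /eqP; rewrite (negbTE e0).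
have mun : mu != 0.
  have k1 : 1 + z != 0 := Re_ge0_addl_neq0 (@ltr01 R) z0.
  have k2 : 2 + z != 0.
    by have := Re_ge0_addl_neq0 (ltr0n R 2) z0; rewrite rmorph_nat.
  exact: (mulf_neq0 (mulf_neq0 zn (invr_neq0 k1)) (mulf_neq0 zn (invr_neq0 k2))).
have E0 : 0 < cabs mu := cabs_gt0 mun.
set E := cabs mu in E0; set fe := f `|eta| in fe0 fF *.
have nuE : E * fe / 4 <= cabs nu.
  rewrite /nu cabsM -/E -mulrA; apply: ler_wpM2l; first exact: ltW.
  by rewrite ler_pdivrMr // mulrC.
(* x is then of norm at most 3 E, and y of norm at least E fe / 32 *)
pose ep := Num.min E (E * fe / 32).
have ep0 : 0 < ep by rewrite lt_min E0 divr_gt0 // mulr_gt0.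
have ep6 : 0 < ep / 6 by rewrite divr_gt0.
have [dm dm0 hdm] := hp_op_approx hT M0 (reg_pos R) (reg_neg R) eta ep6.
have [dn dn0 hdn] := hp_op_approx hT M0 n1 n2 eta ep6.
have [Km Km0 hKm] := hp_op_lin hT (reg_pos R) (reg_neg R).
have [Kn Kn0 hKn] := hp_op_lin hT n1 n2.
set t := `|eta|^-1; have ae0 : 0 < `|eta| by rewrite normr_gt0.
have t0 : 0 < t by rewrite invr_gt0.
pose B := t * Km + Kn * (3 * (t * M)) + 1.
have b1 : 0 <= t * Km by rewrite mulr_ge0 ?ltW.
have b2 : 0 <= Kn * (3 * (t * M)) by rewrite !mulr_ge0 // ltW.
have B0 : 0 < B by rewrite ltr_wpDl // addr_ge0.
pose d := Num.min (Num.min dm dn) (ep / 2 / B).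
have d0 : 0 < d by rewrite !lt_min dm0 dn0 !divr_gt0.
have [u [w0 [u1 g wd']]] := approx_eigenvector hT M0 hA hs Rl d0.
have wd := ltW wd'; have ddm : d <= dm by rewrite !ge_min lexx.
have ddn : d <= dn by rewrite !ge_min lexx orbT.
have dB : B * d <= ep / 2.
  apply: (@le_trans _ _ (B * (ep / 2 / B))); first by rewrite ler_pM2l // ge_min lexx orbT.
  by rewrite mulrC divfK // lt0r_neq0.
have hm := hdm u w0 u1 g (le_trans wd ddm); have hn' := hdn u w0 u1 g (le_trans wd ddn).
rewrite -/z hmu in hm; rewrite -/z hval in hn'.
have gT : gen T u (w0 - z *: u) by apply/(gen_twistE _ _ _ hT).
pose a : R[i] := 1 + (t * eta)%:C * 'i%C.
have a_sq : cabs a ^+ 2 = 2.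
  rewrite cabs_sq /a !(cReD, cImD, cReM, cImM) /= !(mulr0, mul0r, mulr1, subr0, addr0, add0r).
  rewrite expr1n exprMn -(real_normK (num_real eta)) -exprMn /t mulVf ?lt0r_neq0 // expr1n //.
have /andP[a54 a2] := cabs_sqrt2_bound a_sq.
pose c : R[i] := cexp (- (t%:C * z)).
have c1 : cabs c = 1 by rewrite cabs_cexp cReN cReM Rz /= mulr0 mul0r subr0 oppr0 expR0.
have uw : u - t%:C *: (w0 - z *: u) = a *: u - t%:C *: w0.
  rewrite /a scalerDl scale1r scalerBr opprB scalerA /z mulrA -rmorphM /=.
  by rewrite addrA.
have [h1 _ _ _] := hT; have [tD tZ tb] := h1 t (ltW t0).
have Tuw : T t (a *: u - t%:C *: w0) = a *: T t u - t%:C *: T t w0.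
  by rewrite (lin_boundedB _ _ (h1 t (ltW t0))) !tZ.
have errx := euler_input_error (ltW t0) (ltW Km0) a2 wd hKm hm.
have hTu : rnorm (T t u - c *: u) <= t * (M * d).
  have -> : T t u = c *: twist T eta t u.
    rewrite /twist scalerA -cexpD; have -> : (t * eta)%:C * 'i%C = t%:C * z by rewrite rmorphM /= mulrA.
    by rewrite addNr cexp0 scale1r.
  rewrite -scalerBr rnormZ c1 mul1r.
  apply: (le_trans (sg_increment (sg_twist eta hT) M0 g (ltW t0))).
  by rewrite ler_pM2l // ler_wpM2l.
have hTw : rnorm (T t w0) <= M * d by apply: (le_trans (tb w0)); rewrite ler_wpM2l.
have c1' : cabs c <= 1 by rewrite c1.
have erry := euler_output_error (ltW t0) (ltW Kn0) a2 hKn hn' hTu hTw c1'.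
rewrite -uw in errx; rewrite -Tuw -uw in erry.
pose x := hp_op T (cm_diff (reg_pos R) (reg_neg R)) (u - t%:C *: (w0 - z *: u)).
pose y := hp_op T (cm_diff n1 n2) (u - T t (u - t%:C *: (w0 - z *: u))).
rewrite -/x in errx; rewrite -/y in erry.
have ex : 2 * (ep / 6) + t * (Km * d) <= ep.
  have q1 : t * (Km * d) <= B * d.
    by rewrite mulrA; apply: ler_wpM2r; [exact: ltW|rewrite /B -addrA lerDl addr_ge0].
  exact: proj1 (sixth_half (ltW ep0) (le_trans q1 dB)).
have ey : 3 * (ep / 6) + Kn * (3 * (t * (M * d))) <= ep.
  have q1 : Kn * (3 * (t * (M * d))) <= B * d.
    have -> : Kn * (3 * (t * (M * d))) = Kn * (3 * (t * M)) * d by ring.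
    by apply: ler_wpM2r; [exact: ltW|rewrite /B addrAC lerDr addr_ge0].
  exact: proj2 (sixth_half (ltW ep0) (le_trans q1 dB)).
have x3 : rnorm x <= 3 * E.
  have hb : rnorm ((a * mu) *: u) <= 2 * E.
    by rewrite rnormZ u1 mulr1 cabsM; apply: ler_wpM2r => //; exact: ltW.
  apply: (le_trans (le_add_err (le_trans errx ex) hb)).
  have : ep <= E by rewrite ge_min lexx.
  by move=> h; rewrite (_ : 3 * E = 2 * E + E) ?lerD2l //; ring.
have y32 : E * fe / 32 <= rnorm y.
  have k4 : 1 / 4 <= cabs (1 - a * c) by apply: cabs_one_sub_lb; rewrite cabsM c1 mulr1.
  have hl := rnorm_lb (((1 - a * c) * nu) *: u) (((1 - a * c) * nu) *: u - y).
  have EE : ((1 - a * c) * nu) *: u - (((1 - a * c) * nu) *: u - y) = y by rewrite opprB addrC subrK.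
  rewrite EE rnorm_distC rnormZ u1 mulr1 cabsM in hl.
  have k5 : 1 / 4 * (E * fe / 4) <= cabs (1 - a * c) * cabs nu.
    have q1 : 0 <= E * fe / 4 by rewrite divr_ge0 // mulr_ge0 // ltW.
    have q2 : 0 <= 1 / 4 :> R by rewrite divr_ge0.
    exact: (ler_pM q2 q1 k4 nuE).
  have k6 : ep <= E * fe / 32 by rewrite ge_min lexx orbT.
  have k7 := le_trans erry ey.
  have k8 : 1 / 4 * (E * fe / 4) = E * fe / 32 + E * fe / 32 by field.
  rewrite k8 in k5; clear - hl k5 k6 k7.
  move: (E * fe / 32) hl k5 k6 k7 => q; move: (rnorm (y - _)) => r; move: (cabs _ * cabs _) => s.
  move=> hl k5 k6 k7; lra.
(* the scaling that brings x into the unit ball *)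
pose k : R := (3 * E)^-1.
have k0 : 0 < k by rewrite invr_gt0 mulr_gt0.
have Sc : @lin_bounded R X X (fun x => k%:C *: x) (cabs k%:C).
  by split=> [p q|b p|p]; [exact: scalerDr|rewrite !scalerA mulrC|rewrite rnormZ].
have gk : gen T (k%:C *: u) (k%:C *: (w0 - z *: u)).
  apply: (gen_lin hT Sc _ gT) => s v s0.
  by have [_ sZ _] := h1 s s0; rewrite sZ.
have hp := calculus_pair hT hA (ltW t0) hhol hreg gk.
have [_ mZ _] := hKm; have [_ nZ _] := hKn.
have Ek : k%:C *: u - t%:C *: (k%:C *: (w0 - z *: u)) = k%:C *: (u - t%:C *: (w0 - z *: u)).
  by rewrite [RHS]scalerBr !scalerA [_ * k%:C]mulrC.
rewrite Ek tZ -scalerBr mZ nZ -/x -/y in hp.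
have nk (v : X) : rnorm (k%:C *: v) = k * rnorm v by rewrite rnormZ cabs_real ger0_norm // ltW.
apply: (@le_trans _ _ (rnorm (k%:C *: y))%:E).
  rewrite lee_fin nk; have -> : fe / 96 = k * (E * fe / 32).
    by rewrite /k; field; rewrite lt0r_neq0.
  by rewrite ler_pM2l.
apply: ereal_sup_ubound; exists (k%:C *: x, k%:C *: y) => //; split; first exact: hp.
by rewrite /= nk /k mulrC ler_pdivrMr ?mul1r // mulr_gt0.
Qed.

End LowerBound.

Theorem theorem6p5 (R : realType) (X : completeNormedModType R[i])
    (T : R -> X -> X) (A : set (X * X)) (f : R -> R) (F : R[i] -> R[i])
    (hT : c0_semigroup T) (hTb : bounded_semigroup T)
    (hA : generator T = op_opp A)
    (hran : closure (op_ran A) = setT)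
    (hspec : forall M : R, exists2 lam, spectrum A lam &
       complex.Re lam = 0 /\ M <= `|complex.Im lam|)
    (hf : stieltjes_prod2 f) (hF : analytic_extension f F)
    (hf0 : exists2 x : R, 0 < x & f x != 0) :
  (0 < limsup_sqrtn_t (fun n t =>
     op_norm (op_comp (hp_calculus T F) (euler_error T A n t))
       * ((f (Num.sqrt n%:R / t))^-1)%:E))%E.
Proof.
have [M M0 hM] := c0_semigroup_sg hT hTb.
have hd := dense_range hA hran; have [x0 x00 fx0] := hf0.
apply: (@lt_le_trans _ _ (96^-1 : R)%:E); first by rewrite lte_fin invr_gt0.
rewrite /limsup_sqrtn_t; set S := (fun r : R => ereal_sup _).
have cS : S r @[r --> +oo] --> ereal_inf (range S).
  apply: nonincreasing_cvge => r s rs; apply: ereal_sup_le => _ [p [p1 p2 p3] <-].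
  by exists p => //; split=> //; exact: le_trans p3.
apply: lime_ge; first by apply/cvg_ex; exists (ereal_inf (range S)).
apply: nearW => r.
have [lam hs [Rl hl]] := hspec (Num.max r 1).
have [rl l1] : r <= `|complex.Im lam| /\ 1 <= `|complex.Im lam|.
  by move: hl; rewrite ge_max => /andP[].
have ae : 0 < `|complex.Im lam| by exact: lt_le_trans l1.
have e0 : complex.Im lam != 0 by rewrite -normr_gt0.
have fe := stieltjes_prod2_gt0 hf x00 fx0 ae.
have key := calculus_norm_lower hM M0 hA hd hf hF hs Rl e0 fe.
set eta := `|complex.Im lam| in rl ae fe key.
have sq : Num.sqrt 1%:R / eta^-1 = eta by rewrite sqrtr1 invrK mul1r.
apply: (@le_trans _ _ (op_norm (op_comp (hp_calculus T F) (euler_error T A 1 eta^-1)) *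
   ((f (Num.sqrt 1%:R / eta^-1))^-1)%:E)%E); last first.
  apply: ereal_sup_ubound; exists (1%N, eta^-1) => //; split=> //=; first by rewrite invr_gt0.
  by rewrite sq.
rewrite sq; have fi : (0 < ((f eta)^-1)%:E)%E by rewrite lte_fin invr_gt0.
have -> : (96^-1 : R)%:E = ((f eta / 96)%:E * ((f eta)^-1)%:E)%E.
  by rewrite -EFinM mulrAC divff ?mul1r // lt0r_neq0.
by rewrite lee_pmul2r.
Qed.
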